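(* In the setting described in the context, let $h_0\in L^1(\mathbb{R}^M,e^{-\pi|\mathbf v|^2}\mathrm{d}\mathbf v)$ be nonnegative with $\mathcal S(h_0)<\infty$. Then for all $k$, $\underline\alpha$, $\underline\theta$, $$\mathcal S\big(g_k(\cdot,\underline\alpha,\underline\theta)\big)\le\sum_{\sigma\subset\{1,\dots,M\}}\prod_{i\in\sigma^c}\gamma_{k,i}^2\prod_{j\in\sigma}(1-\gamma_{k,j}^2)\int_{\mathbb{R}^M}h_0(\mathbf v)\log h^\sigma_{0,U_k(\underline\alpha,\underline\theta)}\big(P_{\sigma^c}U_k(\underline\alpha,\underline\theta)^T\mathbf v\big)e^{-\pi|\mathbf v|^2}\,\mathrm{d}\mathbf v,$$ where $\sigma^c$ is the complement of $\sigma$ in $\{1,\dots,M\}$.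
   Context: Setting: $M,N$ positive integers, $\lambda_S,\lambda_R,\mu>0$, $\rho$ a probability density on $[-\pi,\pi]$. For a pair $\alpha=(i,j)$, $1\le i<j\le M+N$, $r_\alpha(\theta)$ is the rotation of $\mathbb{R}^{M+N}$ in the $(i,j)$ coordinate plane such that $r_\alpha(\theta)^{-1}\mathbf z$ has $i$-th coordinate $z_i\cos\theta-z_j\sin\theta$ and $j$-th coordinate $z_i\sin\theta+z_j\cos\theta$. For $\underline\alpha=(\alpha_1,\dots,\alpha_k)$, $\underline\theta=(\theta_1,\dots,\theta_k)$, let $A_k(\underline\alpha,\underline\theta)$ be the upper-left $M\times M$ block of $[\prod_{l=1}^kr_{\alpha_l}(\theta_l)]^{-1}$, with singular value decomposition $A_k=U_k\Gamma_kV_k^T$, $U_k,V_k$ orthogonal, $\Gamma_k=\mathrm{diag}(\gamma_{k,1},\dots,\gamma_{k,M})$, $\gamma_{k,j}\in[0,1]$. For an orthogonal $U$ let $h_{0,U}(\mathbf x)=h_0(U\mathbf x)$, and define $$g_k(\mathbf v,\underline\alpha,\underline\theta)=\int_{\mathbb{R}^M}h_{0,U_k}\big(\Gamma_k\mathbf v+(I_M-\Gamma_k^2)^{1/2}\mathbf w\big)e^{-\pi|\mathbf w|^2}\,\mathrm{d}\mathbf w.$$ Entropy: $\mathcal S(h)=\int h\log h\,e^{-\pi|\mathbf x|^2}\mathrm{d}\mathbf x$ (over the appropriate Euclidean space). For a function $h$ of $M$ variables and $\sigma\subset\{1,\dots,M\}$, the marginal $h^\sigma$ is the function of the variables $v_j$,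 $j\in\sigma^c$, obtained by integrating $h$ against $\prod_{j\in\sigma}e^{-\pi v_j^2}\mathrm{d}v_j$. $P_{\sigma^c}:\mathbb{R}^M\to\mathbb{R}^{|\sigma^c|}$ is the coordinate projection $\mathbf v\mapsto(v_j)_{j\in\sigma^c}$. *)

(* Defs.v *)
From HB Require Import structures.
From mathcomp Require Import all_boot all_order all_algebra.
From mathcomp Require Import all_classical all_reals all_analysis.

Set Implicit Arguments.
Unset Strict Implicit.
Unset Printing Implicit Defensive.

Import Order.TTheory GRing.Theory Num.Theory.
Import numFieldNormedType.Exports.

Local Open Scope classical_set_scope.
Local Open Scope ring_scope.

Section Defs.
Variable R : realType.

(** Points of R^n are n-tuples of reals (with the tuple sigma-algebra
    generated by the coordinates, from the library). *)

Definition gauss1 : set (measurableTypeR R) -> \bar R :=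
  fun A => (\int[@lebesgue_measure R]_(x in A) (expR (- pi * x ^+ 2))%:E)%E.

(** The measure e^{-pi |x|^2} dx on R^n, built as the n-fold product of
    gauss1: on R^(n+1) = R x R^n it is the image of gauss1 \x gauss n under
    (x, t) |-> x :: t. *)
Local Unset Implicit Arguments.
Fixpoint gauss (n : nat) : set (n.-tuple R) -> \bar R :=
  match n with
  | 0 => (@dirac _ (0.-tuple R) ([tuple] : 0.-tuple R) R)
  | n'.+1 => pushforward (gauss1 \x gauss n')%E
               (fun p : R * n'.-tuple R => [tuple of p.1 :: p.2])
  end.
Local Set Implicit Arguments.

(** Entropy S(h) = \int h log h e^{-pi|x|^2} dx  (with 0 log 0 = 0, since ln 0 = 0). *)
Definition entropy (n : nat) (h : n.-tuple R -> R) : \bar R :=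
  (\int[gauss n]_x (h x * ln (h x))%:E)%E.

Definition vec (n : nat) (t : n.-tuple R) : 'cV[R]_n := \col_i tnth t i.
Definition tup (n : nat) (v : 'cV[R]_n) : n.-tuple R := [tuple v i 0 | i < n].

Definition orthogonal_mx (n : nat) (U : 'M[R]_n) : Prop :=
  U^T *m U = 1%:M /\ U *m U^T = 1%:M.

Definition rot_inv (n : nat) (i j : 'I_n) (t : R) : 'M[R]_n :=
  \matrix_(a, b)
    if a == i then
      (if b == i then cos t else if b == j then - sin t else 0)
    else if a == j then
      (if b == i then sin t else if b == j then cos t else 0)
    else (a == b)%:R.

Definition rot (n : nat) (i j : 'I_n) (t : R) : 'M[R]_n :=
  invmx (rot_inv i j t).

Definition A_k (M N k : nat) (alpha : 'I_k -> 'I_(M + N) * 'I_(M + N))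
    (theta : 'I_k -> R) : 'M[R]_M :=
  ulsubmx (invmx (\prod_(l < k) rot (alpha l).1 (alpha l).2 (theta l))).

Definition hU (M : nat) (h : M.-tuple R -> R) (U : 'M[R]_M) : M.-tuple R -> R :=
  fun x => h (tup (U *m vec x)).

Definition g_fun (M : nat) (h0 : M.-tuple R -> R) (U : 'M[R]_M)
    (gamma : 'I_M -> R) : M.-tuple R -> R :=
  fun v => fine (\int[gauss M]_w
    (hU h0 U (tup (diag_mx (\row_i gamma i) *m vec v
        + diag_mx (\row_i Num.sqrt (1 - gamma i ^+ 2)) *m vec w)))%:E)%E.

(** Coordinate projection P_S : R^M -> R^{|S|}, v |-> (v_j)_{j in S}
    (coordinates of S listed in increasing order). *)
Definition proj_coord (M : nat) (S : {set 'I_M}) (v : M.-tuple R) : #|S|.-tuple R :=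
  [tuple tnth v (enum_val i) | i < #|S|].

Definition merge (M : nat) (S : {set 'I_M}) (w : #|S|.-tuple R)
    (u : #|~: S|.-tuple R) : M.-tuple R :=
  [tuple if i \in S then nth 0 w (index i (enum S))
         else nth 0 u (index i (enum (~: S))) | i < M].

Definition marginal (M : nat) (sigma : {set 'I_M}) (h : M.-tuple R -> R)
    (w : #|~: sigma|.-tuple R) : R :=
  fine (\int[gauss #|~: ~: sigma|]_u (h (merge w u))%:E)%E.

End Defs.

Arguments marginal {R M} sigma h w.
Arguments merge {R M} S w u.

(* Main.v *)
(* After the rotation by U, g_k is obtained from h = h_0 o U by smoothing each
   coordinate separately with the Mehler operator of parameter gamma_i, and the
   marginals of h are the same smoothings with parameters 0 and 1.  It suffices
   to show that, coordinate by coordinate, with c^2 + s^2 = 1 and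
   G(x) = \int h(c x + s w) e^{-pi w^2} dw,
     S(G) <= c^2 S(h) + (1 - c^2) m log m,    m = \int h e^{-pi x^2} dx.
   Expanding this inequality, which is affine in each gamma_i^2, over the M
   coordinates gives the sum over sigma.

   The one-dimensional inequality is proved by mass transport.  Let h have mass
   one, and let T be the monotone map sending e^{-pi x^2} dx to h e^{-pi x^2} dx.
   In the rotated coordinates y = c x + s z, w = c z - s x, the map
   y |-> c T(x) + s z has derivative c^2 T'(x) + s^2 for fixed w, and by
   concavity log (c^2 T' + s^2) >= c^2 log T'.  Since c T(x) + s z has density G,
   this yields S(G) - c^2 S(h) <= \int G e^{-pi y^2} dy - 1 = 0.  This is done for
   continuous h bounded away from 0 and infinity; the general case follows by
   density and by Fatou's lemma applied to truncations.

   Entropies are handled through psi x = x log x + 1 >= 0, extended by +oo, so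
   that all integrals are integrals of nonnegative functions. *)

Require Import Defs.
From HB Require Import structures.
From mathcomp Require Import all_boot all_order all_algebra.
From mathcomp Require Import all_classical all_reals all_analysis.
From mathcomp Require Import measurable_realfun.
From mathcomp Require Import ring lra.

Import Order.TTheory GRing.Theory Num.Theory.
Import numFieldNormedType.Exports.

Local Open Scope classical_set_scope.
Local Open Scope ring_scope.

(** * The Gaussian measure *)

Section Gauss1.
Context {R : realType}.
Notation mu := (@lebesgue_measure R).
Local Open Scope ereal_scope.

(** In the transport step, with [phi] the Gaussian density, [log T'] is
    [log phi(x) - log h(T x) - log phi(T x)]. As [c^2 + s^2 = 1], the quadratic exponents cancel up
    to [2 pi c s z (T x - x)], which is odd in [z]. Its integral vanishes by reflection, and finite
    first moments are what makes this cancellation legitimate. The final [- 1] comes from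
    [ln y <= y - 1], taken at the ratio of the transported density to the Gaussian one. Substitution
    along a map of the line is proved as an inequality only. For the transported density this is the
    useful direction; for bounded test functions it becomes an equality by applying it to the
    complement as well. The shift by 1 in [psi] survives every step because the Gaussian measure is
    a probability and the weights of the expansion sum to one, so that a single 1 stands on each
    side at the end. Infinite values are allowed throughout, and the convention [0 * +oo = 0] is why
    the parameters 0 and 1 need separate care. *)

Definition gauss_density (x : R) : R := expR (- pi * x ^+ 2)%R.

Lemma gauss_density_gt0 x : (0 < gauss_density x)%R.
Proof. exact: expR_gt0. Qed.

Lemma gauss_density_le1 x : (gauss_density x <= 1)%R.
Proof.
by rewrite /gauss_density -[leRHS]expR0 ler_expR mulNr oppr_le0 mulr_ge0 ?pi_ge0 ?sqr_ge0.
Qed.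

Lemma continuous_gauss_density : continuous gauss_density.
Proof.
move=> x; apply: (cvg_comp _ expR); last exact: continuous_expR.
by apply: cvgM; [exact: cvg_cst|exact: sqr_continuous].
Qed.

Lemma measurable_gauss_density : measurable_fun [set: R] gauss_density.
Proof. by apply: continuous_measurable_fun; exact: continuous_gauss_density. Qed.

(** The variance [1 / (2 pi)] is the one for which the exponent is [- pi x^2] and the peak is 1. The
    measure and probability structures of [gauss1] are transferred through this identification. *)
Lemma gauss1_normal : @gauss1 R = normal_prob 0 (Num.sqrt (pi *+ 2))^-1.
Proof.
apply/funext => A; rewrite /gauss1 /normal_prob; apply: eq_integral => x _.
have s0 : (0 < pi *+ 2 :> R)%R by rewrite mulrn_wgt0// pi_gt0.
rewrite normal_pdfE ?invr_eq0 ?gt_eqF ?sqrtr_gt0//.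
rewrite /normal_peak /normal_fun exprVn sqr_sqrtr ?ltW// subr0 -[(_ * pi *+ 2)%R]mulrnAr.
rewrite mulVf ?gt_eqF// sqrtr1 invr1 mul1r; congr (expR _)%:E.
have p0 : (pi != 0 :> R)%R by rewrite gt_eqF ?pi_gt0.
have -> : ((pi *+ 2)^-1 *+ 2 = pi^-1 :> R)%R.
  by rewrite -[(pi *+ 2)%R]mulr_natr invfM -[LHS]mulr_natr mulfVK.
by rewrite invrK mulNr mulrC mulNr.
Qed.

Let gauss10 : @gauss1 R set0 = 0.
Proof. by rewrite gauss1_normal measure0. Qed.

Let gauss1_ge0 A : 0 <= @gauss1 R A.
Proof. by rewrite gauss1_normal measure_ge0. Qed.

Let gauss1_sigma_additive : semi_sigma_additive (@gauss1 R).
Proof. by rewrite gauss1_normal; exact: measure_semi_sigma_additive. Qed.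

HB.instance Definition _ := isMeasure.Build _ _ _ (@gauss1 R)
  gauss10 gauss1_ge0 gauss1_sigma_additive.

Let gauss1_setT : @gauss1 R [set: _] = 1%E.
Proof. by rewrite gauss1_normal probability_setT. Qed.

HB.instance Definition _ :=
  @Measure_isProbability.Build _ _ R (@gauss1 R) gauss1_setT.

End Gauss1.

Section Density.
Context d (T : measurableType d) (R : realType).
Variables (m nu : {measure set T -> \bar R}) (k : T -> R).
Hypothesis mk : measurable_fun setT k.
Hypothesis k0 : forall x, 0 <= k x.
Hypothesis nuE : forall A, measurable A -> nu A = (\int[m]_(x in A) (k x)%:E)%E.
Local Open Scope ereal_scope.

Import HBNNSimple.

(** Both sides are increasing limits along the simple approximations of [f]; on an indicator the
    identity is [nuE]. *)
Lemma ge0_integral_density (f : T -> \bar R) :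
  measurable_fun setT f -> (forall x, 0 <= f x) ->
  \int[nu]_x f x = \int[m]_x (f x * (k x)%:E).
Proof.
move=> mf f0.
have mkE : measurable_fun setT (fun x => (k x)%:E) by apply/measurable_EFinP.
pose g := nnsfun_approx measurableT mf.
have gf x : (fun n => (g n x)%:E) @ \oo --> f x by exact: cvg_nnsfun_approx.
have mg n : measurable_fun setT (fun x => (g n x)%:E).
  by apply/measurable_EFinP.
have ndg : forall x, {homo (fun n => (g n x)%:E) : n m / (n <= m)%N >-> n <= m}.
  by move=> x a b ab; rewrite lee_fin; exact/lefP/nd_nnsfun_approx.
transitivity (limn (fun n => \int[nu]_x (g n x)%:E)).
  rewrite -monotone_convergence//.
  - by apply: eq_integral => x _; apply/esym/cvg_lim.
  - by move=> n x _; rewrite lee_fin fun_ge0.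
transitivity (limn (fun n => \int[m]_x ((g n x)%:E * (k x)%:E))).
  congr (limn _); apply/funext => n.
  under eq_integral do rewrite fimfunE -fsumEFin//.
  rewrite ge0_integral_fsum//; last 2 first.
    by move=> r; exact/measurable_EFinP/measurableT_comp.
    by move=> r x _; rewrite EFinM nnfun_muleindic_ge0.
  under [RHS]eq_integral.
    move=> x xD; rewrite fimfunE -fsumEFin// ge0_mule_fsuml; last first.
      by move=> r; rewrite EFinM nnfun_muleindic_ge0.
    over.
  rewrite [RHS]ge0_integral_fsum//; last 2 first.
    - by move=> r; apply: emeasurable_funM => //; exact/measurable_EFinP/measurableT_comp.
    - move=> r x _; rewrite mule_ge0 ?(lee_fin _ (k x)) ?k0//.
      by rewrite EFinM nnfun_muleindic_ge0.
  apply: eq_fsbigr => r rg.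
  have r0 : (0 <= r)%R by move: rg; rewrite inE => -[x _ <-]; exact: fun_ge0.
  under eq_integral do rewrite EFinM.
  under [RHS]eq_integral do rewrite EFinM -muleA.
  have mA : measurable (g n @^-1` [set r]) by [].
  rewrite ge0_integralZl_EFin//; last first.
    by apply/measurable_EFinP; exact: measurable_indic.
  rewrite [RHS]ge0_integralZl_EFin//; last 2 first.
    - by move=> x _; rewrite mule_ge0// lee_fin.
    - by apply: emeasurable_funM => //; apply/measurable_EFinP; exact: measurable_indic.
  congr (_ * _); rewrite integral_indic// setIT nuE//.
  rewrite integral_mkcond; apply: eq_integral => x _.
  by rewrite epatch_indic muleC.
rewrite -monotone_convergence//.
- by apply: eq_integral => x _; apply/cvg_lim => //; apply: cvgeMr => //.
- by move=> n; apply: emeasurable_funM.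
- by move=> n x _; rewrite mule_ge0// lee_fin ?fun_ge0.
- by move=> x _ a b ab; rewrite lee_wpmul2r ?lee_fin//; exact: ndg.
Qed.

End Density.

Section GaussDensity.
Context {R : realType}.
Notation mu := (@lebesgue_measure R).
Local Open Scope ereal_scope.

Lemma ge0_integral_gauss1 (f : R -> \bar R) :
  measurable_fun setT f -> (forall x, 0 <= f x) ->
  \int[@gauss1 R]_x f x = \int[mu]_x (f x * (gauss_density x)%:E).
Proof.
move=> mf f0; apply: ge0_integral_density => //.
  exact: measurable_gauss_density.
by move=> x; exact: ltW (gauss_density_gt0 x).
Qed.

Lemma ge0_integral_lebesgue_shift (f : R -> \bar R) (a : R) :
  measurable_fun setT f -> (forall x, 0 <= f x) ->
  \int[mu]_x f (x + a)%R = \int[mu]_x f x.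
Proof.
move=> mf f0.
have ma : measurable_fun setT (fun x : measurableTypeR R => (x + a)%R : measurableTypeR R).
  by apply: measurable_funD.
rewrite -[LHS]/(\int[mu]_x (f \o (fun x => (x + a)%R)) x).
rewrite -[X in \int[mu]_(x in X) _](preimage_setT (fun x : R => (x + a)%R)).
rewrite -(@ge0_integral_pushforward _ _ (measurableTypeR R) (measurableTypeR R) R _ ma)//.
(* The image of Lebesgue measure under the translation agrees with it on half-open intervals, and
   these determine it. *)
apply: eq_measure_integral => A mA _; apply/esym/lebesgue_measure_unique => //.
move=> _ [[u v] _ <-]; transitivity (mu `](u - a)%R, (v - a)%R]%classic); last first.
  congr (mu _).
  by apply/seteqP; split => x /=; rewrite !in_itv/= ltrBlDr lerBrDr.
rewrite [RHS]lebesgue_measure_itv [LHS]lebesgue_measure_itv/=.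
by rewrite !lte_fin ltrD2r -!EFinD; congr (if _ then _%:E else _); ring.
Qed.

Lemma ge0_integral_lebesgueN (f : R -> \bar R) :
  measurable_fun setT f -> (forall x, 0 <= f x) ->
  \int[mu]_x f (- x)%R = \int[mu]_x f x.
Proof.
move=> mf f0.
have ma : measurable_fun setT (fun x : measurableTypeR R => (- x)%R : measurableTypeR R).
  by apply: measurableT_comp.
rewrite -[LHS]/(\int[mu]_x (f \o (fun x => (- x)%R)) x).
rewrite -[X in \int[mu]_(x in X) _](preimage_setT (fun x : R => (- x)%R)).
rewrite -(@ge0_integral_pushforward _ _ (measurableTypeR R) (measurableTypeR R) R _ ma)//.
by apply: eq_measure_integral => A mA _; exact: lebesgue_measureN.
Qed.

End GaussDensity.

Section GaussMeasure.
Context {R : realType}.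
Local Open Scope ereal_scope.

Lemma measurable_cons_pair n :
  measurable_fun [set: measurableTypeR R * n.-tuple R]
    (fun p => [tuple of p.1 :: p.2] : n.+1.-tuple R).
Proof. exact: (@measurable_cons _ _ (R * n.-tuple R)%type R fst n snd). Qed.

(** [gauss] is a recursion on bare set functions, so countable additivity needs an induction
    carrying a genuine probability at each stage: the law of [X] under the product of [gauss1] with
    the previous one. *)
Let gauss_is_probability n :
  {P : probability (n.-tuple R) R | P = gauss R n :> (set _ -> \bar R)}.
Proof.
elim: n => [|n [P PE]]; first by exists (@dirac _ (0.-tuple R) [tuple] R).
pose X := mfun_Sub (mem_set (measurable_cons_pair n)).
exists (distribution (@gauss1 R \x P) X).
by rewrite /= -PE.
Qed.

Let gauss0 n : gauss R n set0 = 0.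
Proof. by case: (gauss_is_probability n) => P <-; exact: measure0. Qed.

Let gauss_ge0 n A : 0 <= gauss R n A.
Proof. by case: (gauss_is_probability n) => P <-; exact: measure_ge0. Qed.

Let gauss_sigma_additive n : semi_sigma_additive (gauss R n).
Proof.
by case: (gauss_is_probability n) => P <-; exact: measure_semi_sigma_additive.
Qed.

HB.instance Definition _ n := isMeasure.Build _ _ _ (gauss R n)
  (gauss0 n) (@gauss_ge0 n) (@gauss_sigma_additive n).

Let gauss_setT n : gauss R n [set: _] = 1%E.
Proof. by case: (gauss_is_probability n) => P <-; exact: probability_setT. Qed.

HB.instance Definition _ n :=
  @Measure_isProbability.Build _ _ R (gauss R n) (@gauss_setT n).

Lemma ge0_integral_gauss_cons n (f : n.+1.-tuple R -> \bar R) :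
  measurable_fun setT f -> (forall x, 0 <= f x) ->
  \int[gauss R n.+1]_x f x =
  \int[@gauss1 R]_x \int[gauss R n]_t f [tuple of x :: t].
Proof.
move=> mf f0; have mc := measurable_cons_pair n.
transitivity (\int[@gauss1 R \x gauss R n]_p f [tuple of p.1 :: p.2]).
  have E := ge0_integral_pushforward mc (@gauss1 R \x gauss R n) measurableT mf (fun y _ => f0 y).
  by rewrite preimage_setT in E; exact: E.
rewrite fubini_tonelli1//.
exact: (measurableT_comp mf mc).
Qed.

Lemma ge0_integral_gauss_nil (f : 0.-tuple R -> \bar R) :
  measurable_fun setT f -> \int[gauss R 0]_x f x = f [tuple].
Proof. by move=> mf; rewrite /= integral_dirac// diracT mul1e. Qed.

End GaussMeasure.


Section TonelliMeasurability.
Context d1 d2 (T1 : measurableType d1) (T2 : measurableType d2) (R : realType).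
Variable m : {sigma_finite_measure set T2 -> \bar R}.

Lemma measurable_fun_integral_param (f : T1 -> T2 -> \bar R) :
  measurable_fun setT (fun p : T1 * T2 => f p.1 p.2) -> (forall x y, (0 <= f x y)%E) ->
  measurable_fun setT (fun x => \int[m]_y f x y)%E.
Proof.
move=> mf f0.
have := @measurable_fun_fubini_tonelli_F _ _ _ _ _ m (fun p => f p.1 p.2).
by rewrite /fubini_F; apply.
Qed.

End TonelliMeasurability.

(** * Invariance of the Lebesgue and Gaussian measures under plane rotations *)

Section Rot2.
Context {R : realType}.
Notation mu := (@lebesgue_measure R).
Notation gauss1 := (@gauss1 R).
Local Open Scope ereal_scope.
Implicit Type f : R -> R -> \bar R.

Lemma lebesgue_swap f :
  measurable_fun setT (fun p : R * R => f p.1 p.2) -> (forall x y, 0 <= f x y) ->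
  \int[mu]_x \int[mu]_y f x y = \int[mu]_y \int[mu]_x f x y.
Proof.
move=> mf f0.
exact: (@fubini_tonelli _ _ (measurableTypeR R) (measurableTypeR R) R mu mu
   (fun p : measurableTypeR R * measurableTypeR R => f p.1 p.2)).
Qed.

(* Three shears make a rotation: with [t = b / (1 + a)] and [a^2 + b^2 = 1],
   (x, y) |-> (x - t y, y) |-> (x, y + b x) |-> (x - t y, y). *)
Lemma ge0_integral_lebesgue_rot f (a b : R) : (a ^+ 2 + b ^+ 2 = 1)%R -> a != (-1)%R ->
  measurable_fun setT (fun p : R * R => f p.1 p.2) -> (forall x y, 0 <= f x y) ->
  \int[mu]_x \int[mu]_y f (a * x - b * y)%R (b * x + a * y)%R =
  \int[mu]_x \int[mu]_y f x y.
Proof.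
move=> ab a1 mf f0.
have a10 : (1 + a)%R != 0%R by rewrite addrC addr_eq0.
pose t : R := (b / (1 + a))%R.
have mf2 (u v : R * R -> R) : measurable_fun setT u -> measurable_fun setT v ->
    measurable_fun setT (fun p => f (u p) (v p)).
  move=> mu mv.
  exact: (measurableT_comp mf (measurable_fun_pair mu mv)).
(* For fixed [y] this is a translation in [x], so exchanging the integrals reduces it to translation
   invariance. *)
have shear1 g : measurable_fun setT (fun p : R * R => g p.1 p.2) -> (forall x y, 0 <= g x y) ->
    \int[mu]_x \int[mu]_y g (x - t * y)%R y = \int[mu]_x \int[mu]_y g x y.
  move=> mg g0; rewrite (lebesgue_swap (fun x y => g (x - t * y)%R y)); last 2 first.
    apply: (measurableT_comp mg (measurable_fun_pair _ _)) => //=.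
    by apply: measurable_funB => //; apply: measurable_funM.
    by move=> x y; exact: g0.
  rewrite (lebesgue_swap g); [|exact: mg|exact: g0].
  apply: eq_integral => y _; apply: (@ge0_integral_lebesgue_shift _ (fun x => g x y)) => //.
  exact: (measurableT_comp mg (measurable_fun_pair _ _)).
have shear2 g : measurable_fun setT (fun p : R * R => g p.1 p.2) -> (forall x y, 0 <= g x y) ->
    \int[mu]_x \int[mu]_y g x (y + b * x)%R = \int[mu]_x \int[mu]_y g x y.
  move=> mg g0; apply: eq_integral => x _.
  apply: (@ge0_integral_lebesgue_shift _ (fun y => g x y)) => //.
  exact: (measurableT_comp mg (measurable_fun_pair _ _)).
have m1 : measurable_fun [set: R * R] (fun p => p.1 - t * p.2)%R.
  by apply: measurable_funB => //; apply: measurable_funM.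
have m2 : measurable_fun [set: R * R] (fun p => p.2 + b * p.1)%R.
  by apply: measurable_funD => //; apply: measurable_funM.
have m3 : measurable_fun [set: R * R] (fun p => p.1 - t * (p.2 + b * p.1))%R.
  apply: measurable_funB => //; apply: measurable_funM; first exact: measurable_cst.
  exact: m2.
transitivity (\int[mu]_x \int[mu]_y f (x - t * y)%R y); last first.
  by apply: shear1; [exact: mf|exact: f0].
transitivity (\int[mu]_x \int[mu]_y f (x - t * (y + b * x))%R (y + b * x)%R); last first.
  apply: (shear2 (fun x y => f (x - t * y)%R y)) => [|x y]; last exact: f0.
  by apply: mf2; [exact: m1|exact: measurable_snd].
transitivity (\int[mu]_x \int[mu]_y f (x - t * y - t * (y + b * (x - t * y)))%R (y + b * (x - t * y))%R); last first.
  apply: (shear1 (fun x y => f (x - t * (y + b * x)) (y + b * x))%R) => [|x y]; last exact: f0.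
  by apply: mf2; [exact: m3|exact: m2].
have tb : (t * b = 1 - a)%R.
  rewrite /t mulrAC -expr2; have -> : (b ^+ 2 = (1 - a) * (1 + a))%R by rewrite -[(b ^+ 2)%R](addKr (a ^+ 2)%R) ab; ring.
  by rewrite mulfK.
have ta : (t * a = b - t)%R by rewrite /t; field.
apply: eq_integral => x _; apply: eq_integral => y _; congr f.
  rewrite [RHS](_ : _ = (1 - t * b) * x - (t + t * (1 - t * b)) * y)%R; last by ring.
  rewrite tb; have -> : (t + t * (1 - (1 - a)) = b)%R by rewrite subKr ta addrC subrK.
  by rewrite subKr.
rewrite [RHS](_ : _ = b * x + (1 - t * b) * y)%R; last by ring.
by rewrite tb subKr.
Qed.

(** The weight [gauss_density x * gauss_density y] depends on [x^2 + y^2] only, so the Lebesgue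
    statement applies to [f] times this weight. *)
Lemma ge0_integral_gauss1_rot f (a b : R) : (a ^+ 2 + b ^+ 2 = 1)%R -> a != (-1)%R ->
  measurable_fun setT (fun p : R * R => f p.1 p.2) -> (forall x y, 0 <= f x y) ->
  \int[gauss1]_x \int[gauss1]_y f (a * x - b * y)%R (b * x + a * y)%R =
  \int[gauss1]_x \int[gauss1]_y f x y.
Proof.
move=> ab a1 mf f0.
pose k x : \bar R := (gauss_density x)%:E.
have k0 x : 0 <= k x by rewrite lee_fin ltW// gauss_density_gt0.
have mk : measurable_fun setT k by apply/measurable_EFinP; exact: measurable_gauss_density.
have gaussE g : measurable_fun setT (fun p : R * R => g p.1 p.2) -> (forall x y, 0 <= g x y) ->
    \int[gauss1]_x \int[gauss1]_y g x y = \int[mu]_x \int[mu]_y (g x y * (k x * k y)).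
  move=> mg g0.
  have mgx x : measurable_fun setT (g x).
    exact: (measurableT_comp mg (measurable_fun_pair (measurable_cst x) (@measurable_id _ _ setT))).
  rewrite ge0_integral_gauss1; last 2 first.
  - exact: (@measurable_fun_integral_param _ _ R (measurableTypeR R) R gauss1 g).
  - by move=> x; apply: integral_ge0.
  apply: eq_integral => x _; rewrite ge0_integral_gauss1; [|exact: mgx|by []].
  rewrite -ge0_integralZr; last 4 first.
  - by [].
  - by apply: emeasurable_funM; [exact: mgx|exact: mk].
  - by move=> y _; apply: mule_ge0; [exact: g0|exact: k0].
  - exact: k0.
  by apply: eq_integral => y _; rewrite -muleA (muleC (k y)).
have m1 : measurable_fun [set: R * R] (fun p => a * p.1 - b * p.2)%R.
  by apply: measurable_funB; apply: measurable_funM.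
have m2 : measurable_fun [set: R * R] (fun p => b * p.1 + a * p.2)%R.
  by apply: measurable_funD; apply: measurable_funM.
rewrite gaussE; last 2 first.
- exact: (measurableT_comp mf (measurable_fun_pair m1 m2)).
- by move=> x y; exact: f0.
rewrite gaussE; [|exact: mf|exact: f0].
rewrite -(ge0_integral_lebesgue_rot (fun x y => f x y * (k x * k y)) _ _ ab a1); last 2 first.
- apply: emeasurable_funM; first exact: mf.
  by apply: emeasurable_funM; apply: (measurableT_comp mk).
- by move=> x y; rewrite !mule_ge0.
apply: eq_integral => x _; apply: eq_integral => y _; congr (_ * _).
rewrite /k -!EFinM /gauss_density -!expRD; congr (expR _)%:E.
rewrite -!mulrDr; congr (_ * _)%R.
rewrite [RHS](_ : _ = (a ^+ 2 + b ^+ 2) * (x ^+ 2 + y ^+ 2))%R; last by ring.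
by rewrite ab mul1r.
Qed.

Lemma ge0_integral_gauss1N (g : R -> \bar R) :
  measurable_fun setT g -> (forall x, 0 <= g x) ->
  \int[gauss1]_x g (- x)%R = \int[gauss1]_x g x.
Proof.
move=> mg g0.
have mgN : measurable_fun setT (fun x : R => g (- x)%R).
  by apply: (measurableT_comp mg); exact: (measurable_funN (@measurable_id _ _ setT)).
rewrite ge0_integral_gauss1; [|exact: mgN|by []].
rewrite ge0_integral_gauss1; [|exact: mg|by []].
rewrite -(ge0_integral_lebesgueN (fun x => g x * (gauss_density x)%:E)); last 2 first.
- by apply: emeasurable_funM => //; apply/measurable_EFinP; exact: measurable_gauss_density.
- by move=> x; rewrite mule_ge0// lee_fin ltW// gauss_density_gt0.
by apply: eq_integral => x _; rewrite /gauss_density sqrrN.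
Qed.

End Rot2.

Section ProbabilityIntegral.
Context d (T : measurableType d) (R : realType) (P : probability T R).

Lemma integral_probability_cst (k : \bar R) : (\int[P]_x k = k)%E.
Proof.
have := integral_cst P measurableT k.
by move=> ->; rewrite -[RHS]mule1; congr (_ * _)%E; exact: probability_setT.
Qed.

End ProbabilityIntegral.

Section IteratedIntegral.
Context d1 d2 (T1 : measurableType d1) (T2 : measurableType d2) (R : realType).
Variables (m1 : {sigma_finite_measure set T1 -> \bar R}) (m2 : {sigma_finite_measure set T2 -> \bar R}).
Implicit Types f g : T1 -> T2 -> \bar R.
Local Open Scope ereal_scope.

Lemma measurable_fun_slice f x : measurable_fun setT (fun p : T1 * T2 => f p.1 p.2) ->
  measurable_fun setT (f x).
Proof.
move=> mf.
exact: (measurableT_comp mf (measurable_fun_pair (measurable_cst x) (@measurable_id _ _ setT))).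
Qed.

Lemma ge0_iterated_integralD f g :
  measurable_fun setT (fun p : T1 * T2 => f p.1 p.2) -> (forall x y, 0 <= f x y) ->
  measurable_fun setT (fun p : T1 * T2 => g p.1 p.2) -> (forall x y, 0 <= g x y) ->
  \int[m1]_x \int[m2]_y (f x y + g x y) =
  \int[m1]_x \int[m2]_y f x y + \int[m1]_x \int[m2]_y g x y.
Proof.
move=> mf f0 mg g0; rewrite -ge0_integralD//; last 4 first.
- by move=> x _; exact: integral_ge0.
- exact: measurable_fun_integral_param.
- by move=> x _; exact: integral_ge0.
- exact: measurable_fun_integral_param.
by apply: eq_integral => x _; rewrite ge0_integralD//; exact: measurable_fun_slice.
Qed.

Lemma ge0_le_iterated_integral f g :
  measurable_fun setT (fun p : T1 * T2 => f p.1 p.2) -> (forall x y, 0 <= f x y) ->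
  measurable_fun setT (fun p : T1 * T2 => g p.1 p.2) ->
  (forall x y, f x y <= g x y) ->
  \int[m1]_x \int[m2]_y f x y <= \int[m1]_x \int[m2]_y g x y.
Proof.
move=> mf f0 mg fg.
have g0 x y : 0 <= g x y by exact: le_trans (fg x y).
apply: ge0_le_integral => //.
- by move=> x _; exact: integral_ge0.
- exact: measurable_fun_integral_param.
- exact: measurable_fun_integral_param.
- move=> x _; apply: ge0_le_integral => //; exact: measurable_fun_slice.
Qed.

Lemma ge0_tonelli f : measurable_fun setT (fun p : T1 * T2 => f p.1 p.2) -> (forall x y, 0 <= f x y) ->
  \int[m1]_x \int[m2]_y f x y = \int[m2]_y \int[m1]_x f x y.
Proof.
by move=> mf f0; exact: (@fubini_tonelli _ _ T1 T2 R m1 m2 (fun p => f p.1 p.2)).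
Qed.

End IteratedIntegral.

(** * Rotation invariance *)

Section TupleMeasurability.
Context d (T : measurableType d) (R : realType).

Lemma measurable_mktuple n (F : 'I_n -> T -> R) : (forall i, measurable_fun setT (F i)) ->
  measurable_fun setT (fun p => [tuple F i p | i < n]).
Proof.
move=> mF; apply/measurable_fun_tnthP => i.
by rewrite (_ : _ \o _ = F i)//; apply/funext => p /=; rewrite tnth_mktuple.
Qed.

Lemma measurable_tnth_comp n (f : T -> n.-tuple R) (i : 'I_n) : measurable_fun setT f ->
  measurable_fun setT (fun p => tnth (f p) i).
Proof. by move=> mf; exact: (measurableT_comp (measurable_tnth i) mf). Qed.

End TupleMeasurability.

Section Resampling.
Context {R : realType}.
Notation gauss1 := (@gauss1 R).
Notation gauss := (@gauss R).

Definition upd {n} (t : n.-tuple R) (i : 'I_n) (x : R) : n.-tuple R :=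
  [tuple if j == i then x else tnth t j | j < n].

Lemma tnth_upd n (t : n.-tuple R) i x j : tnth (upd t i x) j = if j == i then x else tnth t j.
Proof. by rewrite tnth_mktuple. Qed.

Lemma measurable_upd d (T : measurableType d) n (f : T -> n.-tuple R) (g : T -> R) (i : 'I_n) :
  measurable_fun setT f -> measurable_fun setT g ->
  measurable_fun setT (fun p => upd (f p) i (g p)).
Proof.
move=> mf mg; apply: measurable_mktuple => j; case: (j == i) => //.
exact: measurable_tnth_comp.
Qed.

Lemma upd_cons0 n (t : n.-tuple R) x y : upd [tuple of y :: t] ord0 x = [tuple of x :: t].
Proof.
apply: eq_from_tnth => j; rewrite tnth_upd.
by case: (unliftP ord0 j) => [k ->|->]; rewrite ?eqxx// ?tnthS.
Qed.

Lemma upd_consS n (t : n.-tuple R) x y (j : 'I_n) :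
  upd [tuple of y :: t] (lift ord0 j) x = [tuple of y :: upd t j x].
Proof.
apply: eq_from_tnth => i; rewrite tnth_upd.
by case: (unliftP ord0 i) => [k ->|->]; rewrite ?tnthS ?tnth_upd ?tnth0.
Qed.

Local Open Scope ereal_scope.

Lemma measurable_cons_fun d (T : measurableType d) n (f : T -> R) (g : T -> n.-tuple R) :
  measurable_fun setT f -> measurable_fun setT g ->
  measurable_fun setT (fun p => [tuple of f p :: g p]).
Proof. exact: measurable_cons. Qed.

(** Singles out any coordinate without permuting the factors of [gauss]: a one-dimensional statement
    at coordinate [i] passes to tuples by integration over [upd]. *)
Lemma ge0_integral_resample n (i : 'I_n) (f : n.-tuple R -> \bar R) :
  measurable_fun setT f -> (forall t, 0 <= f t) ->
  \int[gauss1]_x \int[gauss n]_t f (upd t i x) = \int[gauss n]_t f t.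
Proof.
elim: n i f => [[]//|n IHn i f mf f0].
rewrite [RHS]ge0_integral_gauss_cons//.
have mfu x : measurable_fun setT (fun t => f (upd t i x)).
  by apply: (measurableT_comp mf); exact: measurable_upd.
under eq_integral do rewrite ge0_integral_gauss_cons//.
(* At the head the overwritten value [y] disappears and integrates to a factor 1; elsewhere the two
   outer variables are exchanged and the induction acts on the tail. *)
case: (unliftP ord0 i) => [j ->|->]; last first.
  apply: eq_integral => x _.
  rewrite -[RHS](integral_probability_cst _ _ _ gauss1).
  by apply: eq_integral => y _; apply: eq_integral => t _; rewrite upd_cons0.
have mF : measurable_fun setT (fun p : R * R => \int[gauss n]_t f (upd [tuple of p.2 :: t] (lift ord0 j) p.1)).
  apply: (@measurable_fun_integral_param _ _ (R * R)%type (n.-tuple R) R (gauss n)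
    (fun p t => f (upd [tuple of p.2 :: t] (lift ord0 j) p.1))) => //.
  apply: (measurableT_comp mf); apply: measurable_upd.
    apply: measurable_cons_fun => //.
    exact: (measurableT_comp measurable_snd measurable_fst).
  exact: (measurableT_comp measurable_fst measurable_fst).
have F0 x y : 0 <= \int[gauss n]_t f (upd [tuple of y :: t] (lift ord0 j) x) by exact: integral_ge0.
transitivity (\int[gauss1]_y \int[gauss1]_x \int[gauss n]_t f (upd [tuple of y :: t] (lift ord0 j) x)).
  exact: (@ge0_tonelli _ _ (measurableTypeR R) (measurableTypeR R) R gauss1 gauss1 _ mF F0).
apply: eq_integral => y _.
have mfy : measurable_fun setT (fun t : n.-tuple R => f [tuple of y :: t]).
  by apply: (measurableT_comp mf); exact: measurable_cons_fun.
rewrite -(IHn j (fun t => f [tuple of y :: t]) mfy (fun t => f0 _)).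
by apply: eq_integral => x _; apply: eq_integral => t _; rewrite upd_consS.
Qed.

(** Induction on [k]: coordinate [e ord0] is resampled first, and injectivity of [e] keeps the other
    selected coordinates untouched by it. *)
Lemma ge0_integral_gauss_proj n k (e : 'I_k -> 'I_n) (f : k.-tuple R -> \bar R) : injective e ->
  measurable_fun setT f -> (forall t, 0 <= f t) ->
  \int[gauss n]_t f [tuple tnth t (e i) | i < k] = \int[gauss k]_u f u.
Proof.
elim: k e f => [|k IHk] e f inj_e mf f0.
  rewrite ge0_integral_gauss_nil// -[RHS](integral_probability_cst _ _ _ (gauss n)).
  by apply: eq_integral => t _; congr f; apply: eq_from_tnth => -[].
rewrite ge0_integral_gauss_cons//.
have mp : measurable_fun setT (fun t : n.-tuple R => [tuple tnth t (e i) | i < k.+1]).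
  by apply: measurable_mktuple => i; exact: measurable_tnth.
rewrite -(ge0_integral_resample n (e ord0)); last 2 first.
- exact: (measurableT_comp mf mp).
- by move=> t; exact: f0.
apply: eq_integral => x _.
rewrite -(IHk (e \o lift ord0) (fun u => f [tuple of x :: u])); last 3 first.
- by apply: inj_comp => //; exact: lift_inj.
- by apply: (measurableT_comp mf); exact: measurable_cons_fun.
- by move=> t; exact: f0.
apply: eq_integral => t _; congr f; apply: eq_from_tnth => i.
rewrite tnth_mktuple tnth_upd; case: (unliftP ord0 i) => [j ->|->].
  by rewrite tnthS tnth_mktuple (inj_eq inj_e)/=.
by rewrite eqxx tnth0.
Qed.

End Resampling.

Section OrthogonalInvariance.
Context {R : realType}.
Notation gauss1 := (@gauss1 R).
Notation gauss := (@gauss R).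

Lemma tupK n (v : 'cV[R]_n) : vec (tup v) = v.
Proof. by apply/colP => i; rewrite mxE tnth_mktuple. Qed.

Lemma vecK n (t : n.-tuple R) : tup (vec t) = t.
Proof. by apply: eq_from_tnth => i; rewrite tnth_mktuple mxE. Qed.

Lemma tnth_tup n (v : 'cV[R]_n) i : tnth (tup v) i = v i 0.
Proof. by rewrite tnth_mktuple. Qed.

Lemma vec_cons n x (t : n.-tuple R) : vec [tuple of x :: t] = col_mx x%:M (vec t) :> 'cV_(1 + n).
Proof.
apply/colP => i; rewrite mxE; case: (split_ordP i) => j ->.
  by rewrite col_mxEu mxE !ord1 (tnth_nth 0).
by rewrite col_mxEd mxE !(tnth_nth 0).
Qed.

Lemma measurable_lin m n (A : 'M[R]_(m, n)) :
  measurable_fun setT (fun t : n.-tuple R => tup (A *m vec t)).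
Proof.
apply: measurable_mktuple => i.
rewrite (_ : (fun _ => _) = fun t : n.-tuple R => \sum_j A i j * tnth t j); last first.
  by apply/funext => t; rewrite mxE; apply: eq_bigr => j _; rewrite mxE.
apply: measurable_sum => j; apply: measurable_funM => //; exact: measurable_tnth.
Qed.

(** Restricted to nonnegative functions, so that products and inverses need no integrability; signed
    integrands are recovered from their positive and negative parts. *)
Definition gauss_invariant {n} (A : 'M[R]_n) := forall f : n.-tuple R -> \bar R,
  measurable_fun setT f -> (forall t, (0 <= f t)%E) ->
  (\int[gauss n]_t f (tup (A *m vec t)) = \int[gauss n]_t f t)%E.

Lemma gauss_invariant_mul n (A B : 'M[R]_n) :
  gauss_invariant A -> gauss_invariant B -> gauss_invariant (A *m B).
Proof.
move=> iA iB f mf f0; rewrite -(iA _ mf f0) -(iB (fun t => f (tup (A *m vec t)))).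
- by apply: eq_integral => t _; rewrite tupK mulmxA.
- exact: (measurableT_comp mf (measurable_lin _ _ _)).
- by move=> t; exact: f0.
Qed.

Lemma gauss_invariant_inv n (A B : 'M[R]_n) : B *m A = 1%:M ->
  gauss_invariant A -> gauss_invariant B.
Proof.
move=> BA iA f mf f0; rewrite -(iA (fun t => f (tup (B *m vec t)))).
- by apply: eq_integral => t _; rewrite tupK mulmxA BA mul1mx vecK.
- exact: (measurableT_comp mf (measurable_lin _ _ _)).
- by move=> t; exact: f0.
Qed.

Lemma block_mx1_cons n (A : 'M[R]_n) x (t : n.-tuple R) :
  tup ((block_mx 1%:M 0 0 A : 'M[R]_(1 + n)) *m vec [tuple of x :: t]) =
  [tuple of x :: tup (A *m vec t)].
Proof.
by rewrite -[RHS]vecK !vec_cons mul_block_col !mul1mx !mul0mx addr0 add0r tupK.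
Qed.

Lemma gauss_invariant_lift n (A : 'M[R]_n) : gauss_invariant A ->
  gauss_invariant (block_mx 1%:M 0 0 A : 'M[R]_(1 + n)).
Proof.
move=> iA f mf f0; rewrite (ge0_integral_gauss_cons _ f mf f0).
rewrite (ge0_integral_gauss_cons _ _ (measurableT_comp mf (measurable_lin _ _ _)) (fun t => f0 _)).
apply: eq_integral => x _; rewrite -[RHS]iA; last 2 first.
- by apply: (measurableT_comp mf); exact: measurable_cons_fun.
- by move=> t; exact: f0.
apply: eq_integral => t _; congr f.
exact: block_mx1_cons.
Qed.

(** Rotations of the first two coordinates, their liftings to later coordinates and a sign in
    dimension one suffice to align any vector with the first axis. *)
Definition givens n (a b : R) : 'M[R]_(2 + n) :=
  block_mx (\matrix_(i < 2, j < 2)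
    (if i == j then a else if i == 0 then - b else b)) 0 0 1%:M.

Lemma ord2P (i : 'I_2) : i = 0 \/ i = 1.
Proof. by case: i => [[|[|//]] pi]; [left|right]; apply: val_inj. Qed.

Lemma vec_cons2 n x y (t : n.-tuple R) : vec [tuple of x :: [tuple of y :: t]] =
  col_mx (\col_(i < 2) if i == 0 then x else y) (vec t) :> 'cV_(2 + n).
Proof.
apply/colP => i; rewrite mxE; case: (@split_ordP 2 n i) => j ->.
  by rewrite col_mxEu mxE (tnth_nth 0); case: (ord2P j) => ->.
by rewrite col_mxEd mxE !(tnth_nth 0).
Qed.

Lemma givens_cons n (a b x y : R) (t : n.-tuple R) :
  tup (givens n a b *m vec [tuple of x :: [tuple of y :: t]]) =
  [tuple of (a * x - b * y) :: [tuple of (b * x + a * y) :: t]].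
Proof.
rewrite -[RHS]vecK !vec_cons2 /givens mul_block_col !mul0mx addr0 add0r mul1mx.
congr (tup (col_mx _ _)); apply/colP => i.
rewrite !mxE !big_ord_recl big_ord0 addr0 !mxE.
by case: (ord2P i) => -> /=; rewrite ?mulNr.
Qed.

Lemma givens_orth n (a b : R) : a ^+ 2 + b ^+ 2 = 1 -> orthogonal_mx (givens n a b).
Proof.
move=> ab; rewrite /orthogonal_mx /givens; set Q := \matrix_(_, _) _.
have QQ : Q^T *m Q = 1%:M.
  apply/matrixP => i j; rewrite !mxE !big_ord_recl big_ord0 addr0 !mxE.
  by case: (ord2P i) => ->; case: (ord2P j) => ->; rewrite /= -?val_eqE/= -?ab; ring.
have QQ' : Q *m Q^T = 1%:M by exact: mulmx1C.
rewrite tr_block_mx !trmx0 trmx1 !mulmx_block !mulmx0 !mul0mx !mulmx1 !addr0 !add0r.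
by rewrite QQ QQ' -scalar_mx_block.
Qed.

(** The half turn, where the shear factor [b / (1 + a)] is undefined, is two quarter turns. *)
Lemma gauss1_rot_invariant (f : R -> R -> \bar R) (a b : R) : a ^+ 2 + b ^+ 2 = 1 ->
  measurable_fun setT (fun p : R * R => f p.1 p.2) -> (forall x y, (0 <= f x y)%E) ->
  (\int[gauss1]_x \int[gauss1]_y f (a * x - b * y)%R (b * x + a * y)%R =
  \int[gauss1]_x \int[gauss1]_y f x y)%E.
Proof.
move=> ab mf f0; have [aE|aN] := eqVneq a (-1); last exact: ge0_integral_gauss1_rot.
have b0 : b = 0.
  by apply/eqP; rewrite -sqrf_eq0; apply/eqP; move: ab; rewrite aE; lra.
have h01 : (0 : R) ^+ 2 + 1 ^+ 2 = 1 by rewrite expr0n expr1n add0r.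
have n01 : (0 : R) != -1 by rewrite eq_sym oppr_eq0 oner_eq0.
rewrite -[RHS](ge0_integral_gauss1_rot f 0 1 h01 n01 mf f0).
have mg : measurable_fun setT (fun p : R * R => f (0 * p.1 - 1 * p.2) (1 * p.1 + 0 * p.2)).
  apply: (measurableT_comp mf (measurable_fun_pair _ _)).
    by apply: measurable_funB; apply: measurable_funM.
  by apply: measurable_funD; apply: measurable_funM.
rewrite -[RHS](ge0_integral_gauss1_rot (fun x y => f (0 * x - 1 * y) (1 * x + 0 * y)) 0 1 h01 n01 mg (fun x y => f0 _ _)).
apply: eq_integral => x _; apply: eq_integral => y _; rewrite aE b0; congr f; ring.
Qed.

Lemma gauss_invariant_givens n (a b : R) : a ^+ 2 + b ^+ 2 = 1 -> gauss_invariant (givens n a b).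
Proof.
move=> ab f mf f0.
have mcons : measurable_fun setT (fun p : (R * R) * n.-tuple R => [tuple of p.1.1 :: [tuple of p.1.2 :: p.2]]).
  apply: measurable_cons_fun; first exact: (measurableT_comp measurable_fst measurable_fst).
  apply: measurable_cons_fun; last exact: measurable_snd.
  exact: (measurableT_comp measurable_snd measurable_fst).
have mfG := measurableT_comp mf (measurable_lin _ _ (givens n a b)).
have two (g : n.+2.-tuple R -> \bar R) : measurable_fun setT g -> (forall t, (0 <= g t)%E) ->
    (\int[gauss n.+2]_t g t =
     \int[gauss1]_x \int[gauss1]_y \int[gauss n]_t g [tuple of x :: [tuple of y :: t]])%E.
  move=> mg g0; rewrite ge0_integral_gauss_cons//; apply: eq_integral => x _.
  rewrite ge0_integral_gauss_cons//.
  by apply: (measurableT_comp mg); exact: measurable_cons_fun.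
apply: (eq_trans (two _ mfG (fun t => f0 _))); apply: (eq_trans _ (esym (two _ mf f0))).
pose F x y := (\int[gauss n]_t f [tuple of x :: [tuple of y :: t]])%E.
have mF : measurable_fun setT (fun p : R * R => F p.1 p.2).
  apply: (@measurable_fun_integral_param _ _ (R * R)%type (n.-tuple R) R (gauss n)
    (fun p t => f [tuple of p.1 :: [tuple of p.2 :: t]])) => //.
  exact: (measurableT_comp mf mcons).
have F0 x y : (0 <= F x y)%E by exact: integral_ge0.
rewrite -[RHS](gauss1_rot_invariant F a b ab mF F0).
apply: eq_integral => x _; apply: eq_integral => y _; apply: eq_integral => t _.
by rewrite /= givens_cons.
Qed.

Lemma orthogonal_mx_mul n (A B : 'M[R]_n) : orthogonal_mx A -> orthogonal_mx B ->
  orthogonal_mx (A *m B).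
Proof.
move=> [A1 A2] [B1 B2]; split; rewrite trmx_mul.
  by rewrite mulmxA -(mulmxA B^T) A1 mulmx1.
by rewrite mulmxA -(mulmxA A) B2 mulmx1.
Qed.

Lemma orthogonal_mx_lift n (A : 'M[R]_n) : orthogonal_mx A ->
  orthogonal_mx (block_mx 1%:M 0 0 A : 'M[R]_(1 + n)).
Proof.
move=> [A1 A2]; rewrite /orthogonal_mx tr_block_mx !trmx0 trmx1 !mulmx_block.
by rewrite !mulmx0 !mul0mx !mulmx1 !addr0 !add0r A1 A2 -scalar_mx_block.
Qed.

(** Aligning the tail first leaves at most two nonzero entries [x] and [y], which one plane rotation
    merges into [r]. The sign condition sends a unit vector to the first basis vector itself and not
    to its opposite. *)
Lemma align_first_axis n (u : 'cV[R]_n.+1) : exists W : 'M[R]_n.+1,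
  [/\ orthogonal_mx W, gauss_invariant W, 0 <= (W *m u) 0 0 &
      forall i, i != 0 -> (W *m u) i 0 = 0].
Proof.
elim: n u => [|n IHn] u.
  (* Dimension one has no rotation; a sign does the job, and its invariance is the evenness of the
     Gaussian. *)
  pose e : R := if 0 <= u 0 0 then 1 else -1.
  have ee : e * e = 1 by rewrite /e; case: ifP; rewrite ?mulr1// mulrNN mulr1.
  exists e%:M; split.
  - by split; rewrite tr_scalar_mx -scalar_mxM ee.
  - move=> f mf f0; rewrite (ge0_integral_gauss_cons _ f mf f0).
    rewrite (ge0_integral_gauss_cons _ _ (measurableT_comp mf (measurable_lin _ _ _)) (fun t => f0 _)).
    pose g x : \bar R := f [tuple of x :: [tuple]].
    have mg : measurable_fun setT g.
      by apply: (measurableT_comp mf); apply: measurable_cons_fun.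
    transitivity (\int[gauss1]_x g (e * x)%R)%E.
      apply: eq_integral => x _; rewrite ge0_integral_gauss_nil; last first.
        apply: (measurableT_comp mf); apply: (measurableT_comp (measurable_lin _ _ _)).
        exact: measurable_cons_fun.
      congr f; apply: eq_from_tnth => i; rewrite tnth_tup mul_scalar_mx !mxE (ord1 i).
      by rewrite !(tnth_nth 0).
    transitivity (\int[gauss1]_x g x)%E.
      rewrite /e; case: ifP => _; first by apply: eq_integral => x _; rewrite mul1r.
      rewrite -[RHS]ge0_integral_gauss1N//; last by move=> x; exact: f0.
      by apply: eq_integral => x _; rewrite mulN1r.
    apply: eq_integral => x _; rewrite ge0_integral_gauss_nil//.
    by apply: (measurableT_comp mf); exact: measurable_cons_fun.
  - rewrite mul_scalar_mx mxE /e; case: ifP => [|/negbT]; rewrite ?mul1r//.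
    by rewrite -ltNge mulN1r oppr_ge0 => /ltW.
  - by move=> i; rewrite (ord1 i) eqxx.
have [W' [oW' iW' pW' zW']] := IHn (dsubmx (u : 'cV_(1 + n.+1))).
pose W1 : 'M[R]_(1 + n.+1) := block_mx 1%:M 0 0 W'.
pose x := u 0 0; pose y := (W' *m dsubmx (u : 'cV_(1 + n.+1))) 0 0.
have zW t : (forall i, tnth t i = 0) ->
    W1 *m u = vec [tuple of x :: [tuple of y :: t]] :> 'cV_(1 + n.+1).
  move=> t0; rewrite -[in LHS](vsubmxK (u : 'cV_(1 + n.+1))) mul_block_col !mul0mx addr0 add0r mul1mx.
  rewrite vec_cons; congr col_mx.
    by apply/colP => i; rewrite !mxE !ord1 mulr1n; congr (u _ _); apply: val_inj.
  apply/colP => i; rewrite [RHS]mxE; case: (unliftP ord0 i) => [k ->|->]; last by rewrite tnth0.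
  by rewrite zW'// tnthS t0.
have W1u := zW [tuple 0 | i < n] (fun i => tnth_mktuple _ i).
have oW1 : orthogonal_mx W1 by exact: orthogonal_mx_lift.
have iW1 : gauss_invariant W1 by exact: gauss_invariant_lift.
pose r := Num.sqrt (x ^+ 2 + y ^+ 2).
have xy0 : 0 <= x ^+ 2 + y ^+ 2 by rewrite addr_ge0// sqr_ge0.
have rr : r ^+ 2 = x ^+ 2 + y ^+ 2 by rewrite sqr_sqrtr.
have [r0|r0] := eqVneq r 0.
  have : x ^+ 2 + y ^+ 2 = 0 by rewrite -rr r0 expr0n.
  move/eqP; rewrite paddr_eq0 ?sqr_ge0// !sqrf_eq0 => /andP[/eqP x0 /eqP y0].
  have W1u0 i : (W1 *m u) i 0 = 0.
    rewrite W1u mxE; case: (unliftP ord0 i) => [k ->|->]; last by rewrite tnth0.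
    by rewrite tnthS; case: (unliftP ord0 k) => [l ->|->]; rewrite ?tnth0// tnthS tnth_mktuple.
  by exists W1; split=> //; rewrite W1u0.
have ab : (x / r) ^+ 2 + (- (y / r)) ^+ 2 = 1.
  by rewrite sqrrN !expr_div_n -mulrDl -rr divff// sqrf_eq0.
pose G : 'M[R]_n.+2 := givens n (x / r) (- (y / r)).
have GW : G *m W1 *m u = vec [tuple of r :: [tuple of 0 :: [tuple 0 | i < n]]].
  rewrite -mulmxA W1u -[LHS]tupK givens_cons; congr vec.
  have -> : x / r * x - - (y / r) * y = r.
    by apply: (mulIf r0); rewrite -expr2 rr; field.
  by have -> : - (y / r) * x + x / r * y = 0 by ring.
exists (G *m W1); split.
- by apply: orthogonal_mx_mul => //; exact: givens_orth.
- by apply: gauss_invariant_mul => //; exact: gauss_invariant_givens.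
- by rewrite GW mxE tnth0 sqrtr_ge0.
- move=> i; rewrite GW mxE; case: (unliftP ord0 i) => [k ->|->]; last by rewrite eqxx.
  by rewrite tnthS; case: (unliftP ord0 k) => [l ->|->]; rewrite ?tnth0// tnthS tnth_mktuple.
Qed.

(** Induction on the dimension, as in a QR factorisation: once [W] aligns the first column of [U],
    the product [W *m U] has corner 1, zeros beside it, and an orthogonal remaining block. *)
Lemma gauss_invariant_orth n (U : 'M[R]_n) : orthogonal_mx U -> gauss_invariant U.
Proof.
elim: n U => [|n IHn] U oU.
  move=> f mf f0; apply: eq_integral => t _; congr f.
  by apply: eq_from_tnth => -[].
have [W [oW iW p0 z0]] := align_first_axis n (col 0 U).
have [B BE] : {B : 'M[R]_(1 + n) | B = W *m U} by exists (W *m U).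
have oB : orthogonal_mx B by rewrite BE; exact: orthogonal_mx_mul.
have colB i : B i 0 = (W *m col 0 U) i 0 by rewrite BE !mxE; apply: eq_bigr => k _; rewrite mxE.
have B0 i : i != 0 -> B i 0 = 0 by move=> i0; rewrite colB z0.
have B00 : B 0 0 = 1.
  have : (B^T *m B) 0 0 = 1 by rewrite oB.1 mxE.
  rewrite mxE (bigD1 0)//= big1 ?addr0; last by move=> i i0; rewrite mxE B0// mulr0.
  by rewrite mxE -expr2 => /eqP; rewrite sqrf_eq1 => /orP[/eqP//|/eqP h]; move: p0; rewrite -colB h; lra.
(* The first column is now the first basis vector, and its orthogonality to the other columns clears
   the first row. *)
have B0r j : j != 0 -> B 0 j = 0.
  move=> j0; have : (B^T *m B) 0 j = 0 by rewrite oB.1 mxE eq_sym (negbTE j0).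
  rewrite mxE (bigD1 0)//= big1 ?addr0; last by move=> i i0; rewrite mxE B0// mul0r.
  by rewrite mxE B00 mul1r.
have BB : B = block_mx 1%:M 0 0 (drsubmx B).
  rewrite -[LHS]submxK; congr block_mx; apply/matrixP => i j; rewrite !mxE ?ord1.
  - by rewrite (_ : lshift n 0 = 0) ?B00//; apply: val_inj.
  - by rewrite (_ : lshift n 0 = 0) ?B0r//; apply: val_inj.
  - by rewrite (_ : lshift n 0 = 0) ?B0//; apply: val_inj.
have oB' : orthogonal_mx (drsubmx B).
  move: oB; rewrite BB /orthogonal_mx tr_block_mx !trmx0 trmx1 !mulmx_block.
  rewrite !mulmx0 !mul0mx !mulmx1 !addr0 !add0r scalar_mx_block block_mxKdr.
  by move=> [/eq_block_mx[_ _ _ ->] /eq_block_mx[_ _ _ ->]].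
have iB : gauss_invariant B by rewrite BB; apply: gauss_invariant_lift; exact: IHn.
have -> : U = W^T *m B by rewrite BE mulmxA oW.1 mul1mx.
by apply: gauss_invariant_mul => //; apply: gauss_invariant_inv iW; exact: oW.1.
Qed.

End OrthogonalInvariance.

(** * Monotone transport *)

Section RealLine.
Context {R : realType}.
Notation mu := (@lebesgue_measure R).
Implicit Types (w H F : R -> R).

Lemma is_derive_gt0_incr F w : (forall x : R, is_derive x 1 F (w x)) ->
  (forall x, 0 < w x) -> {homo F : x y / x < y}.
Proof.
move=> dF w0 x y xy.
have cF : continuous F.
  by move=> z; apply: differentiable_continuous; apply/derivable1_diffP; case: (dF z).
have [z _ E] := MVT xy (fun z _ => dF z) (continuous_subspaceT cF).
by rewrite -subr_gt0 E mulr_gt0// subr_gt0.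
Qed.

Lemma is_derive_continuous F w : (forall x : R, is_derive x 1 F (w x)) -> continuous F.
Proof.
by move=> dF x; apply: differentiable_continuous; apply/derivable1_diffP; case: (dF x).
Qed.

(* No limit of [F'] at infinity is needed for this inequality, unlike for
   [increasing_ge0_integration_by_substitutionT]. *)
Lemma integral_substitution_le F w H :
  (forall x : R, is_derive x 1 F (w x)) -> (forall x, 0 < w x) -> continuous w ->
  continuous H -> (forall x, 0 <= H x) ->
  (\int[mu]_x (H (F x) * w x)%:E <= \int[mu]_x (H x)%:E)%E.
Proof.
move=> dF w0 cw cH H0.
have cF := is_derive_continuous _ _ dF.
have Fincr := is_derive_gt0_incr _ _ dF w0.
have F'E : derive1 F = w by apply/funext => x; rewrite derive1E; case: (dF x).
have mHw : measurable_fun setT (fun x : R => (H (F x) * w x)%:E).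
  apply/measurable_EFinP; apply: continuous_measurable_fun => x.
  by apply: cvgM; [exact: (continuous_comp (cF x) (cH _))|exact: cw].
have mH : measurable_fun setT (fun x : R => (H x)%:E).
  by apply/measurable_EFinP; exact: continuous_measurable_fun.
pose I (n : nat) : set R := `[(- n%:R)%R, n%:R]%classic.
have ndI : {homo I : n m / (n <= m)%N >-> (n <= m)%O}.
  move=> n m nm; apply/subsetPset => x; rewrite /I/= !in_itv/= => /andP[a b].
  apply/andP; split; last by rewrite (le_trans b)// ler_nat.
  by rewrite (le_trans _ a)// lerN2 ler_nat.
have UI : \bigcup_n I n = setT.
  apply/seteqP; split => // x _; exists (Num.bound `|x|) => //.
  rewrite /I/= in_itv/= -ler_norml ltW//.
  by apply: archi_boundP.
have cvgI := @ge0_nondecreasing_set_cvg_integral _ (measurableTypeR R) R I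
  (fun x => (H (F x) * w x)%:E) mu ndI.
rewrite -[X in (\int[_]_(x in X) _ <= _)%E]UI.
rewrite -(cvg_lim _ (cvgI _ _ _)) => [|//|n|n|n x _]; last 3 first.
- by apply: measurable_itv.
- exact: measurable_funTS.
- by rewrite lee_fin mulr_ge0// ltW.
apply: lime_le.
  apply/cvg_ex; eexists; apply: cvgI.
  - by move=> n; exact: measurable_itv.
  - by move=> n; exact: measurable_funTS.
  - by move=> n x _; rewrite lee_fin mulr_ge0// ltW.
(* On a bounded interval the substitution is an equality; the inequality arises because the image of
   the interval is only a part of the line. *)
near=> n.
have nn : - n%:R <= n%:R :> R by rewrite ge0_cp.
have := @integration_by_substitution_increasing R F H (- n%:R) n%:R nn.
rewrite F'E => <-//.
- by apply: ge0_subset_integral => // x _; rewrite lee_fin.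
- by move=> x y _ _; exact: Fincr.
- by apply/cvg_ex; eexists; apply: cvg_at_right_filter; exact: cw.
- by apply/cvg_ex; eexists; apply: cvg_at_left_filter; exact: cw.
- split; first by move=> x _; case: (dF x).
  by apply: cvg_at_right_filter; exact: cF.
  by apply: cvg_at_left_filter; exact: cF.
- exact: continuous_subspaceT.
Unshelve. all: end_near. Qed.

(** The distribution function of [w]. The strict bounds and the surjectivity onto the open unit
    interval are what allows one such function to be composed with the inverse of another. *)
Lemma density_primitive w : continuous w -> (forall x, 0 < w x) ->
  (\int[mu]_x (w x)%:E = 1)%E ->
  exists F, [/\ forall x : R, is_derive x 1 F (w x), forall x, 0 < F x < 1 &
     forall u, 0 < u < 1 -> exists x, F x = u].
Proof.
move=> cw w0 w1.
have mw : measurable_fun setT w by exact: continuous_measurable_fun.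
have wE0 (x : R) : (0 <= (w x)%:E)%E by rewrite lee_fin ltW.
have iw : mu.-integrable setT (EFin \o w).
  apply/integrableP; split; first exact/measurable_EFinP.
  rewrite (_ : integral _ _ _ = 1%E) ?ltry// -w1; apply: eq_integral => x _.
  by rewrite /= ger0_norm// ltW.
have iwA A : measurable A -> mu.-integrable A (EFin \o w).
  by move=> mA; apply: integrableS iw.
pose F x := Rintegral mu `]-oo, x]%classic w.
have FE x : ((F x)%:E = \int[mu]_(t in `]-oo, x]) (w t)%:E)%E.
  rewrite /F/Rintegral fineK//; apply: integrable_fin_num => //.
  by apply: iwA; exact: measurable_itv.
have dF (x : R) : is_derive x 1 F (w x).
  have xx1 : x < x + 1 by rewrite ltrDl.
  have [|//||a b] := @continuous_FTC1 R w -oo%O x (x + 1) xx1.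
  - by apply: iwA; exact: measurable_itv.
  - by rewrite ltNyr.
  - exact: cw.
  apply: DeriveDef; first exact: a.
  by rewrite -derive1E; exact: b.
have Fincr := is_derive_gt0_incr _ _ dF w0.
have F0 x : 0 <= F x by rewrite /F Rintegral_ge0// => y _; exact: ltW.
have F1 x : F x <= 1.
  rewrite -lee_fin FE -w1; apply: ge0_subset_integral => //.
  exact/measurable_EFinP.
exists F; split => //.
  move=> x; apply/andP; split.
    by apply: (le_lt_trans (F0 (x - 1))); apply: Fincr; rewrite ltrBlDr ltrDl.
  by apply: (lt_le_trans _ (F1 (x + 1))); apply: Fincr; rewrite ltrDl.
move=> u /andP[u0 u1].
(* If [F] stayed below [u], the half-lines ending at [n] would exhaust the line with mass at most
   [u < 1]. *)
have [b bu] : exists b, u <= F b.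
  apply: contrapT => /forallNP Fu.
  have : (1 <= u%:E)%E.
    pose I (n : nat) : set R := `]-oo, n%:R]%classic.
    have UI : \bigcup_n I n = setT.
      apply/seteqP; split => // x _; exists (Num.bound `|x|) => //.
      rewrite /I/= in_itv/= (le_trans (ler_norm _))// ltW//.
      by apply: archi_boundP.
    have ndI : {homo I : n m / (n <= m)%N >-> (n <= m)%O}.
      move=> n m nm; apply/subsetPset => x; rewrite /I/= !in_itv/= => /le_trans; apply.
      by rewrite ler_nat.
    have cvgI : (\int[mu]_(x in I n) (w x)%:E @[n --> \oo] --> \int[mu]_(x in \bigcup_n I n) (w x)%:E)%E.
      apply: (@ge0_nondecreasing_set_cvg_integral _ (measurableTypeR R) R I _ mu ndI) => //.
      - by move=> n; exact: measurable_itv.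
      - by move=> n; exact/measurable_EFinP/measurable_funTS.
    rewrite UI w1 in cvgI.
    rewrite -(cvg_lim _ cvgI)//; apply: lime_le; first by apply/cvg_ex; eexists; exact: cvgI.
    apply: nearW => n; rewrite -FE lee_fin.
    by have /negP := Fu n%:R; rewrite -ltNge => /ltW.
  by rewrite lee_fin leNgt u1.
(* If [F] stayed above [u], the half-lines starting at [- n] would, by complements, exhaust the line
   with mass at most [1 - u]. *)
have [a au] : exists a, F a <= u.
  apply: contrapT => /forallNP Fu.
  have : (1 <= (1 - u)%:E)%E.
    pose I (n : nat) : set R := `](- n%:R)%R, +oo[%classic.
    have UI : \bigcup_n I n = setT.
      apply/seteqP; split => // x _; exists (Num.bound `|x|) => //.
      rewrite /I/= in_itv/= andbT ltrNl (le_lt_trans (ler_norm _))// normrN.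
      by apply: archi_boundP.
    have ndI : {homo I : n m / (n <= m)%N >-> (n <= m)%O}.
      move=> n m nm; apply/subsetPset => x; rewrite /I/= !in_itv/= !andbT; apply: le_lt_trans.
      by rewrite lerN2 ler_nat.
    have cvgI : (\int[mu]_(x in I n) (w x)%:E @[n --> \oo] --> \int[mu]_(x in \bigcup_n I n) (w x)%:E)%E.
      apply: (@ge0_nondecreasing_set_cvg_integral _ (measurableTypeR R) R I _ mu ndI) => //.
      - by move=> n; exact: measurable_itv.
      - by move=> n; exact/measurable_EFinP/measurable_funTS.
    rewrite UI w1 in cvgI.
    rewrite -(cvg_lim _ cvgI)//; apply: lime_le; first by apply/cvg_ex; eexists; exact: cvgI.
    apply: nearW => n.
    have IE : I n = ~` `]-oo, (- n%:R)%R]%classic by rewrite setCitvl.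
    have : (\int[mu]_(x in `]-oo, (- n%:R)%R] `|` I n) (w x)%:E = 1)%E by rewrite IE setUv.
    rewrite ge0_integral_setU//; last 3 first.
    - exact: measurable_itv.
    - exact/measurable_EFinP/measurable_funTS.
    - by rewrite IE; apply/disj_setPCl.
    have /negP := Fu (- n%:R); rewrite -ltNge => /ltW Fn.
    rewrite -FE; move: (integral _ _ _) => [r| |]//= [<-].
    by rewrite lee_fin lerBrDl -lerBrDr addrK.
  by rewrite lee_fin leNgt ltrBlDr ltrDl u0.
have ab : a <= b.
  rewrite leNgt; apply/negP => /Fincr ba.
  have := le_lt_trans bu (lt_le_trans ba au); rewrite ltxx//.
have [c _ Fc] : exists2 c, c \in `[a, b] & F c = u.
  apply: IVT => //.
    exact: (continuous_subspaceT (is_derive_continuous _ _ dF)).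
  by rewrite ge_min au/= le_max bu orbT.
by exists c.
Qed.

(* [T = F2^-1 \o F1], with [F1] and [F2] the distribution functions of the two densities. *)
Lemma monotone_transport w1 w2 :
  continuous w1 -> (forall x, 0 < w1 x) -> (\int[mu]_x (w1 x)%:E = 1)%E ->
  continuous w2 -> (forall x, 0 < w2 x) -> (\int[mu]_x (w2 x)%:E = 1)%E ->
  exists T : R -> R, forall x : R, is_derive x 1 T (w1 x / w2 (T x)).
Proof.
move=> c1 p1 i1 c2 p2 i2.
have [F1 [dF1 F101 _]] := density_primitive _ c1 p1 i1.
have [F2 [dF2 F201 F2s]] := density_primitive _ c2 p2 i2.
have F2incr := is_derive_gt0_incr _ _ dF2 p2.
(* An inverse of [F2] by choice; the default 0 only concerns values outside the range of [F2], which
   [F1] never takes. *)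
pose K u : R := xget 0 [set y | F2 y = u].
have F2K x : K (F2 x) = x.
  rewrite /K; case: xgetP => [y _ /= E|/(_ x)/(_ erefl)//].
  by case: (ltrgtP y x) => // /F2incr; rewrite E ltxx.
have F2T x : F2 (K (F1 x)) = F1 x.
  have [y yE] := F2s _ (F101 x).
  by rewrite /K; case: xgetP => [z _ //|/(_ y)/(_ yE)//].
exists (K \o F1) => x /=.
have dK : is_derive (F1 x) 1 K (w2 (K (F1 x)))^-1.
  rewrite -{1}F2T; apply: is_derive_inverse.
  - by near=> y; exact: F2K.
  - by near=> y; exact: (is_derive_continuous _ _ dF2).
  - by rewrite gt_eqF.
rewrite mulrC; exact: (is_derive1_comp dK (dF1 x)).
Unshelve. all: end_near. Qed.

End RealLine.

(** * The one-dimensional entropy inequality *)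

Section RealInequalities.
Context {R : realType}.
Implicit Types (x y t c s : R).

Lemma ln_leB1 x : 0 < x -> ln x <= x - 1.
Proof. by move=> x0; rewrite -{1}[x](subrKC 1) le_ln1Dx// ltrBrDr addrC subrr. Qed.

Lemma continuous_ln_comp (f : R -> R) : continuous f -> (forall x, 0 < f x) ->
  continuous (fun x => ln (f x)).
Proof.
by move=> cf f0 x; apply: (continuous_comp (cf x)); exact: continuous_ln.
Qed.

(** Nonnegativity on the half-line comes from [x ln x >= x - 1]; for [x < 0] the convention
    [ln x = 0] leaves the value 1. *)
Definition psi x := x * ln x + 1.

Lemma psi_ge x : 0 <= x -> x <= psi x.
Proof.
rewrite le_eqVlt => /predU1P[<-|x0]; first by rewrite /psi mul0r add0r.
have := ln_leB1 (x^-1); rewrite invr_gt0 lnV ?posrE// => /(_ x0).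
rewrite -(ler_pM2l x0) mulrBr mulr1 divff ?gt_eqF// /psi; lra.
Qed.

Lemma psi_ge0 x : 0 <= psi x.
Proof.
case: (leP 0 x) => [x0|/ltW x0]; first exact: le_trans (psi_ge _ x0).
by rewrite /psi ln0// mulr0 add0r.
Qed.

Lemma measurable_psi : measurable_fun setT psi.
Proof.
apply: measurable_funD; last exact: measurable_cst.
by apply: measurable_funM; [exact: measurable_id|exact: measurable_ln].
Qed.

(** Concavity between the points [t] and 1 with weights [c^2] and [s^2]: the tangent bound
    [ln y <= y - 1] is taken at [t / m] and at [1 / m], then averaged. *)
Lemma ln_concave1 c s t : c ^+ 2 + s ^+ 2 = 1 -> 0 < t ->
  c ^+ 2 * ln t <= ln (c ^+ 2 * t + s ^+ 2).
Proof.
move=> cs t0; set m := _ + _.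
have c20 : 0 <= c ^+ 2 by rewrite sqr_ge0.
have s20 : 0 <= s ^+ 2 by rewrite sqr_ge0.
have m0 : 0 < m.
  rewrite /m; case: (ltrgtP (s ^+ 2) 0) => [|s2|s2]; first by rewrite ltNge s20.
    by rewrite ltr_wpDl// mulr_ge0// ltW.
  by rewrite s2 addr0; move: cs; rewrite s2 addr0 => ->; rewrite mul1r.
have tm : ln (t / m) <= t / m - 1 by apply: ln_leB1; rewrite divr_gt0.
have vm : ln (m^-1) <= m^-1 - 1 by apply: ln_leB1; rewrite invr_gt0.
rewrite ln_div ?posrE// in tm; rewrite lnV ?posrE// in vm.
have : c ^+ 2 * (ln t - ln m) + s ^+ 2 * (- ln m) <=
       c ^+ 2 * (t / m - 1) + s ^+ 2 * (m^-1 - 1) by rewrite lerD// ler_wpM2l.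
have -> : c ^+ 2 * (t / m - 1) + s ^+ 2 * (m^-1 - 1) = m / m - (c ^+ 2 + s ^+ 2).
  by rewrite /m; ring.
rewrite divff ?gt_eqF// cs subrr.
have -> : c ^+ 2 * (ln t - ln m) + s ^+ 2 * (- ln m) =
          c ^+ 2 * ln t - (c ^+ 2 + s ^+ 2) * ln m by ring.
by rewrite cs mul1r subr_le0.
Qed.

Lemma maxr_posB_neg (d : R) : Num.max d 0 - Num.max (- d) 0 = d.
Proof.
case: (leP 0 d) => d0; first by rewrite max_r ?oppr_le0// subr0.
by rewrite max_l ?oppr_ge0 ?ltW// sub0r opprK.
Qed.

(* The quadratic terms of the three Gaussian densities cancel, up to the
   term which is odd in [z]. *)
Lemma transport_pointwise c s (x z T h g : R) : c ^+ 2 + s ^+ 2 = 1 ->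
  0 < h -> 0 < g -> forall t, t = gauss_density x / (h * gauss_density T) ->
  ln g - c ^+ 2 * ln h - pi *+ 2 * c * s * (z * (T - x)) <=
  g * gauss_density (c * T + s * z) * (c ^+ 2 * t + s ^+ 2) / gauss_density (c * x + s * z) - 1.
Proof.
move=> cs h0 g0 t tE.
have d0 (u : R) : 0 < gauss_density u := gauss_density_gt0 u.
have lnd (u : R) : ln (gauss_density u) = - pi * u ^+ 2 by rewrite /gauss_density expRK.
have t0 : 0 < t by rewrite tE divr_gt0// ?mulr_gt0.
have m0 : 0 < c ^+ 2 * t + s ^+ 2.
  have c20 : 0 <= c ^+ 2 by rewrite sqr_ge0.
  have s20 : 0 <= s ^+ 2 by rewrite sqr_ge0.
  case: (ltrgtP (s ^+ 2) 0) => [|s2|s2]; first by rewrite ltNge s20.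
    by rewrite ltr_wpDl// mulr_ge0// ltW.
  by rewrite s2 addr0; move: cs; rewrite s2 addr0 => ->; rewrite mul1r.
have := ln_concave1 _ _ _ cs t0.
rewrite {1}tE ln_div ?posrE// ?mulr_gt0// lnM ?posrE// !lnd => lnt.
(* The tangent bound at the ratio of the transported density to the Gaussian in the rotated
   variable; this ratio will integrate to at most 1, which pays for the [- 1]. *)
apply: le_trans (ln_leB1 _ _); last by rewrite divr_gt0// !mulr_gt0.
rewrite ln_div ?posrE// ?mulr_gt0// !lnM ?posrE// ?mulr_gt0// !lnd.
have : ln g + - pi * (c * T + s * z) ^+ 2 + c ^+ 2 * (- pi * x ^+ 2 - (ln h + - pi * T ^+ 2)) - - pi * (c * x + s * z) ^+ 2 <=
   ln g + - pi * (c * T + s * z) ^+ 2 + ln (c ^+ 2 * t + s ^+ 2) - - pi * (c * x + s * z) ^+ 2.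
  by rewrite lerD2r lerD2l.
apply: le_trans; rewrite le_eqVlt; apply/orP; left; apply/eqP.
by ring.
Qed.

End RealInequalities.

Section GaussMoment.
Context {R : realType}.
Notation gauss1 := (@gauss1 R).
Notation mu := (@lebesgue_measure R).

(** First moments make the odd term of the transport inequality integrable. Half of the exponent
    [- pi x^2] absorbs [|x|], and the other half remains as a normal density. *)
Lemma integral_gauss1_norm_lty : (\int[gauss1]_x `|x|%:E < +oo)%E.
Proof.
have mn : measurable_fun [set: R] (fun x => `|x|%:E).
  apply/measurable_EFinP.
  exact: normr_measurable.
rewrite ge0_integral_gauss1; [|exact: mn|by move=> x; rewrite lee_fin].
(* Variance [1 / pi], so that [normal_fun] is the square root of [gauss_density]. *)
pose s : R := (Num.sqrt pi)^-1.
have p0 : (0 : R) < pi := pi_gt0 R.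
have s0 : s != 0 by rewrite invr_eq0 gt_eqF// sqrtr_gt0.
have pk : 0 < normal_peak s := normal_peak_gt0 s0.
have /integrable_lty : mu.-integrable setT (fun x : R => ((normal_peak s)^-1%:E * (normal_pdf 0 s x)%:E)%E).
  by apply: integrableZl => //; exact: integrable_normal_pdf.
move=> /(_ measurableT); apply: le_lt_trans; apply: ge0_le_integral => //.
- by move=> x _; rewrite mule_ge0// lee_fin ltW// gauss_density_gt0.
- apply: emeasurable_funM; first exact: mn.
  by apply/measurable_EFinP; exact: measurable_gauss_density.
- apply: emeasurable_funM; first exact: measurable_cst.
  by apply/measurable_EFinP; exact: measurable_normal_pdf.
- move=> x _; rewrite -!EFinM lee_fin normal_pdfE// mulrA mulVf ?gt_eqF// mul1r.
  have E : gauss_density x = expR (- (pi * x ^+ 2) / 2) * expR (- (pi * x ^+ 2) / 2).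
    by rewrite -expRD /gauss_density; congr expR; field.
  rewrite /normal_fun subr0 E mulrA.
  have -> : - x ^+ 2 / (s ^+ 2 *+ 2) = - (pi * x ^+ 2) / 2.
    rewrite /s exprVn sqr_sqrtr ?ltW//.
    suff aux p : p != 0 -> - x ^+ 2 / (p^-1 *+ 2) = - (p * x ^+ 2) / 2 by rewrite aux// gt_eqF.
    by move=> q0; field.
  rewrite ler_piMl ?expR_ge0// mulNr expRN ler_pdivrMr ?expR_gt0// mul1r.
  apply: le_trans (expR_ge1Dx _).
  have pi2 : 2 <= pi :> R := pi_ge2 R.
  have : 1 + x ^+ 2 <= 1 + pi * x ^+ 2 / 2.
    by rewrite lerD2l ler_pdivlMr// mulrC ler_wpM2r// sqr_ge0.
  apply: le_trans; rewrite -real_normK ?num_real//.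
  by have := sqr_ge0 (`|x| - 1); nra.
Qed.

End GaussMoment.

Section MehlerSmooth.
Context {R : realType}.
Notation gauss1 := (@gauss1 R).
Notation mu := (@lebesgue_measure R).
Variables (c s : R).
Hypothesis cs : c ^+ 2 + s ^+ 2 = 1.
Variables (h : R -> R) (a b : R).
Hypothesis mh : measurable_fun setT h.
Hypothesis a0 : 0 < a.
Hypothesis hab : forall x, a <= h x <= b.
Hypothesis h1 : (\int[gauss1]_x (h x)%:E = 1)%E.

Definition smoothed (x : R) : R := \int[gauss1]_w h (c * x + s * w).
Local Notation G := smoothed.

Lemma measurable_bounded_gauss1_integrable (f : R -> R) (l u : R) :
  measurable_fun setT f -> (forall x, l <= f x <= u) -> gauss1.-integrable setT (EFin \o f).
Proof.
move=> mf lu; apply: measurable_bounded_integrable => //.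
- by apply: (@le_lt_trans _ _ 1%E); [exact: (probability_le1 gauss1)|exact: ltry].
- exists (Num.max `|l| `|u|); split; first by rewrite num_real.
  move=> x Mx y _ /=; apply: le_trans (ltW Mx).
  have /andP[ly yu] := lu y.
  rewrite le_max; case: (leP 0 (f y)) => f0.
    by rewrite (ger0_norm f0) (le_trans yu (ler_norm _)) orbT.
  by rewrite (ltr0_norm f0) -normrN (le_trans _ (ler_norm _))// lerN2.
Qed.

Let caff' w : continuous (fun x => c * x + s * w).
Proof.
move=> x; apply: cvgD; last exact: cvg_cst.
by apply: cvgM; [exact: cvg_cst|exact: cvg_id].
Qed.

Let int_h x : gauss1.-integrable setT (EFin \o (fun w => h (c * x + s * w))).
Proof.
apply: (@measurable_bounded_gauss1_integrable _ a b) => //.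
by apply: (measurableT_comp mh); apply: measurable_funD => //; exact: measurable_funM.
Qed.

Lemma smoothedE x : ((G x)%:E = \int[gauss1]_w (h (c * x + s * w))%:E)%E.
Proof. by rewrite /smoothed /Rintegral fineK//; exact: (integrable_fin_num measurableT (int_h x)). Qed.

Lemma smoothed_bounds x : a <= G x <= b.
Proof.
have E k : (\int[gauss1]_w k%:E = k%:E)%E.
  exact: integral_probability_cst.
rewrite -!lee_fin smoothedE -(E a) -(E b); apply/andP; split.
  apply: ge0_le_integral => //.
  - by move=> w _; rewrite lee_fin ltW.
  - by apply/measurable_EFinP; move/integrableP : (int_h x) => [/measurable_EFinP].
  - by move=> w _; rewrite lee_fin; case/andP: (hab (c * x + s * w)).
apply: ge0_le_integral => //.
- by move=> w _; rewrite lee_fin (le_trans (ltW a0))//; case/andP: (hab (c * x + s * w)).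
- by apply/measurable_EFinP; move/integrableP : (int_h x) => [/measurable_EFinP].
- by move=> w _; rewrite lee_fin; case/andP: (hab (c * x + s * w)).
Qed.

Lemma continuous_smoothed : continuous h -> continuous G.
Proof.
move=> ch x.
have := @continuity_under_integral R _ (measurableTypeR R) gauss1 (fun x w => h (c * x + s * w)) setT measurableT (x - 1) (x + 1).
move=> /(_ _ _ (cst b)); apply => //.
- apply: aeW => w _ y _.
  exact: (continuous_comp (caff' w y) (ch _)).
- by apply: (@measurable_bounded_gauss1_integrable _ b b) => // y; rewrite lexx.
- move=> y _; apply: aeW => w _; have /andP[ah hb] := hab (c * y + s * w).
  by rewrite ger0_norm// (le_trans (ltW a0)).
- by rewrite inE/= in_itv/= ltrBlDr ltrDl ltr01.
Qed.

(** After reflection of [w], the argument of [h] is the first coordinate of a rotated pair, and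
    rotation invariance applies. *)
Lemma smoothed_mass : c != -1 -> (\int[gauss1]_x (G x)%:E = 1)%E.
Proof.
move=> c1; under eq_integral do rewrite smoothedE.
have h0 x : (0 <= (h x)%:E)%E.
  by rewrite lee_fin (le_trans (ltW a0))//; case/andP: (hab x).
have mhE : measurable_fun setT (fun x => (h x)%:E) by exact/measurable_EFinP.
transitivity (\int[gauss1]_x \int[gauss1]_w (h (c * x - s * w))%:E)%E.
  apply: eq_integral => x _; rewrite -ge0_integral_gauss1N; last 2 first.
    by apply/measurable_EFinP; move/integrableP : (int_h x) => [/measurable_EFinP].
    by [].
  by apply: eq_integral => w _; rewrite mulrN.
have := ge0_integral_gauss1_rot (fun x _ => (h x)%:E) _ _ cs c1.
move=> /(_ _ _) ->//; last first.
  exact: (measurableT_comp mhE).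
by rewrite -[RHS]h1; apply: eq_integral => x _; exact: integral_probability_cst.
Qed.

End MehlerSmooth.

(** [p] and [q] are the shifted logarithmic terms, [d] the common integral of the two parts of the
    odd term, [r] the transported mass. The finiteness of [d] permits its cancellation even when [p]
    or [q] is infinite. *)
Lemma le_cancel_finite (R : realType) (p q d r : \bar R) (C L : R) :
  (0 <= p -> 0 <= q -> 0 <= d -> 0 <= r -> r <= 1 -> d < +oo ->
   p + d + (1 + C * L)%:E <= r + q + d + L%:E -> p <= q + ((1 - C) * L)%:E)%E.
Proof.
move: p q d r => [p| |] [q| |] [d| |] [r| |]//=; rewrite -?EFinD ?lee_fin ?leey//.
by move=> *; lra.
Qed.

(** Passes from the integrals [x], [y] of [(ln + L) f] to the integrals [p], [q] of [psi]; for mass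
    one the two kinds differ by [L - 1]. *)
Lemma psi_of_shifted (R : realType) (x y p q : \bar R) (C L : R) :
  (y < +oo -> 0 <= y -> 0 <= p -> 0 <= q ->
   q + L%:E = y + 1 -> p + L%:E = x + 1 ->
   x <= C%:E * y + ((1 - C) * L)%:E -> p <= C%:E * q + (1 - C)%:E)%E.
Proof.
move: x y p q => [x| |] [y| |] [p| |] [q| |]//=; rewrite -?EFinM -?EFinD ?lee_fin ?leey//.
move=> _ _ _ _ [E1] [E2]; have -> : q = y + 1 - L by lra.
have -> : p = x + 1 - L by lra.
by nra.
Qed.

Section Displacement.
Context {R : realType}.
Notation gauss1 := (@gauss1 R).

(** Serves to cancel the two parts of the odd term. The bound [|T x - x| <= |T x| + |x|] turns the
    double integral into products of first moments. *)
Lemma iterated_integral_displacement_lty {T : R -> R} (k : R) : measurable_fun setT T ->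
  (\int[gauss1]_x `|T x|%:E < +oo)%E ->
  (\int[gauss1]_x \int[gauss1]_z `|k * (z * (T x - x))|%:E < +oo)%E.
Proof.
move=> mT Too.
have mn : measurable_fun [set: R] (fun x => `|x|%:E).
  by apply/measurable_EFinP; exact: normr_measurable.
have mTn : measurable_fun setT (fun x => (`|T x| + `|x|)%:E).
  apply/measurable_EFinP; apply: measurable_funD; last exact: normr_measurable.
  by apply: (measurableT_comp (@normr_measurable _ _)).
have n0 x : (0 <= `|k|%:E * (`|T x| + `|x|)%:E)%E.
  by rewrite mule_ge0// lee_fin ?addr_ge0.
apply: (@le_lt_trans _ _ (\int[gauss1]_x \int[gauss1]_z ((`|k|%:E * (`|T x| + `|x|)%:E) * `|z|%:E))%E).
  apply: ge0_le_iterated_integral.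
  - apply/measurable_EFinP; apply: measurableT_comp; first exact: normr_measurable.
    apply: measurable_funM; first exact: measurable_cst.
    apply: measurable_funM; first exact: measurable_snd.
    by apply: measurable_funB; [exact: (measurableT_comp mT)|exact: measurable_fst].
  - by move=> x z; rewrite lee_fin.
  - apply: emeasurable_funM; last exact: (measurableT_comp mn).
    apply: emeasurable_funM; first exact: measurable_cst.
    exact: (measurableT_comp mTn).
  - move=> x z; rewrite -!EFinM lee_fin !normrM -[leRHS]mulrA ler_wpM2l// mulrC ler_wpM2r//.
    exact: ler_normB.
under eq_integral do rewrite ge0_integralZl//.
rewrite ge0_integralZr//; last 2 first.
- by apply: emeasurable_funM => //; exact: measurable_cst.
- by apply: integral_ge0 => x _; rewrite lee_fin.
rewrite ge0_integralZl_EFin//.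
under eq_integral do rewrite EFinD.
rewrite ge0_integralD//; last first.
  by apply/measurable_EFinP; apply: (measurableT_comp (@normr_measurable _ _)).
have f1 := @integral_gauss1_norm_lty R.
rewrite -ge0_fin_numE in f1; last by apply: integral_ge0 => x _; rewrite lee_fin.
rewrite -ge0_fin_numE in Too; last by apply: integral_ge0 => x _; rewrite lee_fin.
by rewrite -(fineK f1) -(fineK Too) -EFinD -!EFinM ltry.
Qed.

End Displacement.

(** * Mass transport for continuous densities lying between positive constants *)

Section NiceCase.
Context {R : realType}.
Notation gauss1 := (@gauss1 R).
Notation mu := (@lebesgue_measure R).
Notation phi := (@gauss_density R).
Variables (c s : R).
Hypothesis cs : c ^+ 2 + s ^+ 2 = 1.
Hypothesis c1 : c != -1.
Variables (h : R -> R) (a b : R).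
Hypothesis ch : continuous h.
Hypothesis a0 : 0 < a.
Hypothesis hab : forall x, a <= h x <= b.
Hypothesis h1 : (\int[gauss1]_x (h x)%:E = 1)%E.
Notation G := (smoothed c s h).

Let h_gt0 x : 0 < h x. Proof. by case/andP: (hab x) => /(lt_le_trans a0). Qed.

Let mh : measurable_fun setT h. Proof. exact: continuous_measurable_fun. Qed.

Let phi0 x : 0 < phi x := gauss_density_gt0 x.

Section Transport.
Variable T : R -> R.
Hypothesis dT : forall x : R, is_derive x 1 T (phi x / (h (T x) * phi (T x))).

Let t x := phi x / (h (T x) * phi (T x)).

Let t0 x : 0 < t x. Proof. by rewrite divr_gt0// mulr_gt0. Qed.

Let cT : continuous T. Proof. exact: is_derive_continuous dT. Qed.

Let mT : measurable_fun setT T. Proof. exact: continuous_measurable_fun. Qed.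

Let ct : continuous t.
Proof.
move=> x; apply: cvgM; first exact: continuous_gauss_density.
apply: cvgV; first by rewrite gt_eqF// mulr_gt0.
apply: cvgM; first exact: (continuous_comp (cT x) (ch _)).
exact: (continuous_comp (cT x) (continuous_gauss_density _)).
Qed.

(** Since [T' = phi / (h(T) phi(T))], the left side is the integral of [f h phi] composed with [T],
    times [T']; the substitution inequality applies whether or not [T] is onto. *)
Lemma transport_le (f : R -> R) : continuous f -> (forall x, 0 <= f x) ->
  (\int[gauss1]_x (f (T x))%:E <= \int[gauss1]_x (f x * h x)%:E)%E.
Proof.
move=> cf f0.
rewrite ge0_integral_gauss1; last 2 first.
- apply/measurable_EFinP; apply: continuous_measurable_fun => x.
  exact: (continuous_comp (cT x) (cf _)).
- by move=> x; rewrite lee_fin.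
rewrite ge0_integral_gauss1; last 2 first.
- apply/measurable_EFinP; apply: measurable_funM => //.
  exact: continuous_measurable_fun.
- by move=> x; rewrite lee_fin mulr_ge0// ltW.
have := @integral_substitution_le R T t (fun x => f x * h x * phi x) dT t0 ct _ _.
move=> /(_ _ _)/le_trans => H.
have -> : (\int[mu]_x ((f (T x))%:E * (phi x)%:E) =
    \int[mu]_x (f (T x) * h (T x) * phi (T x) * t x)%:E)%E.
  apply: eq_integral => x _; rewrite -EFinM; congr _%:E; rewrite /t.
  by field; rewrite !gt_eqF.
under [leRHS]eq_integral do rewrite -EFinM.
apply: H => //.
- move=> x; apply: cvgM; last exact: continuous_gauss_density.
  by apply: cvgM; [exact: cf|exact: ch].
- by move=> x; rewrite !mulr_ge0// ltW.
Qed.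

(** The inequality holds for [f] and for [K - f], and on both sides these integrals add up to [K]
    because [h] has mass one; so neither can be strict. *)
Lemma transport_eq (f : R -> R) K : continuous f -> (forall x, 0 <= f x <= K) ->
  (\int[gauss1]_x (f (T x))%:E = \int[gauss1]_x (f x * h x)%:E)%E.
Proof.
move=> cf fK.
have f0 x : 0 <= f x by case/andP: (fK x).
have Kf x : 0 <= K - f x by rewrite subr_ge0; case/andP: (fK x).
have K0 : 0 <= K by apply: (le_trans (f0 0)); case/andP: (fK 0).
have cKf : continuous (fun x => K - f x).
  by move=> x; apply: cvgB; [exact: cvg_cst|exact: cf].
have mf : measurable_fun setT f by exact: continuous_measurable_fun.
have mKf : measurable_fun setT (fun x => K - f x) by exact: continuous_measurable_fun.
have le1 := transport_le _ cf f0.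
have le2 := transport_le _ cKf Kf.
have E1 : (\int[gauss1]_x (f (T x))%:E + \int[gauss1]_x (K - f (T x))%:E = K%:E)%E.
  rewrite -ge0_integralD//; last 4 first.
  - by move=> x _; rewrite lee_fin.
  - by apply/measurable_EFinP; exact: (measurableT_comp mf).
  - by move=> x _; rewrite lee_fin.
  - by apply/measurable_EFinP; exact: (measurableT_comp mKf).
  under eq_integral do rewrite -EFinD subrKC.
  exact: integral_probability_cst.
have E2 : (\int[gauss1]_x (f x * h x)%:E + \int[gauss1]_x ((K - f x) * h x)%:E = K%:E)%E.
  rewrite -ge0_integralD//; last 4 first.
  - by move=> x _; rewrite lee_fin mulr_ge0// ltW.
  - by apply/measurable_EFinP; exact: measurable_funM.
  - by move=> x _; rewrite lee_fin mulr_ge0// ltW.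
  - by apply/measurable_EFinP; exact: measurable_funM.
  under eq_integral do rewrite -EFinD -mulrDl subrKC EFinM.
  rewrite ge0_integralZl_EFin//; last 2 first.
  - by move=> x _; rewrite lee_fin ltW.
  - exact/measurable_EFinP.
  by rewrite h1 mule1.
apply/eqP; rewrite eq_le le1/=.
move: le1 le2 E1 E2.
have : (0 <= \int[gauss1]_x (f (T x))%:E)%E by apply: integral_ge0 => x _; rewrite lee_fin.
have : (0 <= \int[gauss1]_x (f x * h x)%:E)%E.
  by apply: integral_ge0 => x _; rewrite lee_fin mulr_ge0// ltW.
move: (\int[gauss1]_x (f (T x))%:E)%E (\int[gauss1]_x (f x * h x)%:E)%E.
move: (\int[gauss1]_x (K - f (T x))%:E)%E (\int[gauss1]_x ((K - f x) * h x)%:E)%E.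
move=> [x| |] [y| |] [z| |] [w| |]//=.
rewrite -!EFinD !lee_fin => _ _ _ xy [E1] [E2]; lra.
Qed.

Lemma transport_norm_lty : (\int[gauss1]_x `|T x|%:E < +oo)%E.
Proof.
apply: (le_lt_trans (transport_le (fun x => `|x|) _ _)) => //.
  by move=> x; exact: norm_continuous.
apply: (@le_lt_trans _ _ (b%:E * \int[gauss1]_x `|x|%:E)%E); last first.
  have := @integral_gauss1_norm_lty R; rewrite -ge0_fin_numE ?integral_ge0//.
  by move=> /fineK <-; rewrite -EFinM ltry.
have b0 : 0 <= b by apply: (le_trans (ltW (h_gt0 0))); case/andP: (hab 0).
have mn : measurable_fun [set: R] (fun x => `|x|%:E).
  by apply/measurable_EFinP; exact: normr_measurable.
rewrite -ge0_integralZl_EFin//.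
apply: ge0_le_integral => //.
- by move=> x _; rewrite lee_fin mulr_ge0// ltW.
- by apply/measurable_EFinP; apply: measurable_funM => //; exact: normr_measurable.
- by apply: emeasurable_funM => //; exact: measurable_cst.
- move=> x _; rewrite -EFinM lee_fin mulrC ler_wpM2r//.
  by case/andP: (hab x).
Qed.

Section RotatedTransport.
Variable L : R.
(** The shift by [L] makes the logarithms nonnegative, as Tonelli requires, and bounded, as
    [transport_eq] requires. *)
Hypothesis lnL : forall u, a <= u <= b -> 0 <= ln u + L <= L *+ 2.
Hypothesis L0 : 0 <= L.

Let G_ab x : a <= G x <= b := smoothed_bounds _ _ _ _ _ mh a0 hab x.
Let G_gt0 x : 0 < G x. Proof. by case/andP: (G_ab x) => /(lt_le_trans a0). Qed.
Let cG : continuous G := continuous_smoothed _ _ _ _ _ mh a0 hab ch.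

Let mlnG : measurable_fun setT (fun y => ln (G y) + L).
Proof.
apply: measurable_funD; last exact: measurable_cst.
by apply: measurableT_comp; [exact: measurable_ln|exact: continuous_measurable_fun].
Qed.

Let mlnh : measurable_fun setT (fun y => ln (h y) + L).
Proof.
apply: measurable_funD; last exact: measurable_cst.
by apply: measurableT_comp; [exact: measurable_ln|exact: continuous_measurable_fun].
Qed.

Let mlin (p q : R) : measurable_fun [set: R * R] (fun u => p * u.1 + q * u.2).
Proof. by apply: measurable_funD; apply: measurable_funM. Qed.

(** The terms of [transport_pointwise], split into nonnegative functions. [P], [Q], [Dp] and [Dn]
    live in the original variables [(x, z)]; [rho], the transported density over the Gaussian at
    [u], lives in the rotated ones [(u, v)]. *)
Let k : R := pi *+ 2 * c * s.
Let P (x z : R) : \bar R := (ln (G (c * T x + s * z)) + L)%:E.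
Let Q (x z : R) : \bar R := (c ^+ 2 * (ln (h (T x)) + L))%:E.
Let D (x z : R) : R := k * (z * (T x - x)).
Let Dp (x z : R) : \bar R := (Num.max (D x z) 0)%:E.
Let Dn (x z : R) : \bar R := (Num.max (- D x z) 0)%:E.
Let rho (u v : R) : \bar R :=
  let x := c * u - s * v in
  (G (c * T x + s * (s * u + c * v)) * phi (c * T x + s * (s * u + c * v))
   * (c ^+ 2 * t x + s ^+ 2) / phi u)%:E.

Let P0 x z : (0 <= P x z)%E.
Proof. by rewrite lee_fin; case/andP: (lnL _ (G_ab (c * T x + s * z))). Qed.

Let Q0 x z : (0 <= Q x z)%E.
Proof. by rewrite lee_fin mulr_ge0 ?sqr_ge0//; case/andP: (lnL _ (hab (T x))). Qed.

Let Dp0 x z : (0 <= Dp x z)%E. Proof. by rewrite lee_fin le_max lexx orbT. Qed.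
Let Dn0 x z : (0 <= Dn x z)%E. Proof. by rewrite lee_fin le_max lexx orbT. Qed.

Let jac_gt0 x : 0 < c ^+ 2 * t x + s ^+ 2.
Proof.
case: (ltrgtP (s ^+ 2) 0) => [|s2|s2]; first by rewrite ltNge sqr_ge0.
  by rewrite ltr_wpDl// mulr_ge0 ?sqr_ge0// ltW.
by rewrite s2 addr0; move: cs; rewrite s2 addr0 => ->; rewrite mul1r.
Qed.

Let rho0 u v : (0 <= rho u v)%E.
Proof. by rewrite lee_fin divr_ge0 ?mulr_ge0// ltW. Qed.

Let mP : measurable_fun setT (fun p : R * R => P p.1 p.2).
Proof.
apply/measurable_EFinP; apply: (measurableT_comp mlnG).
apply: measurable_funD; apply: measurable_funM => //.
exact: (measurableT_comp mT).
Qed.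

Let mQ : measurable_fun setT (fun p : R * R => Q p.1 p.2).
Proof.
apply/measurable_EFinP; apply: measurable_funM => //.
by apply: (measurableT_comp mlnh); exact: (measurableT_comp mT).
Qed.

Let mD : measurable_fun setT (fun p : R * R => D p.1 p.2).
Proof.
apply: measurable_funM; first exact: measurable_cst.
apply: measurable_funM; first exact: measurable_snd.
by apply: measurable_funB; [exact: (measurableT_comp mT)|exact: measurable_fst].
Qed.

Let mDp : measurable_fun setT (fun p : R * R => Dp p.1 p.2).
Proof. by apply/measurable_EFinP; apply: measurable_maxr => //; exact: mD. Qed.

Let mDn : measurable_fun setT (fun p : R * R => Dn p.1 p.2).
Proof.
apply/measurable_EFinP; apply: measurable_maxr => //.
by apply: measurableT_comp => //; exact: mD.
Qed.

Let mrho : measurable_fun setT (fun p : R * R => rho p.1 p.2).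
Proof.
have mx : measurable_fun [set: R * R] (fun p => c * p.1 - s * p.2).
  by apply: measurable_funB; apply: measurable_funM.
have mG : measurable_fun setT G by exact: continuous_measurable_fun.
have mphi : measurable_fun setT phi := measurable_gauss_density.
have my : measurable_fun [set: R * R] (fun p => c * T (c * p.1 - s * p.2) + s * (s * p.1 + c * p.2)).
  apply: measurable_funD; apply: measurable_funM; first exact: measurable_cst.
  - by apply: (measurableT_comp mT); exact: mx.
  - exact: measurable_cst.
  - exact: mlin.
apply/measurable_EFinP; apply: measurable_funM; last first.
  apply: (measurableT_comp (f := fun u : R => (phi u)^-1)); last exact: measurable_fst.
  apply: continuous_measurable_fun => u; apply: cvgV; first by rewrite gt_eqF.
  exact: continuous_gauss_density.
apply: measurable_funM.
  apply: measurable_funM; first exact: (measurableT_comp mG my).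
  exact: (measurableT_comp mphi my).
apply: measurable_funD; last exact: measurable_cst.
apply: measurable_funM; first exact: measurable_cst.
have mt : measurable_fun setT t by exact: continuous_measurable_fun.
exact: (measurableT_comp mt mx).
Qed.

Let I (f : R -> R -> \bar R) := (\int[gauss1]_x \int[gauss1]_y f x y)%E.
Let rot (f : R -> R -> \bar R) (u v : R) := f (c * u - s * v) (s * u + c * v).

Let mrot f : measurable_fun setT (fun p : R * R => f p.1 p.2) ->
  measurable_fun setT (fun p : R * R => rot f p.1 p.2).
Proof.
move=> mf; apply: (measurableT_comp mf (measurable_fun_pair _ _)); last exact: mlin.
by apply: measurable_funB; apply: measurable_funM.
Qed.

Let I_rot f : measurable_fun setT (fun p : R * R => f p.1 p.2) -> (forall x y, 0 <= f x y)%E ->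
  I (rot f) = I f.
Proof. exact: ge0_integral_gauss1_rot. Qed.

Let I_add f g :
  measurable_fun setT (fun p : R * R => f p.1 p.2) -> (forall x y, (0 <= f x y)%E) ->
  measurable_fun setT (fun p : R * R => g p.1 p.2) -> (forall x y, (0 <= g x y)%E) ->
  (I (fun x y => f x y + g x y) = I f + I g)%E.
Proof. by move=> mf f0 mg g0; rewrite /I ge0_iterated_integralD. Qed.

Let I_cst r : I (fun _ _ => r%:E) = r%:E.
Proof.
rewrite -[RHS](integral_probability_cst _ _ _ gauss1); apply: eq_integral => x _.
exact: integral_probability_cst.
Qed.

(** The shifts [L] inside [P] and [c^2 L] inside [Q] are compensated by constants on the opposite
    sides, and the odd term is written [Dp - Dn]. *)
Let pointwise u v :
  (rot P u v + rot Dn u v + (1 + c ^+ 2 * L)%:E <= rho u v + rot Q u v + rot Dp u v + L%:E)%E.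
Proof.
rewrite /rot /P /Q /Dn /Dp /rho -!EFinD lee_fin.
set x := c * u - s * v; set z := s * u + c * v.
have ux : c * x + s * z = u.
  rewrite /x /z; have -> : c * (c * u - s * v) + s * (s * u + c * v) = (c ^+ 2 + s ^+ 2) * u by ring.
  by rewrite cs mul1r.
have := transport_pointwise _ _ x z (T x) _ _ cs (h_gt0 (T x)) (G_gt0 (c * T x + s * z)) (t x) (erefl _).
rewrite ux -/(k) -/(D x z).
set r := _ / phi u.
have := maxr_posB_neg (D x z).
set dp := Num.max _ _; set dn := Num.max _ _.
by move=> dE; lra.
Qed.

(** Reflection of [z] exchanges the two parts of a function odd in [z]. *)
Let I_Dn : I Dn = I Dp.
Proof.
apply: eq_integral => x _; rewrite -ge0_integral_gauss1N; last 2 first.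
- exact: (@measurable_fun_slice _ _ _ _ _ Dn).
- by move=> y; exact: Dn0.
by apply: eq_integral => y _; rewrite /Dn /Dp /D mulNr mulrN opprK.
Qed.

Let I_Dp_lty : (I Dp < +oo)%E.
Proof.
apply: le_lt_trans (iterated_integral_displacement_lty k mT transport_norm_lty).
apply: ge0_le_iterated_integral.
- exact: mDp.
- exact: Dp0.
- by apply/measurable_EFinP; apply: measurableT_comp; [exact: normr_measurable|exact: mD].
- by move=> x z; rewrite lee_fin ge_max ler_norm normr_ge0.
Qed.

(** For fixed [v] the Gaussian at [u] cancels the denominator of [rho]. What is left is [G phi]
    composed with [th], times the derivative of [th], which the substitution inequality bounds by
    the mass of [G]. *)
Let I_rho : (I rho <= 1)%E.
Proof.
rewrite /I (@ge0_tonelli _ _ (measurableTypeR R) (measurableTypeR R) R gauss1 gauss1 rho mrho rho0).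
rewrite -[leRHS](integral_probability_cst _ _ _ gauss1).
apply: ge0_le_integral.
- exact: measurableT.
- by move=> v _; apply: integral_ge0 => u _; exact: rho0.
- apply: (@measurable_fun_integral_param _ _ (measurableTypeR R) (measurableTypeR R) R gauss1
    (fun v u => rho u v)); last by move=> v u; exact: rho0.
  exact: (measurableT_comp mrho (measurable_fun_pair measurable_snd measurable_fst)).
- exact: measurable_cst.
move=> v _.
pose th u := c * T (c * u - s * v) + s * (s * u + c * v).
(* The point [x = c u - s v] moves at speed [c] with [u], whence [c * T'(x) * c] plus [s * s]. *)
have dth (u : R) : is_derive u 1 th (c ^+ 2 * t (c * u - s * v) + s ^+ 2).
  have d1 : is_derive u 1 (fun u => c * u - s * v) (c * 1 - 0).
    by apply: is_deriveB; apply: is_deriveZ.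
  have d2 : is_derive u 1 (fun u => s * u + c * v) (s * 1 + 0).
    by apply: is_deriveD; apply: is_deriveZ.
  have d3 := @is_derive1_comp R T (fun u => c * u - s * v) u _ _ (dT (c * u - s * v)) d1.
  have d4 := is_deriveD (is_deriveZ c d3) (is_deriveZ s d2).
  rewrite [X in is_derive _ _ _ X](_ : _ =
    c *: (phi (c * u - s * v) / (h (T (c * u - s * v)) * phi (T (c * u - s * v))) * (c * 1 - 0)) +
    s *: (s * 1 + 0)); first exact: d4.
  rewrite /t /GRing.scale/=; ring.
have mrhov : measurable_fun setT (fun u => rho u v).
  exact: (@measurable_fun_slice _ _ _ _ _ (fun v u => rho u v) v
    (measurableT_comp mrho (measurable_fun_pair measurable_snd measurable_fst))).
have -> : (\int[gauss1]_u rho u v =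
    \int[mu]_u (G (th u) * phi (th u) * (c ^+ 2 * t (c * u - s * v) + s ^+ 2))%:E)%E.
  rewrite ge0_integral_gauss1; [|exact: mrhov|by move=> u; exact: rho0].
  by apply: eq_integral => u _; rewrite -EFinM divfK// gt_eqF.
have cj : continuous (fun u => c ^+ 2 * t (c * u - s * v) + s ^+ 2).
  move=> u; apply: cvgD; last exact: cvg_cst.
  apply: cvgM; first exact: cvg_cst.
  apply: (@continuous_comp _ _ _ (fun u => c * u - s * v) t); last exact: ct.
  apply: cvgB; last exact: cvg_cst.
  by apply: cvgM; [exact: cvg_cst|exact: cvg_id].
have cGp : continuous (fun y => G y * phi y).
  by move=> y; apply: cvgM; [exact: cG|exact: continuous_gauss_density].
have Gp0 y : 0 <= G y * phi y.
  by apply: mulr_ge0; apply: ltW; [exact: G_gt0|exact: gauss_density_gt0].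
apply: le_trans (@integral_substitution_le R th _ (fun y => G y * phi y) dth (fun u => jac_gt0 _) cj cGp Gp0) _.
under eq_integral do rewrite EFinM.
rewrite -ge0_integral_gauss1; last 2 first.
- by apply/measurable_EFinP; exact: continuous_measurable_fun.
- by move=> x; rewrite lee_fin ltW.
by rewrite (smoothed_mass _ _ cs _ _ _ mh a0 hab h1 c1).
Qed.

Lemma rotated_transport_le : (I P <= I Q + ((1 - c ^+ 2) * L)%:E)%E.
Proof.
have cL0 : (0 <= (1 + c ^+ 2 * L)%:E)%E 
  by rewrite lee_fin; apply: addr_ge0; [exact: ler01|apply: mulr_ge0; [exact: sqr_ge0|exact: L0]].
have rP := mrot _ mP; have rQ := mrot _ mQ; have rDp := mrot _ mDp; have rDn := mrot _ mDn.
have rP0 u v : (0 <= rot P u v)%E by exact: P0.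
have rQ0 u v : (0 <= rot Q u v)%E by exact: Q0.
have rDp0 u v : (0 <= rot Dp u v)%E by exact: Dp0.
have rDn0 u v : (0 <= rot Dn u v)%E by exact: Dn0.
have m1 : measurable_fun setT (fun p : R * R => rot P p.1 p.2 + rot Dn p.1 p.2)%E.
  exact: emeasurable_funD.
have m2 : measurable_fun setT (fun p : R * R => rho p.1 p.2 + rot Q p.1 p.2)%E.
  exact: emeasurable_funD.
have m3 : measurable_fun setT (fun p : R * R => rho p.1 p.2 + rot Q p.1 p.2 + rot Dp p.1 p.2)%E.
  exact: emeasurable_funD.
have mc r : measurable_fun [set: R * R] (fun=> r : \bar R) by exact: measurable_cst.
have : (I (fun u v => rot P u v + rot Dn u v + (1 + c ^+ 2 * L)%:E) <=
        I (fun u v => rho u v + rot Q u v + rot Dp u v + L%:E))%E.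
  apply: ge0_le_iterated_integral.
  - by apply: emeasurable_funD; [exact: m1|exact: mc].
  - by move=> u v; apply: adde_ge0; [apply: adde_ge0; [exact: rP0|exact: rDn0]|exact: cL0].
  - by apply: emeasurable_funD; [exact: m3|exact: mc].
  - exact: pointwise.
have E1 : I (fun u v => rot P u v + rot Dn u v + (1 + c ^+ 2 * L)%:E)%E =
    (I P + I Dp + (1 + c ^+ 2 * L)%:E)%E.
  rewrite (I_add (fun u v => rot P u v + rot Dn u v)%E (fun _ _ => (1 + c ^+ 2 * L)%:E) m1); last 3 first.
  - by move=> u v; apply: adde_ge0; [exact: P0|exact: Dn0].
  - exact: mc.
  - by move=> _ _; exact: cL0.
  by rewrite (I_add (rot P) (rot Dn) rP rP0 rDn rDn0) I_cst (I_rot _ mP P0) (I_rot _ mDn Dn0) I_Dn.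
have E2 : I (fun u v => rho u v + rot Q u v + rot Dp u v + L%:E)%E = (I rho + I Q + I Dp + L%:E)%E.
  rewrite (I_add (fun u v => rho u v + rot Q u v + rot Dp u v)%E (fun _ _ => L%:E) m3); last 3 first.
  - by move=> u v; apply: adde_ge0; [apply: adde_ge0; [exact: rho0|exact: Q0]|exact: Dp0].
  - exact: mc.
  - by move=> _ _; rewrite lee_fin; exact: L0.
  rewrite (I_add (fun u v => rho u v + rot Q u v)%E (rot Dp) m2 _ rDp rDp0); last first.
    by move=> u v; apply: adde_ge0; [exact: rho0|exact: Q0].
  by rewrite (I_add rho (rot Q) mrho rho0 rQ rQ0) I_cst (I_rot _ mQ Q0) (I_rot _ mDp Dp0).
rewrite E1 E2.
have I0 f : (forall x y, (0 <= f x y)%E) -> (0 <= I f)%E.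
  by move=> f0; apply: integral_ge0 => x _; apply: integral_ge0 => y _; exact: f0.
exact: (le_cancel_finite _ _ _ _ _ _ _ (I0 _ P0) (I0 _ Q0) (I0 _ Dp0) (I0 _ rho0) I_rho I_Dp_lty).
Qed.

Let lnG_cont : continuous (fun y => ln (G y) + L).
Proof.
move=> y; apply: cvgD; last exact: cvg_cst.
exact: (continuous_ln_comp _ cG G_gt0).
Qed.

Let lnh_cont : continuous (fun y => ln (h y) + L).
Proof.
move=> y; apply: cvgD; last exact: cvg_cst.
exact: (continuous_ln_comp _ ch h_gt0).
Qed.

Let integral_Q : I Q = ((c ^+ 2)%:E * \int[gauss1]_x ((ln (h x) + L) * h x)%:E)%E.
Proof.
rewrite -(transport_eq (fun y => ln (h y) + L) (L *+ 2) lnh_cont (fun x => lnL _ (hab x))).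
rewrite -ge0_integralZl_EFin; last 4 first.
- by [].
- by move=> x _; rewrite lee_fin; case/andP: (lnL _ (hab (T x))).
- by apply/measurable_EFinP; exact: (measurableT_comp mlnh mT).
- exact: sqr_ge0.
by apply: eq_integral => x _; rewrite -EFinM; exact: integral_probability_cst.
Qed.

(** Transport at fixed [z] replaces [T x] by [x] with weight [h x]. The rotation with sine [- s]
    then makes [y = c x + s z] a variable, with [x = c y - s w], and averaging [h] over [w] yields
    [G y]. *)
Let integral_P : I P = (\int[gauss1]_y ((ln (G y) + L) * G y)%:E)%E.
Proof.
have lnG0 y : 0 <= ln (G y) + L by case/andP: (lnL _ (G_ab y)).
rewrite /I (@ge0_tonelli _ _ (measurableTypeR R) (measurableTypeR R) R gauss1 gauss1 P mP P0).
transitivity (\int[gauss1]_z \int[gauss1]_x ((ln (G (c * x + s * z)) + L) * h x)%:E)%E.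
  apply: eq_integral => z _.
  apply: (transport_eq (fun x => ln (G (c * x + s * z)) + L) (L *+ 2)) => [x|x]; last exact: lnL.
  apply: (@continuous_comp _ _ _ (fun x => c * x + s * z) (fun y => ln (G y) + L)); last exact: lnG_cont.
  apply: cvgD; last exact: cvg_cst.
  by apply: cvgM; [exact: cvg_cst|exact: cvg_id].
rewrite ge0_tonelli; last 2 first.
- apply/measurable_EFinP; apply: measurable_funM; last exact: (measurableT_comp mh).
  apply: (measurableT_comp mlnG).
  by apply: measurable_funD; apply: measurable_funM.
- by move=> z x; rewrite lee_fin; apply: mulr_ge0; [exact: lnG0|exact/ltW/h_gt0].
pose F (y w : R) : \bar R := ((ln (G y) + L) * h (c * y - s * w))%:E.
have F0 y w : (0 <= F y w)%E.
  by rewrite lee_fin; apply: mulr_ge0; [exact: lnG0|exact/ltW/h_gt0].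
have mF : measurable_fun setT (fun p : R * R => F p.1 p.2).
  apply/measurable_EFinP; apply: measurable_funM; first exact: (measurableT_comp mlnG).
  apply: (measurableT_comp mh).
  by apply: measurable_funB; apply: measurable_funM.
have csN : c ^+ 2 + (- s) ^+ 2 = 1 by rewrite sqrrN.
transitivity (\int[gauss1]_x \int[gauss1]_z F (c * x - (- s) * z)%R ((- s) * x + c * z)%R)%E.
  apply: eq_integral => x _; apply: eq_integral => z _; rewrite /F; congr _%:E; congr (_ * _).
    by rewrite mulNr opprK.
  congr h; have -> : c * (c * x - - s * z) - s * (- s * x + c * z) = (c ^+ 2 + s ^+ 2) * x by ring.
  by rewrite cs mul1r.
rewrite (ge0_integral_gauss1_rot F _ _ csN c1 mF F0).
apply: eq_integral => y _; rewrite /F.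
under eq_integral do rewrite EFinM.
have mhy : measurable_fun setT (fun w => (h (c * y - s * w))%:E).
  apply/measurable_EFinP; apply: (measurableT_comp mh).
  by apply: measurable_funB => //; apply: measurable_funM.
rewrite ge0_integralZl_EFin; last 4 first.
- by [].
- by move=> w _; rewrite lee_fin ltW.
- exact: mhy.
- exact: lnG0.
rewrite EFinM; congr (_ * _)%E.
rewrite (smoothedE _ _ _ _ _ mh hab) -ge0_integral_gauss1N; last 2 first.
- apply/measurable_EFinP; apply: (measurableT_comp mh).
  by apply: measurable_funD => //; apply: measurable_funM.
- by move=> w; rewrite lee_fin ltW.
by apply: eq_integral => w _; rewrite mulrN.
Qed.

Lemma shifted_entropy_transport_le :
  (\int[gauss1]_y ((ln (G y) + L) * G y)%:E <=
   (c ^+ 2)%:E * \int[gauss1]_x ((ln (h x) + L) * h x)%:E + ((1 - c ^+ 2) * L)%:E)%E.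
Proof. by rewrite -integral_P -integral_Q; exact: rotated_transport_le. Qed.

End RotatedTransport.

End Transport.

Lemma psi_smoothed_le :
  (\int[gauss1]_y (psi (G y))%:E <=
   (c ^+ 2)%:E * \int[gauss1]_x (psi (h x))%:E + (1 - c ^+ 2)%:E)%E.
Proof.
have mphi1 : (\int[mu]_x (phi x)%:E = 1)%E.
  rewrite -[RHS](integral_probability_cst _ _ _ gauss1) ge0_integral_gauss1//.
  by apply: eq_integral => x _; rewrite mul1e.
have mhphi1 : (\int[mu]_x (h x * phi x)%:E = 1)%E.
  rewrite -h1 ge0_integral_gauss1//; first exact/measurable_EFinP.
  by move=> x; rewrite lee_fin ltW.
have chphi : continuous (fun x => h x * phi x).
  by move=> x; apply: cvgM; [exact: ch|exact: continuous_gauss_density].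
have hphi0 x : 0 < h x * phi x by rewrite mulr_gt0.
have [T dT] := monotone_transport _ _ continuous_gauss_density phi0 mphi1 chphi hphi0 mhphi1.
have ab : a <= b by have /andP[] := hab 0; exact: le_trans.
have b0 : 0 < b by exact: lt_le_trans ab.
(* Sized so that [|ln u| <= L] on [[a, b]] whatever the signs of [ln a] and [ln b]. *)
pose L := `|ln a| + `|ln b|.
have L0 : 0 <= L by rewrite addr_ge0.
have lnL u : a <= u <= b -> 0 <= ln u + L <= L *+ 2.
  move=> /andP[au ub]; have u0 : 0 < u by exact: lt_le_trans au.
  have : ln a <= ln u by rewrite ler_ln.
  have : ln u <= ln b by rewrite ler_ln.
  have := ler_norm (ln b); have := ler_norm (- ln a); rewrite normrN.
  have := normr_ge0 (ln b); have := normr_ge0 (ln a).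
  by rewrite /L mulr2n => *; apply/andP; split; lra.
have key := shifted_entropy_transport_le T dT L lnL L0.
have shift (f : R -> R) : measurable_fun setT f -> (forall x, a <= f x <= b) ->
    (\int[gauss1]_x (f x)%:E = 1)%E ->
    (\int[gauss1]_x (psi (f x))%:E + L%:E = \int[gauss1]_x ((ln (f x) + L) * f x)%:E + 1)%E.
  move=> mf fab f1.
  have f0 x : 0 < f x by case/andP: (fab x) => /(lt_le_trans a0).
  have mpf : measurable_fun setT (fun x => (psi (f x))%:E).
    by apply/measurable_EFinP; exact: (measurableT_comp measurable_psi mf).
  have mfE : measurable_fun setT (fun x => (f x)%:E) by exact/measurable_EFinP.
  have lnf0 x : (0 <= ((ln (f x) + L) * f x)%:E)%E.
    by rewrite lee_fin mulr_ge0 ?(ltW (f0 x))//; case/andP: (lnL _ (fab x)).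
  have -> : L%:E = (\int[gauss1]_x (L * f x)%:E)%E.
    under eq_integral do rewrite EFinM.
    rewrite ge0_integralZl_EFin//; last by move=> x _; rewrite lee_fin ltW.
    by rewrite f1 mule1.
  rewrite -[X in (_ = _ + X)%E](integral_probability_cst _ _ _ gauss1).
  rewrite -ge0_integralD//; last 3 first.
  - by move=> x _; rewrite lee_fin psi_ge0.
  - by move=> x _; rewrite lee_fin mulr_ge0// ltW.
  - by apply/measurable_EFinP; apply: measurable_funM.
  rewrite -ge0_integralD//; last first.
    apply/measurable_EFinP; apply: measurable_funM => //.
    by apply: measurable_funD => //; exact: (measurableT_comp (@measurable_ln _) mf).
  by apply: eq_integral => x _; rewrite -!EFinD; congr _%:E; rewrite /psi; ring.
have Y1 : (\int[gauss1]_x ((ln (h x) + L) * h x)%:E < +oo)%E.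
  apply: (@le_lt_trans _ _ (\int[gauss1]_x ((L *+ 2 * b)%:E : \bar R))%E); last first.
    by rewrite (integral_probability_cst _ _ _ gauss1) ltry.
  apply: ge0_le_integral => //.
  - by move=> x _; rewrite lee_fin mulr_ge0 ?(ltW (h_gt0 x))//; case/andP: (lnL _ (hab x)).
  - apply/measurable_EFinP; apply: measurable_funM => //.
    by apply: measurable_funD => //; exact: (measurableT_comp (@measurable_ln _) mh).
  - move=> x _; rewrite lee_fin; case/andP: (lnL _ (hab x)) => l0 l2.
    by apply: ler_pM => //; [exact: ltW|case/andP: (hab x)].
have cG : continuous G := continuous_smoothed _ _ _ _ _ mh a0 hab ch.
have := shift G (continuous_measurable_fun cG) (smoothed_bounds _ _ _ _ _ mh a0 hab)
  (smoothed_mass _ _ cs _ _ _ mh a0 hab h1 c1).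
have := shift h mh hab h1.
have : (0 <= \int[gauss1]_x (psi (h x))%:E)%E.
  by apply: integral_ge0 => x _; rewrite lee_fin psi_ge0.
have : (0 <= \int[gauss1]_x (psi (G x))%:E)%E.
  by apply: integral_ge0 => x _; rewrite lee_fin psi_ge0.
have : (0 <= \int[gauss1]_x ((ln (h x) + L) * h x)%:E)%E.
  apply: integral_ge0 => x _; rewrite lee_fin mulr_ge0 ?(ltW (h_gt0 x))//.
  by case/andP: (lnL _ (hab x)).
move=> y0 p0 q0 E1 E2; exact: (psi_of_shifted _ _ _ _ _ _ _ Y1 y0 p0 q0 E1 E2 key).
Qed.
End NiceCase.

(** * Bounded measurable functions *)

Section PsiLipschitz.
Context {R : realType}.
Implicit Types (x y u v a b L m : R).

Lemma psi_scale m x : 0 < m -> 0 < x -> psi (m * x) = m * psi x + x * (m * ln m) - m + 1.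
Proof. by move=> m0 x0; rewrite /psi lnM ?posrE//; ring. Qed.

(** The derivative [ln + 1] of [psi] is at most [L + 1] in absolute value on this range. The case
    [v <= u] uses the tangent bound, the other one the monotonicity of [ln]. *)
Lemma psi_lipschitz L u v : 0 < u -> 0 < v -> `|ln u| <= L -> `|ln v| <= L ->
  psi u <= psi v + (L + 1) * `|u - v|.
Proof.
move=> u0 v0; rewrite !ler_norml => /andP[uL Lu] /andP[vL Lv].
have L0 : 0 <= L by lra.
suff : u * ln u - v * ln v <= (L + 1) * `|u - v| by rewrite /psi; lra.
have [vu|/ltW uv] := leP v u.
  rewrite ger0_norm ?subr_ge0//.
  have : ln (u / v) <= u / v - 1 by apply: ln_leB1; rewrite divr_gt0.
  rewrite ln_div ?posrE// -(ler_pM2l v0) mulrBr [v * (u / v - 1)]mulrBr mulrCA divff ?gt_eqF// !mulr1.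
  have : (u - v) * ln u <= (u - v) * L by rewrite ler_wpM2l// subr_ge0.
  by lra.
rewrite ler0_norm ?subr_le0//.
have : u * ln u <= u * ln v by rewrite ler_wpM2l ?(ltW u0)// ler_ln.
have : (v - u) * - L <= (v - u) * ln v by rewrite ler_wpM2l// subr_ge0.
by nra.
Qed.

Lemma norm_ln_bound a b u : 0 < a -> a <= u <= b -> `|ln u| <= `|ln a| + `|ln b|.
Proof.
move=> a0 /andP[au ub]; have u0 : 0 < u by exact: lt_le_trans au.
have : ln a <= ln u by rewrite ler_ln.
have : ln u <= ln b by rewrite ler_ln// ?posrE; exact: lt_le_trans ub.
have := ler_norm (ln b); have := ler_norm (- ln a); rewrite normrN.
have := normr_ge0 (ln b); have := normr_ge0 (ln a).
by rewrite ler_norml => *; apply/andP; split; lra.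
Qed.

Lemma continuous_psi : continuous (@psi R).
Proof.
move=> x; suff cx : {for x, continuous (fun y => y * ln y)}.
  by apply: cvgD; [exact: cx|exact: cvg_cst].
rewrite /prop_for /continuous_at; case: (ltrgtP x 0) => [x0|x0|->].
- have -> : x * ln x = 0 by rewrite ln0 ?mulr0// ltW.
  apply: cvg_near_cst.
  near=> y; rewrite ln0 ?mulr0// ltW//.
  by near: y; exact: (cvgr_lt _ cvg_id).
- by apply: cvgM; [exact: cvg_id|exact: continuous_ln].
- rewrite mul0r.
  (* The tangent bound at [1 / sqrt y] gives [|y ln y| <= 2 sqrt y] on []0, 1]], which settles
     continuity at 0. *)
  have cvg2 : (fun y : R => 2 * Num.sqrt y) y @[y --> (0 : R)] --> (0 : R).
    rewrite -[X in _ --> X](mulr0 (2 : R)); apply: cvgM; first exact: cvg_cst.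
    by have := @sqrt_continuous R 0; rewrite /continuous_at sqrtr0.
  apply: norm_cvg0.
  apply: (@squeeze_cvgr _ _ _ _ (fun=> 0) (fun y : R => 2 * Num.sqrt y)) => //; last exact: cvg_cst.
  near=> y; rewrite normr_ge0/=.
  have [y0|y0] := leP y 0; first by rewrite ln0// mulr0 normr0 mulr_ge0// sqrtr_ge0.
  have y1 : y <= 1.
    by rewrite ltW//; near: y; exact: (cvgr_lt _ cvg_id).
  have s0 : 0 < Num.sqrt y by rewrite sqrtr_gt0.
  have lny : ln y <= 0 by exact: ln_le0.
  rewrite normrM ger0_norm ?ltW// ler0_norm//.
  have : ln ((Num.sqrt y)^-1) <= (Num.sqrt y)^-1 - 1 by apply: ln_leB1; rewrite invr_gt0.
  rewrite lnV ?posrE// => H.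
  have yE : y = Num.sqrt y * Num.sqrt y by rewrite -expr2 sqr_sqrtr// ltW.
  rewrite {1 2}yE lnM ?posrE//.
  have : Num.sqrt y * (- ln (Num.sqrt y)) <= Num.sqrt y * ((Num.sqrt y)^-1 - 1) by rewrite ler_wpM2l// ltW.
  rewrite mulrBr divff ?gt_eqF// mulr1.
  set z := Num.sqrt y in s0 *; set l := ln z; move=> h.
  have : z * (z * - l) <= z * (1 - z) by rewrite ler_wpM2l// ltW.
  by nra.
Unshelve. all: end_near. Qed.

End PsiLipschitz.

Section BoundedCase.
Context {R : realType}.
Notation gauss1 := (@gauss1 R).
Notation mu := (@lebesgue_measure R).
Variables (c s : R).
Hypothesis cs : c ^+ 2 + s ^+ 2 = 1.
Hypothesis c1 : c != -1.

Lemma measurable_smoothing (f : R -> \bar R) : measurable_fun setT f ->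
  measurable_fun setT (fun p : R * R => f (c * p.1 + s * p.2)).
Proof.
move=> mf; apply: (measurableT_comp mf).
by apply: measurable_funD; apply: measurable_funM.
Qed.

Lemma integral_smoothing (f : R -> \bar R) :
  measurable_fun setT f -> (forall x, 0 <= f x)%E ->
  (\int[gauss1]_x \int[gauss1]_w f (c * x + s * w)%R = \int[gauss1]_x f x)%E.
Proof.
move=> mf f0.
have csN : c ^+ 2 + (- s) ^+ 2 = 1 by rewrite sqrrN.
have -> : (\int[gauss1]_x f x = \int[gauss1]_x \int[gauss1]_w f x)%E.
  by apply: eq_integral => x _; rewrite (integral_probability_cst _ _ _ gauss1).
rewrite -(ge0_integral_gauss1_rot (fun x _ => f x) _ _ csN c1 (measurableT_comp mf measurable_fst) (fun x _ => f0 x)).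
by apply: eq_integral => x _; apply: eq_integral => w _; rewrite mulNr opprK.
Qed.

Lemma psi_bounded_integrable (f : R -> R) (l u : R) : measurable_fun setT f -> 0 < l ->
  (forall x, l <= f x <= u) -> gauss1.-integrable setT (EFin \o (fun x => psi (f x))).
Proof.
move=> mf l0 flu; pose L := `|ln l| + `|ln u|.
have f0 x : 0 < f x by case/andP: (flu x) => /(lt_le_trans l0).
apply: (measurable_bounded_gauss1_integrable _ 0 (psi l + (L + 1) * (u - l))).
  exact: (measurableT_comp measurable_psi mf).
move=> x; rewrite psi_ge0/=; apply: (le_trans (psi_lipschitz _ _ _ (f0 x) l0 (norm_ln_bound _ _ _ l0 (flu x)) _)).
  by rewrite /L ler_wpDr.
rewrite lerD2l ler_wpM2l ?addr_ge0//; case/andP: (flu x) => lf fu.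
by rewrite ger0_norm ?subr_ge0// lerD2r.
Qed.

(** [h] is divided by its mass [m]. By [psi_scale] both entropy integrals acquire the same
    correction [psi m - m], because smoothing preserves mass. *)
Lemma psi_smoothed_mass_le (h : R -> R) (a b m : R) : continuous h -> 0 < a ->
  (forall x, a <= h x <= b) -> (\int[gauss1]_x (h x)%:E = m%:E)%E ->
  (\int[gauss1]_y (psi (smoothed c s h y))%:E <=
   (c ^+ 2)%:E * \int[gauss1]_x (psi (h x))%:E + ((1 - c ^+ 2) * psi m)%:E)%E.
Proof.
move=> ch a0 hab hm.
have am : a <= m.
  rewrite -lee_fin -hm -[leLHS](integral_probability_cst _ _ _ gauss1).
  apply: ge0_le_integral => //.
  - by move=> x _; rewrite lee_fin ltW.
  - by apply/measurable_EFinP; exact: continuous_measurable_fun.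
  - by move=> x _; rewrite lee_fin; case/andP: (hab x).
have m0 : 0 < m by exact: lt_le_trans am.
pose k x := h x / m.
have ck : continuous k by move=> x; apply: cvgM; [exact: ch|exact: cvg_cst].
have mk : measurable_fun setT k by exact: continuous_measurable_fun.
have mh : measurable_fun setT h by exact: continuous_measurable_fun.
have kab x : a / m <= k x <= b / m.
  by rewrite !ler_pM2r ?invr_gt0.
have am0 : 0 < a / m by rewrite divr_gt0.
have k1 : (\int[gauss1]_x (k x)%:E = 1)%E.
  under eq_integral do rewrite /k mulrC EFinM.
  rewrite ge0_integralZl_EFin//; last 3 first.
  - by move=> x _; rewrite lee_fin (le_trans (ltW a0))//; case/andP: (hab x).
  - by apply/measurable_EFinP; exact: continuous_measurable_fun.
  - by rewrite invr_ge0 ltW.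
  by rewrite hm -EFinM mulVf// gt_eqF.
have smoothedZ y : smoothed c s h y = m * smoothed c s k y.
  apply: EFin_inj; rewrite EFinM (smoothedE _ _ _ _ _ mh hab) (smoothedE _ _ _ _ _ mk kab).
  rewrite -ge0_integralZl_EFin//; last 3 first.
  - by move=> x _; rewrite lee_fin (le_trans (ltW am0))//; case/andP: (kab (c * y + s * x)).
  - apply/measurable_EFinP; apply: measurableT_comp; first exact: continuous_measurable_fun.
    by apply: measurable_funD => //; apply: measurable_funM.
  - exact: ltW.
  by apply: eq_integral => w _; rewrite -EFinM /k mulrCA divff ?gt_eqF// mulr1.
have scale (f : R -> R) l u : continuous f -> 0 < l -> (forall x, l <= f x <= u) ->
    (\int[gauss1]_x (f x)%:E = 1)%E ->
    exists q : R, (\int[gauss1]_x (psi (f x))%:E = q%:E)%E /\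
       (\int[gauss1]_x (psi (m * f x))%:E = (m * q + psi m - m)%:E)%E.
  move=> cf l0 flu f1.
  have f0 x : 0 < f x by case/andP: (flu x) => /(lt_le_trans l0).
  have mf : measurable_fun setT f by exact: continuous_measurable_fun.
  have iF : gauss1.-integrable setT (EFin \o f).
    exact: (measurable_bounded_gauss1_integrable _ _ _ mf flu).
  have iP := psi_bounded_integrable _ _ _ mf l0 flu.
  exists (fine (\int[gauss1]_x (psi (f x))%:E)%E).
  have PE := fineK (integrable_fin_num measurableT iP); split; first by rewrite PE.
  transitivity (\int[gauss1]_x ((m%:E * (psi (f x))%:E + (m * ln m)%:E * (f x)%:E) + (1 - m)%:E))%E.
    apply: eq_integral => x _; rewrite psi_scale// -!EFinM -!EFinD; congr _%:E; ring.
  have i1 := integrableZl measurableT m iP.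
  have i2 := integrableZl measurableT (m * ln m) iF.
  have i3 : gauss1.-integrable setT (fun=> (1 - m)%:E).
    by apply: (measurable_bounded_gauss1_integrable _ (1 - m) (1 - m)) => // x; rewrite lexx.
  rewrite (integralD measurableT (integrableD measurableT i1 i2) i3).
  rewrite (integralD measurableT i1 i2) (integralZl measurableT iP) (integralZl measurableT iF).
  rewrite f1 (integral_probability_cst _ _ _ gauss1) mule1 -PE -EFinM -!EFinD; congr _%:E.
  by rewrite /psi /=; ring.
have [q [E1 E2]] := scale k _ _ ck am0 kab k1.
have [p [E3 E4]] := scale (smoothed c s k) _ _ (continuous_smoothed _ _ _ _ _ mk am0 kab ck) am0
  (smoothed_bounds _ _ _ _ _ mk am0 kab) (smoothed_mass _ _ cs _ _ _ mk am0 kab k1 c1).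
have := psi_smoothed_le _ _ cs c1 _ _ _ ck am0 kab k1.
under [in X in _ -> X]eq_integral do rewrite smoothedZ.
rewrite E1 E3 E4.
have -> : (\int[gauss1]_x (psi (h x))%:E = \int[gauss1]_x (psi (m * k x))%:E)%E.
  by apply: eq_integral => x _; rewrite /k mulrCA divff ?gt_eqF// mulr1.
rewrite E2 -!EFinM -!EFinD !lee_fin => H.
have : m * p <= m * (c ^+ 2 * q + (1 - c ^+ 2)) by rewrite ler_wpM2l// ltW.
by lra.
Qed.

Lemma gauss1_tail_small (e : R) : 0 < e ->
  exists n : nat, (gauss1 (~` `[(- n%:R)%R, n%:R]%classic) <= e%:E)%E.
Proof.
move=> e0; pose I (n : nat) : set R := `[(- n%:R)%R, n%:R]%classic.
have mI n : measurable (I n) by exact: measurable_itv.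
have ndI : {homo I : n m / (n <= m)%N >-> (n <= m)%O}.
  move=> n m nm; apply/subsetPset => x; rewrite /I/= !in_itv/= => /andP[u v].
  apply/andP; split; last by rewrite (le_trans v)// ler_nat.
  by rewrite (le_trans _ u)// lerN2 ler_nat.
have UI : \bigcup_n I n = setT.
  apply/seteqP; split => // x _; exists (Num.bound `|x|) => //.
  rewrite /I/= in_itv/= -ler_norml ltW//.
  by apply: archi_boundP.
have mUI : measurable (\bigcup_n I n) by exact: bigcup_measurable.
have cvgI := @nondecreasing_cvg_mu _ _ _ gauss1 I mI mUI ndI.
have [n nE] : exists n, ((1 - e)%:E <= gauss1 (I n))%E.
  apply: contrapT => /forallNP H.
  have : (gauss1 (\bigcup_n I n) <= (1 - e)%:E)%E.
    rewrite -(cvg_lim _ cvgI)//; apply: lime_le; first by apply/cvg_ex; eexists; exact: cvgI.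
    by apply: nearW => n; have /negP := H n; rewrite -ltNge => /ltW.
  rewrite UI (_ : gauss1 setT = 1%E); last exact: (probability_setT gauss1).
  by rewrite lee_fin leNgt ltrBlDr ltrDl e0.
exists n; rewrite -/(I n).
have -> : gauss1 (~` I n) = (1 - gauss1 (I n))%E by exact: (probability_setC gauss1 (mI n)).
have : gauss1 (I n) \is a fin_num by exact: (@fin_num_measure _ _ _ gauss1 (I n) (mI n)).
move: nE; move: (gauss1 (I n)) => [r| |]//=; rewrite -EFinB !lee_fin; lra.
Qed.

(** Lebesgue approximation on [[-n, n]] controls the Gaussian error there, since
    [gauss_density <= 1]; outside, values in [[a, b]] meet a small mass. Clipping to [[a, b]] does
    not increase the error, as [h] takes its values there. *)
Lemma continuous_approx (h : R -> R) (a b e : R) : measurable_fun setT h ->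
  (forall x, a <= h x <= b) -> 0 < e ->
  exists k : R -> R, [/\ continuous k, forall x, a <= k x <= b &
    (\int[gauss1]_x `|h x - k x|%:E <= e%:E)%E].
Proof.
move=> mh hab e0.
have ab : a <= b by have /andP[] := hab 0; exact: le_trans.
(* The extra 1 keeps this divisor positive when [a = b]. *)
have d0 : 0 < b - a + 1 by rewrite ltr_wpDl// subr_ge0.
have e20 : 0 < e / 2 by rewrite divr_gt0.
have [n nE] := gauss1_tail_small _ (divr_gt0 e20 d0).
pose E : set R := `[(- n%:R)%R, n%:R]%classic.
have mE : measurable E by exact: measurable_itv.
have Elty : (mu E < +oo)%E by rewrite /E lebesgue_measure_itv/=; case: ifP => _; rewrite -?EFinB ltry.
have iE : mu.-integrable E (EFin \o h).
  apply: measurable_bounded_integrable => //; first exact: measurable_funTS.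
  exists (`|a| + `|b|); split; first by rewrite num_real.
  move=> x Mx y _ /=; apply: le_trans (ltW Mx); have /andP[ay yb] := hab y.
  have := ler_norm b; have := ler_norm (- a); rewrite normrN.
  have := normr_ge0 b; have := normr_ge0 a.
  by rewrite ler_norml => *; apply/andP; split; lra.
have [g [cg ig cvg0]] := approximation_continuous_integrable mE Elty iE.
have [m mE'] : exists m, (\int[mu]_(z in E) `|(h z - g m z)%:E| <= (e / 2)%:E)%E.
  apply: contrapT => /forallNP H.
  have : ((e / 2)%:E <= 0 :> \bar R)%E.
    rewrite -(cvg_lim _ cvg0)//; apply: lime_ge; first by apply/cvg_ex; eexists; exact: cvg0.
    by apply: nearW => m; have /negP := H m; rewrite -ltNge => /ltW.
  by rewrite lee_fin leNgt e20.
pose k x := Num.min (Num.max (g m x) a) b.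
have ck : continuous k.
  have cmax (f : R -> R) u : continuous f -> continuous (fun x => Num.max (f x) u).
    move=> cf; rewrite (_ : (fun _ => _) = fun x => (f x + u + `|f x - u|) / 2); last first.
      by apply/funext => x; rewrite maxr_absE.
    move=> x; apply: cvgM; last exact: cvg_cst.
    apply: cvgD; first by apply: cvgD; [exact: cf|exact: cvg_cst].
    by apply: cvg_norm; apply: cvgB; [exact: cf|exact: cvg_cst].
  have cmin (f : R -> R) u : continuous f -> continuous (fun x => Num.min (f x) u).
    move=> cf; rewrite (_ : (fun _ => _) = fun x => (f x + u - `|f x - u|) / 2); last first.
      by apply/funext => x; rewrite minr_absE.
    move=> x; apply: cvgM; last exact: cvg_cst.
    apply: cvgB; first by apply: cvgD; [exact: cf|exact: cvg_cst].
    by apply: cvg_norm; apply: cvgB; [exact: cf|exact: cvg_cst].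
  exact/cmin/cmax/cg.
have kab x : a <= k x <= b by rewrite /k le_min le_max lexx orbT ab ge_min lexx orbT.
exists k; split => //.
have hk x : `|h x - k x| <= `|h x - g m x|.
  have /andP[ah hb] := hab x; rewrite /k.
  case: (leP (g m x) a) => ga; first by rewrite (min_l ab) !ger0_norm; lra.
  by case: (leP (g m x) b) => gb //; rewrite !ler0_norm; lra.
have hkd x : `|h x - k x| <= b - a + 1.
  by have /andP[? ?] := hab x; have /andP[? ?] := kab x; rewrite ler_norml; apply/andP; split; lra.
have mk : measurable_fun setT k by exact: continuous_measurable_fun.
have mg : measurable_fun setT (g m) by exact: continuous_measurable_fun.
have mhk : measurable_fun setT (fun x => `|h x - k x|%:E).
  apply/measurable_EFinP; apply: (measurableT_comp (@normr_measurable _ _)).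
  exact: measurable_funB.
have mhg : measurable_fun setT (fun x => `|h x - g m x|%:E).
  apply/measurable_EFinP; apply: (measurableT_comp (@normr_measurable _ _)).
  exact: measurable_funB.
rewrite -(setUv E) ge0_integral_setU//; last 3 first.
- exact: measurableC.
- by rewrite setUv.
- by apply/disj_setPCl.
rewrite [e]splitr EFinD leeD//.
  apply: le_trans mE'.
  rewrite integral_mkcond [leRHS]integral_mkcond.
  rewrite ge0_integral_gauss1; last 2 first.
  - by apply/(measurable_restrictT _ _).1 => //; exact: measurable_funTS.
  - by move=> x; rewrite erestrict_ge0.
  apply: ge0_le_integral => //.
  - by move=> x _; rewrite mule_ge0// ?erestrict_ge0// lee_fin ltW// gauss_density_gt0.
  - apply: emeasurable_funM.
      by apply/(measurable_restrictT _ _).1 => //; exact: measurable_funTS.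
    by apply/measurable_EFinP; exact: measurable_gauss_density.
  - by apply/(measurable_restrictT _ _).1 => //; exact: measurable_funTS.
  - move=> x _; rewrite !patchE; case: ifPn => _; last by rewrite mul0e.
    rewrite -EFinM lee_fin; apply: le_trans (hk x).
    by rewrite ler_piMr// gauss_density_le1.
apply: (@le_trans _ _ (\int[gauss1]_(x in ~` E) (b - a + 1)%:E)%E).
  apply: ge0_le_integral => //.
  - exact: measurableC.
  - exact: measurable_funTS.
  - by move=> x _; rewrite lee_fin.
rewrite integral_cst; last exact: measurableC.
apply: (@le_trans _ _ ((b - a + 1)%:E * (e / 2 / (b - a + 1))%:E)%E).
  by rewrite lee_pmul2l.
by rewrite -EFinM lee_fin mulrCA divff ?gt_eqF// mulr1.
Qed.

Lemma psi_integral_perturb (h k : R -> R) (a b e : R) : 0 < a ->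
  measurable_fun setT h -> measurable_fun setT k ->
  (forall x, a <= h x <= b) -> (forall x, a <= k x <= b) ->
  (\int[gauss1]_x `|h x - k x|%:E <= e%:E)%E ->
  (\int[gauss1]_x (psi (h x))%:E <=
   \int[gauss1]_x (psi (k x))%:E + ((`|ln a| + `|ln b| + 1) * e)%:E)%E.
Proof.
move=> a0 mh mk hab kab hk; set L := `|ln a| + `|ln b|.
have L10 : 0 <= L + 1 by rewrite !addr_ge0.
have h0 x : 0 < h x by case/andP: (hab x) => /(lt_le_trans a0).
have k0 x : 0 < k x by case/andP: (kab x) => /(lt_le_trans a0).
have mhk : measurable_fun setT (fun x => `|h x - k x|%:E).
  apply/measurable_EFinP; apply: (measurableT_comp (@normr_measurable _ _)).
  exact: measurable_funB.
have mph : measurable_fun setT (fun x => (psi (h x))%:E).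
  by apply/measurable_EFinP; exact: (measurableT_comp measurable_psi mh).
have mpk : measurable_fun setT (fun x => (psi (k x))%:E).
  by apply/measurable_EFinP; exact: (measurableT_comp measurable_psi mk).
have mL : measurable_fun setT (fun x => ((L + 1)%:E * `|h x - k x|%:E)%E).
  by apply: emeasurable_funM => //; exact: measurable_cst.
apply: (@le_trans _ _ (\int[gauss1]_x ((psi (k x))%:E + (L + 1)%:E * `|h x - k x|%:E))%E).
  apply: ge0_le_integral => //.
  - by move=> x _; rewrite lee_fin psi_ge0.
  - exact: emeasurable_funD.
  - move=> x _; rewrite -EFinM -EFinD lee_fin; apply: psi_lipschitz => //.
      exact: norm_ln_bound.
    exact: norm_ln_bound.
rewrite ge0_integralD//; last 2 first.
- by move=> x _; rewrite lee_fin psi_ge0.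
- by move=> x _; rewrite mule_ge0// lee_fin.
by rewrite leeD2l// ge0_integralZl_EFin// EFinM lee_wpmul2l.
Qed.

Lemma normr_integralB_le (f g : R -> R) (u v : R) :
  gauss1.-integrable setT (EFin \o f) -> gauss1.-integrable setT (EFin \o g) ->
  (\int[gauss1]_x (f x)%:E = u%:E)%E -> (\int[gauss1]_x (g x)%:E = v%:E)%E ->
  (`|u - v|%:E <= \int[gauss1]_x `|f x - g x|%:E)%E.
Proof.
move=> fi gi fu gv.
have -> : (`|u - v|%:E = `|\int[gauss1]_x (f x - g x)%:E|)%E.
  have := integralB_EFin measurableT fi gi; rewrite fu gv => E.
  by rewrite [X in (`|X|)%E](_ : _ = (u%:E - v%:E)%E).
have mfg : measurable_fun setT (fun x => f x - g x).
  move/integrableP : fi => [/measurable_EFinP mf _].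
  move/integrableP : gi => [/measurable_EFinP mg _].
  exact: measurable_funB.
have mfgE : measurable_fun setT (EFin \o (fun x => f x - g x)) by exact/measurable_EFinP.
exact: (le_abse_integral gauss1 measurableT mfgE).
Qed.

Lemma psi_smoothed_bounded_le (h : R -> R) (a b m : R) : measurable_fun setT h -> 0 < a ->
  (forall x, a <= h x <= b) -> (\int[gauss1]_x (h x)%:E = m%:E)%E ->
  (\int[gauss1]_y (psi (smoothed c s h y))%:E <=
   (c ^+ 2)%:E * \int[gauss1]_x (psi (h x))%:E + ((1 - c ^+ 2) * psi m)%:E)%E.
Proof.
move=> mh a0 hab hm; set L := `|ln a| + `|ln b|.
have L10 : 0 < L + 1 by rewrite ltr_wpDl ?addr_ge0.
apply/lee_addgt0Pr => e e0.
(* [L + 1] is the Lipschitz constant of [psi] on [[a, b]]. There are three errors of [e / 2], one on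
   the left and two on the right with weights [c^2] and [1 - c^2], hence [e] in total. *)
have e20 : 0 < e / 2 / (L + 1) by rewrite !divr_gt0.
have [k [ck kab hk]] := continuous_approx _ _ _ _ mh hab e20.
have mk : measurable_fun setT k by exact: continuous_measurable_fun.
have h0 x : 0 <= h x by case/andP: (hab x) => /(le_trans (ltW a0)).
have k0 x : 0 <= k x by case/andP: (kab x) => /(le_trans (ltW a0)).
have mhE : measurable_fun setT (EFin \o h) by exact/measurable_EFinP.
have kh : (\int[gauss1]_x `|k x - h x|%:E <= (e / 2 / (L + 1))%:E)%E.
  by under eq_integral do rewrite distrC.
have ik : gauss1.-integrable setT (EFin \o k) := measurable_bounded_gauss1_integrable _ _ _ mk kab.
have ih : gauss1.-integrable setT (EFin \o h) := measurable_bounded_gauss1_integrable _ _ _ mh hab.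
pose n := fine (\int[gauss1]_x (k x)%:E)%E.
have nE : (\int[gauss1]_x (k x)%:E = n%:E)%E.
  by rewrite fineK//; exact: (integrable_fin_num measurableT ik).
have mn : (`|n - m| <= e / 2 / (L + 1))%R.
  by rewrite -lee_fin; apply: le_trans (normr_integralB_le _ _ _ _ ik ih nE hm) kh.
have am (f : R -> R) r : measurable_fun setT f -> (forall x, a <= f x <= b) ->
    (\int[gauss1]_x (f x)%:E = r%:E)%E -> a <= r <= b.
  move=> mf fab fr; have mfE : measurable_fun setT (fun x => (f x)%:E) by exact/measurable_EFinP.
  apply/andP; split.
    rewrite -lee_fin -fr -[leLHS](integral_probability_cst _ _ _ gauss1).
    apply: ge0_le_integral => //; first by move=> x _; rewrite lee_fin ltW.
    by move=> x _; rewrite lee_fin; case/andP: (fab x).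
  rewrite -lee_fin -fr -[leRHS](integral_probability_cst _ _ _ gauss1).
  apply: ge0_le_integral => //.
    by move=> x _; rewrite lee_fin; case/andP: (fab x) => /(le_trans (ltW a0)).
  by move=> x _; rewrite lee_fin; case/andP: (fab x).
have psin : psi n <= psi m + e / 2.
  have mb := am _ _ mh hab hm; have nb := am _ _ mk kab nE.
  have n0 : 0 < n by case/andP: nb => /(lt_le_trans a0).
  have m0 : 0 < m by case/andP: mb => /(lt_le_trans a0).
  apply: le_trans (psi_lipschitz _ _ _ n0 m0 (norm_ln_bound _ _ _ a0 nb) (norm_ln_bound _ _ _ a0 mb)) _.
  by rewrite lerD2l -ler_pdivlMl// mulrC.
have msh : measurable_fun setT (smoothed c s h).
  apply/measurable_EFinP; rewrite (_ : EFin \o _ = fun y => \int[gauss1]_w (h (c * y + s * w))%:E)%E.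
    apply: (@measurable_fun_integral_param _ _ R (measurableTypeR R) R gauss1 (fun y w => (h (c * y + s * w))%:E)).
      exact: (measurable_smoothing (EFin \o h) mhE).
    by move=> y w; rewrite lee_fin.
  by apply/funext => y; exact: (smoothedE _ _ _ _ _ mh hab).
have sh := smoothed_bounds c s _ _ _ mh a0 hab.
have sk := smoothed_bounds c s _ _ _ mk a0 kab.
have msk : measurable_fun setT (smoothed c s k).
  by apply: continuous_measurable_fun; exact: (continuous_smoothed _ _ _ _ _ mk a0 kab ck).
(* Smoothing is an average that preserves mass, hence a contraction for the [L^1] distance. *)
have shk : (\int[gauss1]_x `|smoothed c s h x - smoothed c s k x|%:E <= (e / 2 / (L + 1))%:E)%E.
  apply: le_trans hk.
  have mhk : measurable_fun setT (fun x => `|h x - k x|%:E).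
    apply/measurable_EFinP; apply: (measurableT_comp (@normr_measurable _ _)).
    exact: measurable_funB.
  rewrite -(integral_smoothing _ mhk)//.
  have aff (f : R -> R) y : measurable_fun setT f -> measurable_fun setT (fun w => f (c * y + s * w)).
    by move=> mf; apply: (measurableT_comp mf); apply: measurable_funD => //; exact: measurable_funM.
  apply: ge0_le_integral => //.
  - apply/measurable_EFinP; apply: (measurableT_comp (@normr_measurable _ _)).
    exact: measurable_funB.
  - apply: (@measurable_fun_integral_param _ _ R (measurableTypeR R) R gauss1 (fun y w => `|h (c * y + s * w) - k (c * y + s * w)|%:E)).
      exact: (measurable_smoothing _ mhk).
    by move=> y w; rewrite lee_fin.
  - move=> y _; apply: normr_integralB_le.
    + by apply: (measurable_bounded_gauss1_integrable _ _ _ (aff _ y mh)) => w; exact: hab.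
    + by apply: (measurable_bounded_gauss1_integrable _ _ _ (aff _ y mk)) => w; exact: kab.
    + by rewrite (smoothedE _ _ _ _ _ mh hab).
    + by rewrite (smoothedE _ _ _ _ _ mk kab).
have ex f : measurable_fun setT f -> (forall x, a <= f x <= b) ->
    exists r, (\int[gauss1]_x (psi (f x))%:E = r%:E)%E.
  move=> mf fab; exists (fine (\int[gauss1]_x (psi (f x))%:E)).
  by rewrite fineK//; exact: (integrable_fin_num measurableT (psi_bounded_integrable _ _ _ mf a0 fab)).
have := psi_smoothed_mass_le _ _ _ _ ck a0 kab nE.
have := psi_integral_perturb _ _ _ _ _ a0 msh msk sh sk shk.
have := psi_integral_perturb _ _ _ _ _ a0 mk mh kab hab kh.
have [A ->] := ex _ msh sh; have [B ->] := ex _ msk sk.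
have [C ->] := ex _ mk kab; have [D ->] := ex _ mh hab.
rewrite -/L mulrCA divff ?gt_eqF// mulr1 -!EFinM -!EFinD !lee_fin => CD AB BC.
have c20 : 0 <= c ^+ 2 by rewrite sqr_ge0.
have c21 : 0 <= 1 - c ^+ 2 by rewrite -cs addrC addKr sqr_ge0.
have : c ^+ 2 * C <= c ^+ 2 * (D + e / 2) by rewrite ler_wpM2l.
have : (1 - c ^+ 2) * psi n <= (1 - c ^+ 2) * (psi m + e / 2) by rewrite ler_wpM2l.
by lra.
Qed.

End BoundedCase.

(** * Removal of the bounds *)

Section ExtendedPsi.
Context {R : realType}.
Local Open Scope ereal_scope.

(** The smoothing of an unbounded function may be infinite at some points; the value [+oo] there
    keeps the integral of [Psi] from being underestimated. *)
Definition Psi (y : \bar R) : \bar R := if y \is a fin_num then (psi (fine y))%:E else +oo.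

Lemma Psi_ge0 y : 0 <= Psi y.
Proof. by rewrite /Psi; case: ifP => // _; rewrite lee_fin psi_ge0. Qed.

Lemma measurable_Psi : measurable_fun setT Psi.
Proof.
apply: measurable_fun_ifT.
- apply: (measurable_fun_bool true); rewrite setTI.
  have := emeasurable_fin_num measurableT (@measurable_id _ (\bar R) setT).
  by rewrite setTI.
- by apply/measurable_EFinP; apply: (measurableT_comp measurable_psi); exact: fine_measurable.
- exact: measurable_cst.
Qed.

Lemma PsiE (r : R) : Psi r%:E = (psi r)%:E. Proof. by []. Qed.

(** Clamping between [1 / (n + 1)] and [n + 1] produces the two-sided bounds of the bounded case,
    with a meaningful lower bound already at [n = 0]. *)
Definition trunc (n : nat) (y : \bar R) : R :=
  fine (mine (maxe y (n.+1%:R^-1)%:E) n.+1%:R%:E).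

Let inv_le n : (n.+1%:R^-1 <= n.+1%:R :> R)%R.
Proof. by apply: (@le_trans _ _ 1%R); rewrite ?ler1n// invf_le1 ?ler1n// ltr0n. Qed.

Lemma truncE n y : (trunc n y)%:E = mine (maxe y (n.+1%:R^-1)%:E) n.+1%:R%:E.
Proof.
rewrite /trunc fineK// fin_numE; apply/andP; split.
  by rewrite gt_eqF// lt_min lt_max !ltNyr orbT.
by rewrite lt_eqF// gt_min ltry orbT.
Qed.

Lemma trunc_bounds n y : (n.+1%:R^-1 <= trunc n y <= n.+1%:R)%R.
Proof. by rewrite -!lee_fin truncE le_min le_max ge_min !lexx !orbT lee_fin inv_le. Qed.

Lemma measurable_trunc n : measurable_fun setT (trunc n).
Proof.
apply: (measurableT_comp (fine_measurable measurableT)).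
by apply: measurable_mine => //; apply: measurable_maxe.
Qed.

Lemma trunc_leD1 n y : 0 <= y -> (trunc n y)%:E <= y + 1.
Proof.
move=> y0; rewrite truncE ge_min ge_max leeDl// -[X in X <= _]add0e leeD//.
by rewrite lee_fin invf_le1 ?ler1n.
Qed.

Lemma trunc_cvg y : 0 <= y -> (trunc n y)%:E @[n --> \oo] --> y.
Proof.
case: y => [r| |]// r0.
  rewrite lee_fin in r0.
  apply: cvg_EFin; first by near=> n.
  apply: (@squeeze_cvgr _ _ _ _ (fun=> r) (fun n => r + n.+1%:R^-1)%R); last 2 first.
  - exact: cvg_cst.
  - by rewrite -[X in _ --> X](addr0 r); apply: cvgD; [exact: cvg_cst|exact: cvg_harmonic].
  near=> n; rewrite -!lee_fin /= truncE.
  have rn : (r <= n.+1%:R)%R.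
    rewrite (le_trans (ltW (archi_boundP r0)))// ler_nat leqW//.
    by near: n; exists (Num.bound r).
  rewrite le_min le_max lexx/= lee_fin rn/= ge_min ge_max !lee_fin lerDl lerDr r0.
  by rewrite invr_ge0 ler0n.
have -> : (fun n => (trunc n (+oo : \bar R))%:E) = (fun n => (n.+1%:R : R)%:E).
  by apply/funext => n; rewrite truncE max_l ?leey// min_r ?leey.
apply/cvgeryP/cvgryPge => A; near=> n.
rewrite (le_trans (ler_norm A))// (le_trans (ltW (archi_boundP (normr_ge0 A))))// ler_nat leqW//.
by near: n; exists (Num.bound `|A|).
Unshelve. all: end_near. Qed.

(** The majorant for dominated convergence. Raising a value to [1 / (n + 1)] leaves [psi] at most 1,
    the logarithm being nonpositive there; lowering one to [n + 1 >= 1] does not increase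
    [x ln x]. *)
Lemma psi_trunc_le n y : 0 <= y -> (psi (trunc n y))%:E <= Psi y + 1.
Proof.
case: y => [r| |]// r0; last by rewrite /Psi/= leey.
rewrite PsiE -EFinD lee_fin; rewrite lee_fin in r0.
have p0 := psi_ge0 r.
have n1 : (1 <= n.+1%:R :> R)%R by rewrite ler1n.
have trE : trunc n r%:E = Num.min (Num.max r n.+1%:R^-1)%R n.+1%:R.
  by apply: EFin_inj; rewrite truncE EFin_min EFin_max.
have v1 : (n.+1%:R^-1 <= 1 :> R)%R by rewrite invf_le1 ?ltr0n.
have [rv|rv] := leP r n.+1%:R^-1%R.
  rewrite trE (max_r rv) min_l ?inv_le// [X in (X <= _)%R]/psi.
  suff h : (n.+1%:R^-1 * ln (n.+1%:R^-1) <= 0 :> R)%R by rewrite lerD2r (le_trans h).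
  by rewrite mulr_ge0_le0 ?invr_ge0// ln_le0.
rewrite trE (max_l (ltW rv)).
have [rn|] := boolP (r <= n.+1%:R)%R; first by rewrite min_l// lerDl ler01.
rewrite -ltNge => rn; rewrite (min_r (ltW rn)).
suff : (n.+1%:R * ln n.+1%:R <= r * ln r :> R)%R by rewrite /psi; lra.
have r1 : (0 < r)%R by exact: le_lt_trans rn.
by apply: ler_pM; [rewrite ler0n|exact: ln_ge0|exact: ltW|rewrite ler_ln ?posrE ?ltr0n//; exact: ltW].
Qed.

End ExtendedPsi.

Section PsiLimit.
Context {R : realType}.

Lemma Psi_cvg (u : nat -> R) (y : \bar R) : y \is a fin_num ->
  (u n)%:E @[n --> \oo] --> y -> (psi (u n))%:E @[n --> \oo] --> Psi y.
Proof.
case: y => // r _ ur; apply: cvg_EFin; first exact: nearW.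
have ur' : u n @[n --> \oo] --> r by exact: (fine_cvg ur).
exact: (cvg_comp _ _ ur' (continuous_psi r)).
Qed.

Lemma limn_einf_le_cvg (u v : nat -> \bar R) (l : \bar R) :
  (forall n, u n <= v n)%E -> v n @[n --> \oo] --> l -> (limn_einf u <= l)%E.
Proof.
move=> uv vl; rewrite limn_einf_lim -(cvg_lim _ vl)//.
apply: lee_lim; first exact: is_cvg_einfs.
  by apply/cvg_ex; exists l.
apply: nearW => n; apply: le_trans (uv n).
by apply: ereal_inf_lbound; exists n => /=.
Qed.

Lemma limn_einf_ge0 (u : nat -> \bar R) : (forall n, 0 <= u n)%E -> (0 <= limn_einf u)%E.
Proof.
move=> u0; rewrite limn_einf_lim; apply: lime_ge; first exact: is_cvg_einfs.
by apply: nearW => n; apply: le_ereal_inf_tmp => _ [p _ <-]; exact: u0.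
Qed.

Lemma measurable_fun_limn_einf d (T : measurableType d) (f : nat -> T -> \bar R) :
  (forall n, measurable_fun setT (f n)) ->
  measurable_fun setT (fun x => limn_einf (f ^~ x)).
Proof.
move=> mf; rewrite /limn_einf; apply: measurableT_comp => //.
apply: (@measurable_fun_limn_esup _ _ _ _ (fun n x => - f n x)%E) => n.
by apply: measurableT_comp => //; exact: mf.
Qed.

End PsiLimit.

Section Mehler1.
Context {R : realType}.
Notation gauss1 := (@gauss1 R).
Local Open Scope ereal_scope.

Definition mehler1 (c s : R) (f : R -> \bar R) (x : R) : \bar R :=
  \int[gauss1]_w f (c * x + s * w)%R.

Variables (c s : R).
Hypothesis cs : (c ^+ 2 + s ^+ 2 = 1)%R.
Hypothesis c1 : c != (-1)%R.
Variable f : R -> \bar R.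
Hypothesis mf : measurable_fun setT f.
Hypothesis f0 : forall x, 0 <= f x.

Let aff x : measurable_fun [set: R] (fun w => c * x + s * w)%R.
Proof. by apply: measurable_funD => //; exact: measurable_funM. Qed.

Lemma mehler1_ge0 x : 0 <= mehler1 c s f x.
Proof. by apply: integral_ge0. Qed.

Lemma measurable_mehler1 : measurable_fun setT (mehler1 c s f).
Proof.
apply: (@measurable_fun_integral_param _ _ R (measurableTypeR R) R gauss1 (fun x w => f (c * x + s * w)%R)) => //.
exact: measurable_smoothing.
Qed.

Lemma integral_mehler1 : \int[gauss1]_x mehler1 c s f x = \int[gauss1]_x f x.
Proof. exact: integral_smoothing. Qed.

Let fn n x : R := trunc n (f x).

Let mfn n : measurable_fun setT (fn n).
Proof. exact: (measurableT_comp (measurable_trunc n) mf). Qed.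

Let fn_bounds n x : (n.+1%:R^-1 <= fn n x <= n.+1%:R)%R := trunc_bounds n (f x).

Let cvg_integral_fn (g : R -> R) : measurable_fun setT g ->
  \int[gauss1]_x f (g x) < +oo ->
  (\int[gauss1]_x (fn n (g x))%:E) @[n --> \oo] --> \int[gauss1]_x f (g x).
Proof.
move=> mg fg.
have mfg : measurable_fun setT (fun x => f (g x)) by exact: (measurableT_comp mf mg).
have ig : gauss1.-integrable setT (fun x => f (g x) + 1).
  apply/integrableP; split; first by apply: emeasurable_funD => //; exact: measurable_cst.
  under eq_integral do rewrite gee0_abs ?adde_ge0//.
  rewrite ge0_integralD// (integral_probability_cst _ _ _ gauss1).
  by rewrite lte_add_pinfty// ltry.
have [|||||_ _ H] := @dominated_convergence _ (measurableTypeR R) R gauss1 setT measurableT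
  (fun n x => (fn n (g x))%:E) (fun x => f (g x)) (fun x => f (g x) + 1).
- by move=> n; apply/measurable_EFinP; exact: (measurableT_comp (mfn n) mg).
- exact: mfg.
- by apply: aeW => x _; exact: trunc_cvg.
- exact: ig.
- apply: aeW => x n _; rewrite gee0_abs ?trunc_leD1// lee_fin.
  by case/andP: (fn_bounds n (g x)) => /(le_trans _) ->//; rewrite invr_ge0.
exact: H.
Qed.

(** On the right the truncations converge by domination, with majorants [f + 1] and [Psi f + 1]. On
    the left only a lower bound for the limit is wanted, and Fatou's lemma supplies it without a
    majorant. *)
Lemma Psi_mehler1_finite_le : \int[gauss1]_x f x < +oo -> \int[gauss1]_x Psi (f x) < +oo ->
  \int[gauss1]_x Psi (mehler1 c s f x) <=
  (c ^+ 2)%:E * \int[gauss1]_x Psi (f x) + (1 - c ^+ 2)%:E * Psi (\int[gauss1]_x f x).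
Proof.
move=> foo Poo.
have mfnE n : measurable_fun setT (fun x => (fn n x)%:E) by exact/measurable_EFinP.
have vn0 n : (0 < n.+1%:R^-1 :> R)%R by rewrite invr_gt0.
have fn_gt0 n x : (0 < fn n x)%R by case/andP: (fn_bounds n x) => /(lt_le_trans (vn0 n)).
pose m n := fine (\int[gauss1]_x (fn n x)%:E).
have mE n : \int[gauss1]_x (fn n x)%:E = (m n)%:E.
  rewrite fineK//; apply: (integrable_fin_num measurableT).
  exact: (measurable_bounded_gauss1_integrable _ _ _ (mfn n) (fn_bounds n)).
pose g n y := psi (smoothed c s (fn n) y).
have step n := psi_smoothed_bounded_le _ _ cs c1 _ _ _ _ (mfn n) (vn0 n) (fn_bounds n) (mE n).
have ffin : \int[gauss1]_x f x \is a fin_num.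
  by rewrite ge0_fin_numE//; apply: integral_ge0.
have cvg_m : (m n) @[n --> \oo] --> fine (\int[gauss1]_x f x).
  apply: fine_cvg; rewrite fineK//.
  rewrite (_ : (fun n => _) = (fun n => \int[gauss1]_x (fn n (id x))%:E)); last first.
    by apply/funext => n; rewrite mE.
  exact: (cvg_integral_fn id).
have cvg_psi : \int[gauss1]_x (psi (fn n x))%:E @[n --> \oo] --> \int[gauss1]_x Psi (f x).
  have iP : gauss1.-integrable setT (fun x => Psi (f x) + 1).
    have mP : measurable_fun setT (fun x => Psi (f x)).
      exact: (measurableT_comp measurable_Psi mf).
    apply/integrableP; split; first by apply: emeasurable_funD => //; exact: measurable_cst.
    under eq_integral do rewrite gee0_abs ?adde_ge0 ?Psi_ge0//.
    rewrite ge0_integralD//; last by move=> x _; exact: Psi_ge0.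
    by rewrite (integral_probability_cst _ _ _ gauss1) lte_add_pinfty// ltry.
  have [|||||_ _ H] := @dominated_convergence _ (measurableTypeR R) R gauss1 setT measurableT
    (fun n x => (psi (fn n x))%:E) (fun x => Psi (f x)) (fun x => Psi (f x) + 1).
  - by move=> n; apply/measurable_EFinP; exact: (measurableT_comp measurable_psi (mfn n)).
  - exact: (measurableT_comp measurable_Psi mf).
  - have fi : gauss1.-integrable setT f.
      by apply/integrableP; split => //; under eq_integral do rewrite gee0_abs//.
    have := integrable_ae measurableT fi; apply: filterS => x /(_ I) fx _.
    exact: Psi_cvg (trunc_cvg _ (f0 x)).
  - exact: iP.
  - by apply: aeW => x n _; rewrite gee0_abs ?psi_trunc_le// lee_fin psi_ge0.
  exact: H.
have cvg_rhs : ((c ^+ 2)%:E * \int[gauss1]_x (psi (fn n x))%:E + ((1 - c ^+ 2) * psi (m n))%:E) @[n --> \oo] -->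
    (c ^+ 2)%:E * \int[gauss1]_x Psi (f x) + (1 - c ^+ 2)%:E * Psi (\int[gauss1]_x f x).
  apply: cvgeD.
  - rewrite fin_num_adde_defl// fin_numM// /Psi ffin//.
  - by apply: cvgeZl.
  - rewrite -(fineK ffin) PsiE -EFinM.
    apply: cvg_EFin; first exact: nearW.
    apply: cvgM; first exact: cvg_cst.
    exact: (cvg_comp _ _ cvg_m (continuous_psi _)).
have mg n : measurable_fun setT (fun x => (g n x)%:E).
  apply/measurable_EFinP; apply: (measurableT_comp measurable_psi).
  apply/measurable_EFinP; rewrite (_ : EFin \o _ = fun y => \int[gauss1]_w (fn n (c * y + s * w)%R)%:E)%E.
    apply: (@measurable_fun_integral_param _ _ R (measurableTypeR R) R gauss1 (fun y w => (fn n (c * y + s * w)%R)%:E)).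
      exact: (measurable_smoothing _ _ _ (mfnE n)).
    by move=> y w; rewrite lee_fin ltW.
  by apply/funext => y; exact: (smoothedE _ _ _ _ _ (mfn n) (fn_bounds n)).
have g0 n x : 0 <= (g n x)%:E by rewrite lee_fin psi_ge0.
have := @fatou _ (measurableTypeR R) R gauss1 setT measurableT (fun n x => (g n x)%:E) mg (fun n x _ => g0 n x).
move=> F; apply: (@le_trans _ _ (limn_einf (fun n => \int[gauss1]_x (g n x)%:E))); last first.
  exact: (limn_einf_le_cvg _ _ _ step cvg_rhs).
apply: le_trans F.
have mlim : measurable_fun setT (fun x => limn_einf (fun n => (g n x)%:E)).
  exact: measurable_fun_limn_einf.
(* Where the smoothing of [f] is finite, the smoothed truncations converge to it by domination in
   [w]; it is finite almost everywhere because its integral is that of [f]. *)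
have : {ae gauss1, forall x, setT x -> Psi (mehler1 c s f x) <= limn_einf (fun n => (g n x)%:E)}.
  have Mi : gauss1.-integrable setT (mehler1 c s f).
    apply/integrableP; split; first exact: measurable_mehler1.
    by under eq_integral do rewrite gee0_abs ?mehler1_ge0//; rewrite integral_mehler1.
  have := integrable_ae measurableT Mi; apply: filterS => x /(_ I) fx _.
  rewrite -(cvg_limn_einf_sup (Psi_cvg (fun n => smoothed c s (fn n) x) _ fx _)).1//.
  rewrite (_ : (fun n => _) = (fun n => \int[gauss1]_w (fn n (c * x + s * w)%R)%:E)); last first.
    by apply/funext => n; rewrite (smoothedE _ _ _ _ _ (mfn n) (fn_bounds n)).
  apply: cvg_integral_fn; first exact: aff.
  by move: fx; rewrite ge0_fin_numE ?mehler1_ge0.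
apply: ae_ge0_le_integral => //.
- by move=> x _; exact: Psi_ge0.
- exact: (measurableT_comp measurable_Psi measurable_mehler1).
- by move=> x _; apply: limn_einf_ge0.
Qed.

(** An infinite term on the right settles the matter unless its weight is 0. Hence the separate
    cases [s = 0], where smoothing is the identity, and [c = 0], where it is the constant mean. *)
Lemma Psi_mehler1_le :
  \int[gauss1]_x Psi (mehler1 c s f x) <=
  (c ^+ 2)%:E * \int[gauss1]_x Psi (f x) + (1 - c ^+ 2)%:E * Psi (\int[gauss1]_x f x).
Proof.
have c2 : (1 - c ^+ 2 = s ^+ 2)%R by rewrite -cs addrC addKr.
have If0 : 0 <= \int[gauss1]_x f x by exact: integral_ge0.
have P0 : 0 <= \int[gauss1]_x Psi (f x) by apply: integral_ge0 => x _; exact: Psi_ge0.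
have [s0|s0] := eqVneq s 0%R.
  have cc : (c ^+ 2 = 1)%R by rewrite -cs s0 expr0n addr0.
  have -> : c = 1%R by move/eqP : cc; rewrite sqrf_eq1 (negbTE c1) orbF => /eqP.
  rewrite expr1n subrr mul1e mul0e adde0 le_eqVlt; apply/orP; left; apply/eqP.
  apply: eq_integral => x _; congr Psi; rewrite /mehler1 s0.
  rewrite -[RHS](integral_probability_cst _ _ _ gauss1).
  by apply: eq_integral => w _; rewrite mul0r addr0 mul1r.
have s20 : (0 < s ^+ 2)%R by rewrite exprn_even_gt0.
have [foo|] := ltP (\int[gauss1]_x f x) +oo; last first.
  rewrite leye_eq => /eqP ->; rewrite {2}/Psi/= c2 gt0_muley ?lte_fin//.
  by rewrite addey ?leey// -ltNye (lt_le_trans _ (mule_ge0 _ P0))// lee_fin sqr_ge0.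
have [Poo|] := ltP (\int[gauss1]_x Psi (f x)) +oo; first exact: Psi_mehler1_finite_le.
rewrite leye_eq => /eqP PE.
have [c0|c0] := eqVneq c 0%R; last first.
  rewrite PE gt0_muley ?lte_fin ?exprn_even_gt0// addye ?leey//.
  by rewrite -ltNye (lt_le_trans _ (mule_ge0 _ (Psi_ge0 _)))// lee_fin c2 sqr_ge0.
rewrite PE c0 expr0n mul0e add0e subr0 mul1e.
rewrite -[leRHS](integral_probability_cst _ _ _ gauss1) le_eqVlt; apply/orP; left; apply/eqP.
have cs' : (s ^+ 2 = 1)%R by rewrite -cs c0 expr0n add0r.
apply: eq_integral => x _; congr Psi; rewrite /mehler1.
have mfs : measurable_fun setT (fun x => f (s * x)%R).
  by apply: (measurableT_comp mf); exact: measurable_funM.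
transitivity (\int[gauss1]_w f (s * w)%R).
  by apply: eq_integral => w _; rewrite mul0r add0r.
move/eqP : cs'; rewrite sqrf_eq1 => /predU1P[->|/eqP ->].
  by apply: eq_integral => w _; rewrite mul1r.
rewrite -[RHS]ge0_integral_gauss1N//.
by apply: eq_integral => w _; rewrite mulN1r.
Qed.

End Mehler1.

(** * Smoothing in several coordinates *)

Section CoordinateMehler.
Context {R : realType} {M : nat}.
Notation gauss1 := (@gauss1 R).
Notation gauss := (@gauss R).
Implicit Types (c : 'I_M -> R) (v w : M.-tuple R) (h : M.-tuple R -> \bar R).

Definition mix c v w : M.-tuple R :=
  [tuple c i * tnth v i + Num.sqrt (1 - c i ^+ 2) * tnth w i | i < M].

Definition setc c (i : 'I_M) (g : R) : 'I_M -> R := fun j => if j == i then g else c j.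

Lemma measurable_mix d (T : measurableType d) c (f g : T -> M.-tuple R) :
  measurable_fun setT f -> measurable_fun setT g ->
  measurable_fun setT (fun p => mix c (f p) (g p)).
Proof.
move=> mf mg; apply: measurable_mktuple => i.
by apply: measurable_funD; apply: measurable_funM => //; exact: measurable_tnth_comp.
Qed.

Lemma mix_upd c i g v w x y :
  mix (setc c i g) (upd v i x) (upd w i y) =
  mix (setc c i 1) (upd v i (g * x + Num.sqrt (1 - g ^+ 2) * y)) w.
Proof.
apply: eq_from_tnth => j; rewrite !tnth_mktuple /setc; case: eqP => // _.
by rewrite mul1r expr1n subrr sqrtr0 mul0r addr0.
Qed.

Local Open Scope ereal_scope.

(** With [c = gamma] and [h] equal to [h_0] composed with [U], this is [g_k] before the passage to
    real values; with parameters 0 and 1 only, it is a marginal. *)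
Definition mehler c h v : \bar R := \int[gauss M]_w h (mix c v w).

Variable h : M.-tuple R -> \bar R.
Hypothesis mh : measurable_fun setT h.
Hypothesis h0 : forall v, 0 <= h v.

Lemma mehler_ge0 c v : 0 <= mehler c h v.
Proof. exact: integral_ge0. Qed.

Lemma measurable_mehler c : measurable_fun setT (mehler c h).
Proof.
apply: (@measurable_fun_integral_param _ _ (M.-tuple R) (M.-tuple R) R (gauss M)
  (fun v w => h (mix c v w))) => //.
by apply: (measurableT_comp mh); exact: measurable_mix.
Qed.

(** Resampling the [i]-th noise variable exhibits the dependence on coordinate [i] as a
    one-dimensional smoothing of the function in which this coordinate is left alone. *)
Lemma mehler_upd c i g v x :
  mehler (setc c i g) h (upd v i x) =
  mehler1 g (Num.sqrt (1 - g ^+ 2)) (fun z => mehler (setc c i 1) h (upd v i z)) x.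
Proof.
rewrite /mehler -(ge0_integral_resample _ i); last 2 first.
- by apply: (measurableT_comp mh); exact: measurable_mix.
- by move=> w; exact: h0.
by apply: eq_integral => y _; apply: eq_integral => w _; rewrite mix_upd.
Qed.

Lemma mehler_upd0 c i v x :
  mehler (setc c i 0) h (upd v i x) = \int[gauss1]_z mehler (setc c i 1) h (upd v i z).
Proof.
rewrite mehler_upd; apply: eq_integral => z _.
by rewrite mul0r add0r expr0n subr0 sqrtr1 mul1r.
Qed.

Let measurable_updp i : measurable_fun setT (fun p : M.-tuple R * R => upd p.1 i p.2).
Proof. exact: measurable_upd. Qed.

Lemma ge0_integral_resampleC i (f : M.-tuple R -> \bar R) :
  measurable_fun setT f -> (forall t, 0 <= f t) ->
  \int[gauss M]_v \int[gauss1]_x f (upd v i x) = \int[gauss M]_v f v.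
Proof.
move=> mf f0; rewrite -(ge0_integral_resample _ i f mf f0).
apply: (@ge0_tonelli _ _ (M.-tuple R) (measurableTypeR R) R (gauss M) gauss1
  (fun v x => f (upd v i x))) => //.
exact: (measurableT_comp mf (measurable_updp i)).
Qed.

Section Coordinate.
Variables (c : 'I_M -> R) (i : 'I_M) (g : R).
Hypothesis g01 : (0 <= g <= 1)%R.

Let gs : (g ^+ 2 + Num.sqrt (1 - g ^+ 2) ^+ 2 = 1)%R.
Proof.
rewrite sqr_sqrtr; first by rewrite addrC subrK.
by rewrite subr_ge0 expr_le1//; case/andP: g01.
Qed.

Let gN1 : g != (-1)%R.
Proof. by apply/eqP => gE; move: g01; rewrite gE => /andP[]; lra. Qed.

Let f v z := mehler (setc c i 1) h (upd v i z).

Let mf : measurable_fun setT (fun p : M.-tuple R * R => f p.1 p.2).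
Proof. exact: (measurableT_comp (measurable_mehler _) (measurable_updp i)). Qed.

Let mfv v : measurable_fun setT (f v).
Proof. exact: (@measurable_fun_slice _ _ (M.-tuple R) (measurableTypeR R) R f v mf). Qed.

Let f0 v z : 0 <= f v z. Proof. exact: mehler_ge0. Qed.

Lemma integral_mehler_coord :
  \int[gauss M]_v mehler (setc c i g) h v = \int[gauss M]_v mehler (setc c i 1) h v.
Proof.
rewrite -(ge0_integral_resampleC i _ (measurable_mehler _) (mehler_ge0 _)).
rewrite -[RHS](ge0_integral_resampleC i _ (measurable_mehler _) (mehler_ge0 _)).
apply: eq_integral => v _; under eq_integral do rewrite mehler_upd.
exact: (integral_mehler1 _ _ gs gN1 _ (mfv v) (f0 v)).
Qed.

Lemma Psi_mehler_coord_le :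
  \int[gauss M]_v Psi (mehler (setc c i g) h v) <=
  (g ^+ 2)%:E * \int[gauss M]_v Psi (mehler (setc c i 1) h v) +
  (1 - g ^+ 2)%:E * \int[gauss M]_v Psi (mehler (setc c i 0) h v).
Proof.
have mP b : measurable_fun setT (fun v => Psi (mehler (setc c i b) h v)).
  exact: (measurableT_comp measurable_Psi (measurable_mehler _)).
have P0 b v : 0 <= Psi (mehler (setc c i b) h v) by exact: Psi_ge0.
rewrite -(ge0_integral_resampleC i _ (mP g) (P0 g)).
rewrite -(ge0_integral_resampleC i _ (mP 1%R) (P0 1%R)).
rewrite -(ge0_integral_resampleC i _ (mP 0%R) (P0 0%R)).
have g2 : (0 <= 1 - g ^+ 2)%R by rewrite subr_ge0 expr_le1//; case/andP: g01.
have mint b : measurable_fun setT (fun v => \int[gauss1]_x Psi (mehler (setc c i b) h (upd v i x))).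
  apply: (@measurable_fun_integral_param _ _ (M.-tuple R) (measurableTypeR R) R gauss1
    (fun v x => Psi (mehler (setc c i b) h (upd v i x)))) => //.
  exact: (measurableT_comp (mP b) (measurable_updp i)).
have int0 b v : 0 <= \int[gauss1]_x Psi (mehler (setc c i b) h (upd v i x)).
  by apply: integral_ge0 => x _; exact: P0.
rewrite -ge0_integralZl//; last by rewrite lee_fin sqr_ge0.
rewrite -ge0_integralZl// -ge0_integralD//; last 4 first.
- by move=> v _; rewrite mule_ge0// lee_fin sqr_ge0.
- by apply: emeasurable_funM => //.
- by move=> v _; rewrite mule_ge0.
- by apply: emeasurable_funM => //.
apply: ge0_le_integral => //.
- by apply: emeasurable_funD; apply: emeasurable_funM.
move=> v _; under eq_integral do rewrite mehler_upd.
apply: le_trans (Psi_mehler1_le _ _ gs gN1 _ (mfv v) (f0 v)) _.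
(* The mean over coordinate [i] is the smoothing with parameter 0, which is constant in that
   coordinate. *)
rewrite leeD2l// le_eqVlt; apply/orP; left; apply/eqP; congr (_ * _).
under [RHS]eq_integral do rewrite mehler_upd0.
by rewrite integral_probability_cst.
Qed.

End Coordinate.

Lemma mehler1E v : mehler (fun=> 1%R) h v = h v.
Proof.
rewrite /mehler -[RHS](integral_probability_cst _ _ _ (gauss M)).
apply: eq_integral => w _; congr h; apply: eq_from_tnth => i.
by rewrite tnth_mktuple mul1r expr1n subrr sqrtr0 mul0r addr0.
Qed.

(** The parameters are turned into 1 one at a time along an enumeration, each change preserving the
    integral. *)
Lemma integral_mehler c : (forall i, (0 <= c i <= 1)%R) ->
  \int[gauss M]_v mehler c h v = \int[gauss M]_v h v.
Proof.
move=> c01.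
pose cs (s : seq 'I_M) i := if i \in s then 1%R else c i.
have step s : \int[gauss M]_v mehler c h v = \int[gauss M]_v mehler (cs s) h v.
  elim: s => [|i s ->]; first by congr integral; apply/funext => v; congr mehler.
  have -> : cs s = setc (cs s) i (cs s i) by apply/funext => j; rewrite /setc; case: eqP => // ->.
  rewrite integral_mehler_coord; last by rewrite /cs; case: ifP => //; rewrite ler01 lexx.
  rewrite (_ : setc (cs s) i 1 = cs (i :: s))//.
  by apply/funext => j; rewrite /setc /cs in_cons; case: eqP.
rewrite (step (enum 'I_M)) (_ : cs _ = fun=> 1%R).
  by apply: eq_integral => v _; rewrite mehler1E.
by apply/funext => i; rewrite /cs mem_enum.
Qed.

End CoordinateMehler.

(** * Expansion of a multi-affine bound over the subsets of coordinates *)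

Section Expansion.
Context {R : realType} {n : nat}.
Local Open Scope ereal_scope.

Lemma big_subsets_setU1 (G : {set 'I_n} -> \bar R) (i : 'I_n) (S : {set 'I_n}) : i \notin S ->
  \sum_(s : {set 'I_n} | s \subset i |: S) G s =
  \sum_(s : {set 'I_n} | s \subset S) (G s + G (i |: s)%SET).
Proof.
move=> iS; rewrite (bigID (fun s : {set 'I_n} => i \notin s))/= big_split/=; congr (_ + _).
  apply: eq_bigl => s; apply/andP/idP => [[sS si]|sS].
    apply/fintype.subsetP => j js; move/fintype.subsetP/(_ j js): sS; rewrite !inE => /orP[/eqP ji|//].
    by rewrite ji (negbTE si) in js *.
  split; first exact: (fintype.subset_trans sS (finset.subsetUr _ _)).
  by apply: contra iS => /(fintype.subsetP sS).
rewrite (reindex_onto (fun s => i |: s)%SET (fun s => s :\ i)%SET)/=; last first.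
  by move=> s /andP[_]; rewrite negbK => si; rewrite finset.setD1K.
apply: eq_bigl => s; apply/andP/idP => [[/andP[sS _] /eqP sE]|sS].
  apply/fintype.subsetP => j; rewrite -sE !inE => /andP[ji /orP[/eqP jE|js]].
    by rewrite jE eqxx in ji.
  by move/fintype.subsetP/(_ j): sS; rewrite !inE js orbT (negbTE ji) => /(_ isT).
have si : i \notin s by apply: contra iS => /(fintype.subsetP sS).
by rewrite finset.setUS// finset.setU1K// setU11 eqxx.
Qed.

Lemma multiaffine_expansion_le (F : ('I_n -> R) -> \bar R) (g : 'I_n -> R) :
  (forall c, 0 <= F c) -> (forall i, (0 <= g i <= 1)%R) ->
  (forall c i, F (setc c i (g i)) <=
    (g i ^+ 2)%:E * F (setc c i 1) + (1 - g i ^+ 2)%:E * F (setc c i 0)) ->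
  F g <= \sum_(s : {set 'I_n})
    ((\prod_(i in ~: s) g i ^+ 2) * (\prod_(j in s) (1 - g j ^+ 2)))%:E *
    F (fun i => if i \in s then 0%R else 1%R).
Proof.
move=> F0 g01 step.
have g2 i : (0 <= 1 - g i ^+ 2)%R by rewrite subr_ge0 expr_le1//; case/andP: (g01 i).
(* Once the coordinates in [S] are expanded, [s] records those set to 0, [x S s] is the resulting
   parameter and [w S s] its weight. Nonnegative weights preserve the inequality at the next
   coordinate. *)
pose w (S s : {set 'I_n}) : R := ((\prod_(i in S :\: s) g i ^+ 2) * (\prod_(j in s) (1 - g j ^+ 2)))%R.
have w0 S s : (0 <= w S s)%R.
  by rewrite mulr_ge0// prodr_ge0// => i _; exact: sqr_ge0.
pose x (S s : {set 'I_n}) i : R := if i \in s then 0%R else if i \in S then 1%R else g i.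
have main (r : seq 'I_n) : uniq r -> F g <=
    \sum_(s : {set 'I_n} | s \subset [set i in r]%SET) (w [set i in r]%SET s)%:E * F (x [set i in r]%SET s).
  elim: r => [_|i r IHr /= /andP[ir ur]]; set S := [set _ in _]%SET.
    have S0 : S = finset.set0 by apply/setP => j; rewrite !inE.
    rewrite (bigD1 finset.set0)/= ?sub0set// big1 ?adde0; last first.
      by move=> s /andP[]; rewrite S0 finset.subset0 => ->.
    have -> : w S finset.set0 = 1%R.
      by rewrite /w big1 ?big1 ?mulr1// => j; rewrite !inE.
    by rewrite mul1e le_eqVlt; apply/orP; left; apply/eqP; congr F; apply/funext => j; rewrite /x !inE.
  apply: le_trans (IHr ur) _; pose S' := [set i in r]%SET; rewrite -/S'.
  have SE : S = (i |: S')%SET by apply/setP => j; rewrite !inE.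
  have iS' : i \notin S' by rewrite inE.
  rewrite SE big_subsets_setU1//; apply: lee_sum => s sS.
  have si : i \notin s by apply: contra iS' => /(fintype.subsetP sS).
  have -> : x S' s = setc (x S' s) i (g i).
    by apply/funext => j; rewrite /setc; case: eqP => // ->; rewrite /x (negbTE si) (negbTE iS').
  apply: le_trans (lee_wpmul2l _ (step _ _)) _; first by rewrite lee_fin.
  rewrite ge0_muleDr ?mule_ge0 ?lee_fin ?sqr_ge0// !muleA -!EFinM.
  have -> : setc (x S' s) i 1 = x (i |: S')%SET s.
    apply/funext => j; rewrite /setc /x; case: (eqVneq j i) => [->|ji].
      by rewrite (negbTE si) setU11.
    by rewrite in_setU1 (negbTE ji).
  have -> : setc (x S' s) i 0 = x (i |: S')%SET (i |: s)%SET.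
    apply/funext => j; rewrite /setc /x; case: (eqVneq j i) => [->|ji].
      by rewrite setU11.
    by rewrite !in_setU1 (negbTE ji).
  rewrite le_eqVlt; apply/orP; left; apply/eqP; congr (_%:E * _ + _%:E * _).
    rewrite /w [X in _ = (X * _)%R](bigD1 i)/=; last by rewrite !inE si eqxx.
    rewrite [LHS]mulrC -[RHS]mulrA; congr (_ * (_ * _))%R.
    apply: eq_bigl => j; rewrite !inE; case: (eqVneq j i) => [->|ji]; last by rewrite andbT.
    by rewrite (negbTE ir) !andbF.
  rewrite /w big_setU1//= [RHS]mulrCA [LHS]mulrC; congr (_ * (_ * _))%R.
  apply: eq_bigl => j; rewrite !inE; case: (eqVneq j i) => [->|//].
  by rewrite (negbTE ir) andbF.
have := main (enum 'I_n) (enum_uniq _).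
have -> : [set i in enum 'I_n]%SET = [set: 'I_n]%SET by apply/setP => i; rewrite !inE mem_enum.
move=> /le_trans; apply; rewrite le_eqVlt; apply/orP; left; apply/eqP.
apply: eq_big => [s|s _]; first by rewrite finset.subsetT.
congr (_%:E * F _); first by rewrite /w -finset.setTD.
by apply/funext => i; rewrite /x !inE.
Qed.

(** Distributes the product of the factors [(1 - g_i^2) + g_i^2], all equal to 1. It balances the
    shifts by 1 at the end. *)
Lemma expansion_weights_sum (g : 'I_n -> R) :
  (\sum_(s : {set 'I_n}) (\prod_(i in ~: s) g i ^+ 2) * (\prod_(j in s) (1 - g j ^+ 2)) = 1)%R.
Proof.
transitivity (\prod_(i < n) ((1 - g i ^+ 2) + g i ^+ 2))%R; last first.
  by rewrite big1// => i _; rewrite subrK.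
rewrite bigA_distr; apply: eq_bigr => s _; rewrite [RHS](bigID (mem s))/= mulrC; congr (_ * _)%R.
  by apply: eq_bigr => i ->.
by apply: eq_big => [i|i]; rewrite ?inE// => /negbTE ->.
Qed.

End Expansion.

Section IntegralDecomposition.
Context {d} {T : measurableType d} {R : realType} {mu : {measure set T -> \bar R}}.
Local Open Scope ereal_scope.

(** The integral of [u] is taken through its own parts [u^+] and [u^-], and may be [+oo].
    Integrating [u^+ + m = p + u^-], whose terms are nonnegative, allows the finite integrals of [m]
    and of [u^- <= m] to be subtracted. *)
Lemma integral_decomposition {u : T -> R} (p m : T -> R) :
  measurable_fun setT p -> measurable_fun setT m ->
  (forall x, 0 <= p x)%R -> (forall x, 0 <= m x)%R -> (forall x, u x = p x - m x)%R ->
  \int[mu]_x (m x)%:E < +oo ->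
  \int[mu]_x (u x)%:E = \int[mu]_x (p x)%:E - \int[mu]_x (m x)%:E.
Proof.
move=> mp mm p0 m0 uE moo.
have mu' : measurable_fun setT (EFin \o u).
  by apply/measurable_EFinP; rewrite (_ : u = p \- m)%R; [exact: measurable_funB|apply/funext].
have mp' : measurable_fun setT (EFin \o p) by exact/measurable_EFinP.
have mm' : measurable_fun setT (EFin \o m) by exact/measurable_EFinP.
rewrite integralE; set A := \int[mu]_x _; set B := \int[mu]_x _.
have B0 : 0 <= B by exact: integral_ge0.
have A0 : 0 <= A by exact: integral_ge0.
have mup := measurable_funepos mu'.
have mun := measurable_funeneg mu'.
have BM : B <= \int[mu]_x (m x)%:E.
  apply: ge0_le_integral => //.
  move=> x _; rewrite funenegE /= -EFin_max lee_fin ge_max m0 andbT uE.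
  by have := p0 x; lra.
have E : A + \int[mu]_x (m x)%:E = \int[mu]_x (p x)%:E + B.
  rewrite -ge0_integralD//; last by move=> x _; rewrite lee_fin.
  rewrite -ge0_integralD//; last by move=> x _; rewrite lee_fin.
  apply: eq_integral => x _; rewrite funeposE funenegE /= -!EFin_max -!EFinD.
  congr EFin; rewrite uE; have := p0 x; have := m0 x.
  by rewrite /Num.max; case: ifP; case: ifP; lra.
have mf : \int[mu]_x (m x)%:E \is a fin_num.
  by rewrite ge0_fin_numE//; apply: integral_ge0 => x _; rewrite lee_fin.
have Bf : B \is a fin_num by rewrite ge0_fin_numE//; exact: le_lt_trans moo.
apply/eqP; rewrite eq_sym; apply/eqP.
move: E mf Bf; move: A B (\int[mu]_x _) (\int[mu]_x _) A0 B0 {BM moo} => [a| |] [b| |]// [e| |] [r| |]//= _ _ [] // E _ _.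
by congr EFin; lra.
Qed.

End IntegralDecomposition.

Lemma measurable_nth {R : realType} n i :
  measurable_fun setT (fun t : n.-tuple R => nth 0 t i).
Proof.
have [lti|lei] := ltnP i n.
  rewrite (_ : (fun _ => _) = (@tnth _ R)^~ (Ordinal lti)); first exact: measurable_tnth.
  by apply/funext => u; rewrite (tnth_nth 0).
rewrite (_ : (fun _ => _) = cst 0)//.
by apply/funext => u; rewrite nth_default// size_tuple.
Qed.

(** * Marginals as smoothings, and their entropies *)

Section EntropyOfSmoothing.
Context {R : realType} {n : nat}.
Notation gauss := (@gauss R).
Implicit Types (q : n.-tuple R -> \bar R) (f l : n.-tuple R -> R) (s : {set 'I_n}).
Local Open Scope ereal_scope.

(** Smoothing with these parameters averages out the variables in [s]: it gives the marginal, seen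
    as a function of all coordinates. *)
Definition indC s : 'I_n -> R := fun i => if i \in s then 0%R else 1%R.

Lemma mix_indC s v w w' : mix (indC s) (mix (indC s) v w) w' = mix (indC s) v w'.
Proof.
apply: eq_from_tnth => i; rewrite !tnth_mktuple /indC; case: ifP => _.
  by rewrite !mul0r.
by rewrite expr1n subrr sqrtr0 !mul1r !mul0r !addr0.
Qed.

Lemma ge0_ae_fin_num q : measurable_fun setT q -> (forall x, 0 <= q x) ->
  \int[gauss n]_x q x < +oo -> {ae gauss n, forall x, setT x -> q x \is a fin_num}.
Proof.
move=> mq q0 qoo; apply: integrable_ae => //; apply/integrableP; split=> //.
by under eq_integral do rewrite gee0_abs//.
Qed.

(** The integrands differ by 1 except where [q] is infinite, which is a null set since [q] has
    finite integral. *)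
Lemma entropy_shift q : measurable_fun setT q -> (forall x, 0 <= q x) ->
  \int[gauss n]_x q x < +oo ->
  \int[gauss n]_x (fine (q x) * ln (fine (q x)))%:E + 1 = \int[gauss n]_x Psi (q x).
Proof.
move=> mq q0 qoo.
have mfq : measurable_fun setT (fun x => fine (q x)).
  exact: (measurableT_comp (fine_measurable measurableT) mq).
have mpq : measurable_fun setT (fun x => psi (fine (q x))) by exact: (measurableT_comp measurable_psi mfq).
have one : \int[gauss n]_x (1%R)%:E = 1 by exact: integral_probability_cst.
rewrite (integral_decomposition (fun x => psi (fine (q x))) (fun=> 1%R) mpq (measurable_cst _) (fun x => psi_ge0 _) (fun=> ler01)); last 2 first.
- by move=> x; rewrite /psi addrK.
- by rewrite one ltry.
rewrite one subeK//; apply: ae_eq_integral => //.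
- exact/measurable_EFinP.
- exact: (measurableT_comp measurable_Psi mq).
apply: filterS (ge0_ae_fin_num _ mq q0 qoo) => x qx _.
by rewrite -PsiE fineK// qx.
Qed.

Section Marginal.
Variables (s : {set 'I_n}) (f : n.-tuple R -> R).
Hypothesis mf : measurable_fun setT f.
Hypothesis f0 : forall x, (0 <= f x)%R.
Hypothesis foo : \int[gauss n]_x (f x)%:E < +oo.

Let q := mehler (indC s) (EFin \o f).

Let mEf : measurable_fun setT (EFin \o f). Proof. exact/measurable_EFinP. Qed.
Let Ef0 x : 0 <= (EFin \o f) x. Proof. by rewrite lee_fin. Qed.
Let mq : measurable_fun setT q. Proof. exact: measurable_mehler. Qed.
Let q0 x : 0 <= q x. Proof. exact: mehler_ge0. Qed.
Let indC01 i : (0 <= indC s i <= 1)%R.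
Proof. by rewrite /indC; case: ifP; rewrite ?ler01 lexx. Qed.

Let qoo : \int[gauss n]_x q x < +oo.
Proof. by rewrite integral_mehler. Qed.

(** The smoothing is the conditional expectation given the coordinates outside [s]; a function [l]
    of these coordinates alone comes out of the average. *)
Lemma integral_mehler_weight l : measurable_fun setT l -> (forall x, (0 <= l x)%R) ->
  (forall v w, l (mix (indC s) v w) = l v) ->
  \int[gauss n]_x (f x * l x)%:E = \int[gauss n]_x (fine (q x) * l x)%:E.
Proof.
move=> ml l0 lmix.
have mfl : measurable_fun setT (fun x => (f x * l x)%:E) by apply/measurable_EFinP; exact: measurable_funM.
have fl0 x : 0 <= (f x * l x)%:E by rewrite lee_fin mulr_ge0.
rewrite -(integral_mehler _ mfl fl0 _ indC01).
have mfq : measurable_fun setT (fun x => fine (q x)).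
  exact: (measurableT_comp (fine_measurable measurableT) mq).
apply: ae_eq_integral => //.
- exact: measurable_mehler.
- by apply/measurable_EFinP; exact: measurable_funM.
apply: filterS (ge0_ae_fin_num _ mq q0 qoo) => v qv _.
rewrite EFinM fineK ?qv// /mehler.
under eq_integral do rewrite EFinM lmix.
rewrite ge0_integralZr//.
- by apply: (measurableT_comp mEf); exact: measurable_mix.
- by move=> w _; exact: Ef0.
- by rewrite lee_fin.
Qed.

(** The logarithm of the marginal has no fixed sign, so [integral_mehler_weight] is applied to its
    positive and negative parts. *)
Lemma integral_ln_marginal :
  \int[gauss n]_x (f x * ln (fine (q x)))%:E + 1 = \int[gauss n]_x Psi (q x).
Proof.
rewrite -(entropy_shift _ mq q0 qoo); congr (_ + 1).
pose L x := ln (fine (q x)).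
have mfq : measurable_fun setT (fun x => fine (q x)).
  exact: (measurableT_comp (fine_measurable measurableT) mq).
have mL : measurable_fun setT L by exact: (measurableT_comp (@measurable_ln R) mfq).
have Lmix v w : L (mix (indC s) v w) = L v.
  rewrite /L /q /mehler; congr (ln (fine _)).
  by apply: eq_integral => w' _; rewrite mix_indC.
pose lp x := Num.max (L x) 0%R; pose lm x := Num.max (- L x)%R 0%R.
have lp0 x : (0 <= lp x)%R by rewrite le_max lexx orbT.
have lm0 x : (0 <= lm x)%R by rewrite le_max lexx orbT.
have mlp : measurable_fun setT lp by apply: measurable_maxr.
have mlm : measurable_fun setT lm by apply: measurable_maxr => //; exact: measurableT_comp.
have LE x : L x = (lp x - lm x)%R by rewrite /lp /lm /Num.max; case: ifP; case: ifP; lra.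
have wp := integral_mehler_weight lp mlp lp0 (fun v w => congr1 (fun y => Num.max y 0%R) (Lmix v w)).
have wm := integral_mehler_weight lm mlm lm0 (fun v w => congr1 (fun y => Num.max (- y)%R 0%R) (Lmix v w)).
have fq0 x : (0 <= fine (q x))%R by exact: fine_ge0.
(* [y ln y >= -1] bounds the negative part, so that the difference of the two integrals makes
   sense. *)
have lmoo : \int[gauss n]_x (fine (q x) * lm x)%:E < +oo.
  apply: (@le_lt_trans _ _ (\int[gauss n]_x 1)); last by rewrite integral_probability_cst ltry.
  apply: ge0_le_integral => //.
  - by move=> x _; rewrite lee_fin mulr_ge0.
  - by apply/measurable_EFinP; exact: measurable_funM.
  move=> x _; rewrite lee_fin /lm; have := psi_ge0 (fine (q x)); rewrite /psi -/(L x).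
  by rewrite /Num.max; case: ifP => _; rewrite ?mulr0 ?mulrN; lra.
have decomp (u : n.-tuple R -> R) : measurable_fun setT u -> (forall x, 0 <= u x)%R ->
    \int[gauss n]_x (u x * lm x)%:E < +oo ->
    \int[gauss n]_x (u x * L x)%:E =
    \int[gauss n]_x (u x * lp x)%:E - \int[gauss n]_x (u x * lm x)%:E.
  move=> mu u0 uoo; apply: integral_decomposition => //.
  - exact: measurable_funM.
  - exact: measurable_funM.
  - by move=> x; exact: mulr_ge0.
  - by move=> x; exact: mulr_ge0.
  - by move=> x; rewrite LE mulrBr.
rewrite (decomp f)//; last by rewrite wm.
by rewrite (decomp (fun x => fine (q x)))// wp wm.
Qed.

Lemma nth_proj_coord (S : {set 'I_n}) (v : n.-tuple R) i : i \in S ->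
  nth 0%R (proj_coord S v) (index i (enum S)) = tnth v i.
Proof.
move=> iS; have ltS : (index i (enum S) < #|S|)%N by rewrite cardE index_mem mem_enum.
rewrite -[index _ _]/(val (Ordinal ltS)) -tnth_nth tnth_mktuple; congr tnth.
by rewrite /enum_val nth_index// mem_enum.
Qed.

Lemma marginal_mehler x : marginal s f (proj_coord (~: s) x) = fine (q x).
Proof.
rewrite /marginal; congr fine.
(* [marginal] integrates over tuples indexed by [~: ~: s]; these are projections of full tuples
   along [enum_val], and a full tuple is what [mehler] integrates over. *)
rewrite -(ge0_integral_gauss_proj n _ (@enum_val _ (mem (~: ~: s)))); last 3 first.
- exact: enum_val_inj.
- apply: (measurableT_comp mEf); apply: measurable_mktuple => i.
  case: (i \in ~: s) => //.
  exact: measurable_nth.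
- by move=> u; exact: Ef0.
apply: eq_integral => w _; congr (EFin (f _)); apply: eq_from_tnth => i.
rewrite !tnth_mktuple /indC; case: ifP => iS.
  rewrite nth_proj_coord//; move: iS; rewrite inE => /negbTE ->.
  by rewrite expr1n subrr sqrtr0 mul1r mul0r addr0.
rewrite (nth_proj_coord (~: ~: s)); last by rewrite inE iS.
move: iS; rewrite inE => /negbFE ->.
by rewrite expr0n subr0 sqrtr1 mul1r mul0r add0r.
Qed.

End Marginal.

Lemma gauss_invariant_integral (A : 'M[R]_n) (G : n.-tuple R -> \bar R) : gauss_invariant A ->
  measurable_fun setT G -> \int[gauss n]_x G (tup (A *m vec x)) = \int[gauss n]_x G x.
Proof.
move=> iA mG; rewrite integralE [RHS]integralE; congr (_ - _).
  rewrite -(iA _ (measurable_funepos mG) (funepos_ge0 _)).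
  by apply: eq_integral => x _; rewrite !funeposE.
rewrite -(iA _ (measurable_funeneg mG) (funeneg_ge0 _)).
by apply: eq_integral => x _; rewrite !funenegE.
Qed.

End EntropyOfSmoothing.

Theorem theorem4p1 (R : realType) (M N : nat)
  (h0 : M.-tuple R -> R)
  (h0_meas : measurable_fun setT h0)
  (h0_int : (gauss R M).-integrable setT (EFin \o h0))
  (h0_ge0 : forall v, 0 <= h0 v)
  (h0_S : (entropy h0 < +oo)%E)
  (k : nat) (alpha : 'I_k -> 'I_(M + N) * 'I_(M + N)) (theta : 'I_k -> R)
  (alpha_lt : forall l, ((alpha l).1 < (alpha l).2)%N)
  (U V : 'M[R]_M) (gamma : 'I_M -> R)
  (U_orth : orthogonal_mx U) (V_orth : orthogonal_mx V)
  (gamma01 : forall j, 0 <= gamma j <= 1)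
  (svd : A_k alpha theta = U *m diag_mx (\row_j gamma j) *m V^T) :
  (entropy (g_fun h0 U gamma) <=
   \sum_(sigma : {set 'I_M})
     ((\prod_(i in ~: sigma) gamma i ^+ 2)
        * (\prod_(j in sigma) (1 - gamma j ^+ 2)))%:E
     * \int[gauss R M]_v
         (h0 v * ln (marginal sigma (hU h0 U) (proj_coord (~: sigma) (tup (U^T *m vec v)))))%:E)%E.
Proof.
pose f := hU h0 U; pose h := EFin \o f.
have mf : measurable_fun setT f by exact: (measurableT_comp h0_meas (measurable_lin _ _ _)).
have f0 x : 0 <= f x by exact: h0_ge0.
have mh : measurable_fun setT h by exact/measurable_EFinP.
have hge0 x : (0 <= h x)%E by rewrite lee_fin.
have UT : orthogonal_mx U^T by split; rewrite trmxK; [exact: U_orth.2|exact: U_orth.1].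
have iU := gauss_invariant_orth _ _ U_orth; have iUT := gauss_invariant_orth _ _ UT.
have fU v : f (tup (U^T *m vec v)) = h0 v by rewrite /f /hU tupK mulmxA U_orth.2 mul1mx vecK.
have hoo : (\int[gauss R M]_x h x < +oo)%E.
  rewrite (gauss_invariant_integral U (EFin \o h0))//; last exact/measurable_EFinP.
  move/integrableP: h0_int => [_]; congr (_ < _)%E.
  by apply: eq_integral => x _; rewrite gee0_abs// lee_fin.
pose q c := mehler c h.
have mq c : measurable_fun setT (q c) by exact: measurable_mehler.
have q0 c v : (0 <= q c v)%E by exact: mehler_ge0.
have gE : g_fun h0 U gamma = fun v => fine (q gamma v).
  apply/funext => v; rewrite /g_fun; congr fine; apply: eq_integral => w _; congr (EFin (f _)).
  apply: eq_from_tnth => i; rewrite tnth_tup tnth_mktuple mxE !mul_diag_mx !mxE//.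
pose F c := (\int[gauss R M]_v Psi (q c v))%E.
have entE : (entropy (g_fun h0 U gamma) + 1 = F gamma)%E.
  have qoo : (\int[gauss R M]_v q gamma v < +oo)%E by rewrite integral_mehler.
  rewrite gE; exact: (entropy_shift _ (mq gamma) (q0 gamma) qoo).
pose J (s : {set 'I_M}) := (\int[gauss R M]_v
  (h0 v * ln (marginal s f (proj_coord (~: s) (tup (U^T *m vec v)))))%:E)%E.
(* The change of variables by [U^T] turns [h_0] into [f] and removes the rotation from the argument
   of the marginal. *)
have JE s : (J s + 1 = F (indC s))%E.
  apply: (eq_trans _ (integral_ln_marginal s f mf f0 hoo)); congr (_ + _)%E.
  pose G x := (f x * ln (fine (q (indC s) x)))%:E.
  have mG : measurable_fun setT G.
    apply/measurable_EFinP; apply: measurable_funM => //.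
    apply: (measurableT_comp (@measurable_ln R)).
    exact: (measurableT_comp (fine_measurable measurableT) (mq _)).
  rewrite -[RHS](gauss_invariant_integral U^T G iUT mG).
  by apply: eq_integral => v _; rewrite /G fU marginal_mehler.
have J1 s : (J s +? 1%:E)%E by rewrite /adde_def !andbF.
pose w (s : {set 'I_M}) := (\prod_(i in ~: s) gamma i ^+ 2) * (\prod_(j in s) (1 - gamma j ^+ 2)).
have F0 c : (0 <= F c)%E by apply: integral_ge0 => v _; exact: Psi_ge0.
have le : (F gamma <= \sum_(s : {set 'I_M}) (w s)%:E * F (indC s))%E.
  apply: (multiaffine_expansion_le F gamma F0 gamma01) => c i.
  exact: Psi_mehler_coord_le.
(* The weights sum to 1, so the shifts add up to a single 1, which cancels against the one attached
   to the entropy of [g_k]. *)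
have sumE : (\sum_(s : {set 'I_M}) (w s)%:E * F (indC s) = \sum_(s : {set 'I_M}) (w s)%:E * J s + 1)%E.
  transitivity (\sum_(s : {set 'I_M}) ((w s)%:E * J s + (w s)%:E))%E.
    by apply: eq_bigr => s _; rewrite -JE muleDr// mule1.
  by rewrite big_split/= sumEFin expansion_weights_sum.
by move: le; rewrite -entE sumE leeD2rE.
Qed.
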